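(* Let $n\ge 2$ be an integer and $p\in\{0,\dots,n\}$. (a) $(SLSym_n(p), g)$ is a homogeneous semi-Riemannian submanifold of $(GLSym_n(p), g)$ with signature $\left(\frac{n(n+1)}{2} - p(n-p) - 1,\ p(n-p)\right)$. (b) $(SLSym_n(p), g)$ is a totally geodesic submanifold of $(GLSym_n(p), g)$, whose geodesics are the curves $t \mapsto K\exp(tK^{-1}V)$ for every $K \in SLSym_n(p)$ and every $V \in Sym_n$ with $\mathrm{tr}(K^{-1}V) = 0$. In particular $(SLSym_n(p), g)$ is geodesically complete. (c) The inversion $\varphi$ and the congruences $\Gamma_C$ with $\det(C) = \pm 1$ are isometries of the symmetric manifold $(SLSym_n(p), g)$ and, for every $Q\in SLSym_n(p)$, $\varphi_Q$ is the symmetry fixing $Q$. (d) $(SLSym_n(p), g)$ is an Einstein manifold with Ricci tensor $Ric = -\frac{n}{4}\, g$ and with scalar curvature $S = -\frac{(n-1)n(n+2)}{8}$.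
   Context: $GL_n$ is the group of non-singular real $n\times n$ matrices; $Sym_n$ is the vector space of real symmetric $n\times n$ matrices. $GLSym_n(p)$ ($0\le p\le n$) is the set of non-singular matrices in $Sym_n$ with signature $(p,n-p)$ ($p$ positive and $n-p$ negative eigenvalues), an open subset of $Sym_n$; $SLSym_n(p)$ is the set of matrices in $GLSym_n(p)$ with determinant $(-1)^{n-p}$. The trace metric is $g_A(V,W)=\mathrm{tr}(A^{-1}VA^{-1}W)$ for tangent vectors $V,W$ at $A$; the same symbol denotes its restriction to submanifolds. The signature of a semi-Riemannian metric is the pair (number of positive, number of negative) signs. Homogeneous means that the isometry group acts transitively. For $C\in GL_n$: $\Gamma_C(A)=CAC^T$ (congruence), $\varphi(A)=A^{-1}$ (inversion), $\varphi_C(A)=(\Gamma_C\circ\varphi)(A)=CA^{-1}C^T$. The symmetry fixing a point $Q$ is an isometry that fixes $Q$ and whose differential at $Q$ is $-\mathrm{Id}$; a semi-Riemannian manifold is symmetric if it has such an isometry at each of its points. The usual sign convention for Ricci curvature is used (positive on round spheres). *)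

(* Defs.v *)
From mathcomp Require Import all_boot all_order all_algebra.
From mathcomp Require Import all_classical all_reals all_analysis.

Set Implicit Arguments.
Unset Strict Implicit.
Unset Printing Implicit Defensive.

Import Order.TTheory GRing.Theory Num.Theory.
Import numFieldNormedType.Exports.

Local Open Scope ring_scope.
Local Open Scope classical_set_scope.

Section SmoothMaps.
Context {R : realType}.

(* C^oo on U (meant for U open and V of finite dimension): every iterated
   directional derivative is differentiable, hence continuous, on U. *)
Definition smooth_on {V W : normedModType R} (U : set V) (f : V -> W) : Prop :=
  forall (vs : seq V) (x : V), U x ->
    differentiable (foldr (fun v h => 'D_v h) f vs) x.

(* Smoothness of a map on a subset M of V: local smooth extendability. Only the
   values of f on M matter. *)
Definition smooth_map {V W : normedModType R} (M : set V) (f : V -> W) : Prop :=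
  forall A, M A -> exists U : set V, exists F : V -> W,
    [/\ open U, U A, smooth_on U F & forall B, U B -> M B -> F B = f B].

Definition open_interval (I : set R) : Prop :=
  [/\ open I, is_interval I & I !=set0].

End SmoothMaps.

(* Semi-Riemannian geometry of (embedded) submanifolds M of the vector space
   'M[R]_n. Functions, vector fields and metrics on M are represented by total
   functions on 'M[R]_n of which only the values on M are relevant. *)
Section SemiRiemannian.
Context {R : realType} {n : nat}.
Local Notation E := 'M[R]_n.

Definition submanifold (d : nat) (M : set E) : Prop :=
  forall A, M A ->
    exists U V : set E, exists Phi Psi : E -> E, exists L : {vspace E},
    [/\ [/\ open U, U A & open V],
        smooth_on U Phi /\ (forall x, U x -> V (Phi x) /\ Psi (Phi x) = x),
        smooth_on V Psi /\ (forall y, V y -> U (Psi y) /\ Phi (Psi y) = y),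
        \dim L = d &
        forall x, U x -> (M x <-> Phi x \in L)].

Definition curve_through (M : set E) (A v : E) (c : R -> E) : Prop :=
  exists J : set R,
    [/\ open J, J 0, smooth_on J c, (forall t, J t -> M (c t)) &
        c 0 = A /\ c^`() 0 = v].

Definition tangent (M : set E) (A v : E) : Prop :=
  exists c, curve_through M A v c.

Definition tspace (M : set E) (A : E) : {vspace E} :=
  xget 0%VS [set L : {vspace E} | forall v, v \in L <-> tangent M A v].

(* The derivative of f : M -> W at A in the tangent direction v, computed along
   a chosen curve in M through A with velocity v. *)
Definition tderiv {W : normedModType R} (M : set E) (f : E -> W) (A v : E) : W :=
  (f \o xget (cst A) [set c | curve_through M A v c])^`() 0.

Definition vector_field (M : set E) (X : E -> E) : Prop :=
  smooth_map M X /\ forall A, M A -> tangent M A (X A).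

Definition bracket (M : set E) (X Y : E -> E) : E -> E :=
  fun A => tderiv M Y A (X A) - tderiv M X A (Y A).

Definition metric := E -> E -> E -> R.

(* b is a symmetric bilinear form on L which has an orthonormal basis with r
   positive and s negative signs; in particular b is nondegenerate on L. *)
Definition scalar_product (L : {vspace E}) (b : E -> E -> R) (r s : nat) : Prop :=
  [/\ forall u v, u \in L -> v \in L -> b u v = b v u,
      forall (a : R) u v w, u \in L -> v \in L -> w \in L ->
        b (a *: u + v) w = a * b u w + b v w &
      exists e : (r + s).-tuple E, basis_of L e /\
        forall i j : 'I_(r + s), b (tnth e i) (tnth e j) =
          if i == j then (if (i < r)%N then 1 else -1) else 0].

(* (M, g) is a semi-Riemannian manifold whose metric has signature (r, s). *)
Definition semi_riemannian (M : set E) (g : metric) (r s : nat) : Prop :=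
  [/\ submanifold (r + s) M,
      forall A, M A -> scalar_product (tspace M A) (g A) r s &
      forall X Y, vector_field M X -> vector_field M Y ->
        smooth_map M (fun A => g A (X A) (Y A) : R)].

Definition semi_riemannian_submanifold
    (M N : set E) (g : metric) (r s : nat) : Prop :=
  [/\ exists r' s', semi_riemannian N g r' s', M `<=` N & semi_riemannian M g r s].

Definition is_isometry (M : set E) (g : metric) (f : E -> E) : Prop :=
  [/\ smooth_map M f,
      forall A, M A -> M (f A),
      exists h : E -> E, smooth_map M h /\
        (forall A, M A -> [/\ M (h A), h (f A) = A & f (h A) = A]) &
      forall A v w, M A -> tangent M A v -> tangent M A w ->
        g (f A) (tderiv M f A v) (tderiv M f A w) = g A v w].

Definition homogeneous (M : set E) (g : metric) : Prop :=
  forall A B, M A -> M B -> exists f, is_isometry M g f /\ f A = B.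

Definition symmetry_at (M : set E) (g : metric) (Q : E) (f : E -> E) : Prop :=
  [/\ is_isometry M g f, f Q = Q & forall v, tangent M Q v -> tderiv M f Q v = - v].

Definition symmetric_manifold (M : set E) (g : metric) : Prop :=
  forall Q, M Q -> exists f, symmetry_at M g Q f.

Definition connection := (E -> E) -> (E -> E) -> E -> E.

Record is_levi_civita (M : set E) (g : metric) (D : connection) : Prop := {
  lc_field : forall X Y, vector_field M X -> vector_field M Y ->
    vector_field M (D X Y);
  lc_linear : forall (f : E -> R) X X' Y, smooth_map M f ->
    vector_field M X -> vector_field M X' -> vector_field M Y ->
    forall A, M A ->
      D (fun B => f B *: X B + X' B) Y A = f A *: D X Y A + D X' Y A;
  lc_add : forall X Y Y',
    vector_field M X -> vector_field M Y -> vector_field M Y' ->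
    forall A, M A -> D X (fun B => Y B + Y' B) A = D X Y A + D X Y' A;
  lc_leibniz : forall (f : E -> R) X Y, smooth_map M f ->
    vector_field M X -> vector_field M Y ->
    forall A, M A ->
      D X (fun B => f B *: Y B) A = tderiv M f A (X A) *: Y A + f A *: D X Y A;
  lc_torsion_free : forall X Y, vector_field M X -> vector_field M Y ->
    forall A, M A -> D X Y A - D Y X A = bracket M X Y A;
  lc_metric : forall X Y Z,
    vector_field M X -> vector_field M Y -> vector_field M Z ->
    forall A, M A ->
      tderiv M (fun B => g B (Y B) (Z B) : R) A (X A) =
      g A (D X Y A) (Z A) + g A (Y A) (D X Z A)
}.

(* The Levi-Civita connection: for a semi-Riemannian (M, g) such a D exists, and
   the values on M of D X Y, for vector fields X and Y on M, are unique (the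
   fundamental theorem of semi-Riemannian geometry). *)
Definition levi_civita (M : set E) (g : metric) : connection :=
  xget (fun _ _ _ => 0) [set D | is_levi_civita M g D].

Definition field_along (M : set E) (I : set R) (c Z : R -> E) : Prop :=
  smooth_on I Z /\ forall t, I t -> tangent M (c t) (Z t).

(* The characteristic properties of the covariant derivative P of vector fields
   along the curve c : I -> M. *)
Record is_covariant_derivative_along (M : set E) (g : metric)
    (I : set R) (c : R -> E) (P : (R -> E) -> R -> E) : Prop := {
  ca_field : forall Z, field_along M I c Z -> field_along M I c (P Z);
  ca_add : forall Z Z', field_along M I c Z -> field_along M I c Z' ->
    forall t, I t -> P (fun u => Z u + Z' u) t = P Z t + P Z' t;
  ca_leibniz : forall (h : R -> R) Z, smooth_on I h -> field_along M I c Z ->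
    forall t, I t -> P (fun u => h u *: Z u) t = (h^`() t)%classic *: Z t + h t *: P Z t;
  ca_restrict : forall X Y, vector_field M X -> vector_field M Y ->
    forall t, I t -> X (c t) = c^`() t ->
      P (Y \o c) t = levi_civita M g X Y (c t)
}.

Definition geodesic (M : set E) (g : metric) (I : set R) (c : R -> E) : Prop :=
  [/\ open_interval I, smooth_on I c, (forall t, I t -> M (c t)) &
      exists P, is_covariant_derivative_along M g I c P /\
        forall t, I t -> P (c^`()) t = 0].

Definition geodesically_complete (M : set E) (g : metric) : Prop :=
  forall I c, geodesic M g I c ->
    exists c', geodesic M g setT c' /\ forall t, I t -> c' t = c t.

(* The shape tensor of M in (N, g) vanishes: the ambient covariant derivative of
   fields which are tangent to M near A has no component normal to M at A. *)
Definition totally_geodesic (M N : set E) (g : metric) : Prop :=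
  forall (A : E) (U : set E) (X Y : E -> E), M A -> open U -> U A ->
    vector_field N X -> vector_field N Y ->
    (forall B, M B -> U B -> tangent M B (X B) /\ tangent M B (Y B)) ->
    tangent M A (levi_civita N g X Y A).

Definition curvature (M : set E) (g : metric) (X Y Z : E -> E) : E -> E :=
  let D := levi_civita M g in
  fun A => D X (D Y Z) A - D Y (D X Z) A - D (bracket M X Y) Z A.

Definition field_ext (M : set E) (A v : E) : E -> E :=
  xget (cst 0) [set X | vector_field M X /\ X A = v].

(* The curvature is tensorial, so that R_A(u, v)w can be computed from any
   extensions of u, v, w to vector fields. *)
Definition curvature_at (M : set E) (g : metric) (A u v w : E) : E :=
  curvature M g (field_ext M A u) (field_ext M A v) (field_ext M A w) A.

Definition trace_on (L : {vspace E}) (f : E -> E) : R :=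
  \sum_(i < \dim L) coord (vbasis L) i (f (vbasis L)`_i).

(* Sign convention: with R(u, v) = [D_u, D_v] - D_[u, v], the Ricci tensor
   Ric(v, w) = tr (u |-> R(u, v)w) is positive on round spheres. *)
Definition ricci (M : set E) (g : metric) (A v w : E) : R :=
  trace_on (tspace M A) (fun u => curvature_at M g A u v w).

(* The metric contraction g^{ij} Ric_{ij} of the Ricci tensor. *)
Definition scalar_curvature (M : set E) (g : metric) (A : E) : R :=
  let L := tspace M A in
  let G := \matrix_(i < \dim L, j < \dim L) g A (vbasis L)`_i (vbasis L)`_j in
  let Rc := \matrix_(i < \dim L, j < \dim L)
              ricci M g A (vbasis L)`_i (vbasis L)`_j in
  \tr (invmx G *m Rc).

Definition einstein (M : set E) (g : metric) (lam : R) : Prop :=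
  forall A v w, M A -> tangent M A v -> tangent M A w ->
    ricci M g A v w = lam * g A v w.

End SemiRiemannian.

Section SymmetricMatrices.
Context {R : realType} {n : nat}.
Local Notation E := 'M[R]_n.

(* A has p positive and q negative eigenvalues, counted with multiplicity. *)
Definition has_signature (A : E) (p q : nat) : Prop :=
  exists s : seq R,
    [/\ char_poly A = \prod_(x <- s) ('X - x%:P),
        count (fun x => 0 < x) s = p & count (fun x => x < 0) s = q].

Definition trace_metric : @metric R n :=
  fun A V W => \tr (invmx A *m V *m invmx A *m W).

Definition congruence (C A : E) : E := C *m A *m C^T.

Definition inversion (A : E) : E := invmx A.

Definition mxexp (X : E) : E :=
  limn (series (fun k : nat => (k`!%:R : R)^-1 *: X ^+ k)).

End SymmetricMatrices.

Definition GLSym (R : realType) (n p : nat) : set 'M[R]_n :=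
  [set A | [/\ A^T = A, A \in unitmx & has_signature A p (n - p)]].

Definition SLSym (R : realType) (n p : nat) : set 'M[R]_n :=
  [set A | GLSym p A /\ \det A = (-1) ^+ (n - p)].

(* Main.v *)
Require Import Defs.
From HB Require Import structures.
From mathcomp Require Import all_boot all_order all_algebra.
From mathcomp Require Import all_classical all_reals all_analysis.
From mathcomp Require Import ring lra.

Set Implicit Arguments.
Unset Strict Implicit.
Unset Printing Implicit Defensive.

Import Order.TTheory GRing.Theory Num.Theory.
Import numFieldNormedType.Exports.

Local Open Scope ring_scope.
Local Open Scope classical_set_scope.

(** The proof is computational: everything is expressed by the two formulas
[[
  D_X Y (A) = dY (X) - (X A^-1 Y + Y A^-1 X) / 2,
  R (u, v) w = - A [[A^-1 u, A^-1 v], A^-1 w] / 4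
]]
for the Levi-Civita connection and the curvature of the trace metric. They hold
on [GLSym p] and on [SLSym p] alike, and both manifolds are treated together.

The tangent space of [GLSym p] consists of the symmetric matrices, that of
[SLSym p] at [A] of those with [tr (A^-1 v) = 0] ([tangentP]): by Jacobi's formula
this is the differential of the condition on the determinant, and conversely
[t |-> K exp (t K^-1 V)] is a curve with velocity [V] which stays in the manifold,
since it equals [B^T K B] with [B = exp (t K^-1 V / 2)] and congruences preserve
the signature. This last fact is Sylvester's law of inertia, which is derived
together with its local constancy ([GLSym_open]) from the spectral theorem and
identifies [GLSym p] with the congruence class of a diagonal matrix of signs
([GLSymP]). A congruence therefore moves every point to every other one, and
calculations of signatures can be made at the diagonal matrix, where the
elementary symmetric matrices and a suitable orthonormal family of diagonal
matrices form an orthonormal basis ([scalar_product_tspace]). For charts of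
[SLSym p] one uses that the determinant is affine along a matrix of rank one, so
that it can replace a linear coordinate and the inverse chart is rational
([submanifold_SL]).

The formula for the connection satisfies the axioms because the differential of
[A^-1] is [- A^-1 v A^-1] ([g_levi_civita]), and the Koszul formula makes it
the only possible one ([levi_civita_uniq]). It preserves tangency to [SLSym p],
which is thus totally geodesic. Covariant derivatives along curves are unique as
well, since a field along a curve is a combination of restrictions of global
fields ([cov_uniq]); so geodesics are the solutions of [c'' = c' c^-1 c'], for
which [c^-1 c'] is constant, that is, the exponential curves above
([mxexp_of_geodesic]). Inserting the formula for the connection in the curvature
of arbitrary vector fields, the second derivatives cancel by their symmetry
([derive_comm]) and the formula for the curvature remains ([curvatureE]). The
Ricci tensor is the trace of a combination of operators [u |-> P u Q + Q^T u P^T]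
on symmetric matrices, whose trace is [tr P tr Q + tr (P Q^T)] ([symprod_trace]);
the scalar curvature is the factor [- n / 4] times the dimension. *)

(** * Calculus of smooth maps *)

Section SmoothCalculus.
Context {R : realType} {V : normedModType R}.
Implicit Types (U : set V) (x v : V).

(** Closure under products cannot be proved on [smooth_on] by induction on the
    list of directions, because differentiating a product creates a sum of two
    products; it can be proved by induction on an order of differentiability. *)
Definition smoothk {W : normedModType R} (k : nat) U (f : V -> W) : Prop :=
  forall (vs : seq V) x, (size vs <= k)%N -> U x ->
    differentiable (foldr (fun v h => 'D_v h) f vs) x.

Lemma smoothkP {W : normedModType R} U (f : V -> W) :
  smooth_on U f <-> forall k, smoothk k U f.
Proof.
split=> [fs k vs x _ Ux|fs vs x Ux]; first exact: fs.
exact: (fs (size vs)).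
Qed.

Lemma smoothk_le {W : normedModType R} U k l (f : V -> W) :
  (k <= l)%N -> smoothk l U f -> smoothk k U f.
Proof. by move=> kl fs vs x vsk; apply: fs; exact: leq_trans kl. Qed.

Lemma smoothk_diff {W : normedModType R} U k (f : V -> W) x :
  smoothk k U f -> U x -> differentiable f x.
Proof. by move=> fs Ux; exact: (fs [::]). Qed.

Lemma foldr_deriveE {W : normedModType R} (f : V -> W) v vs :
  foldr (fun v h => 'D_v h) f (rcons vs v) =
  foldr (fun v h => 'D_v h) ('D_v f) vs.
Proof. by rewrite -cats1 foldr_cat. Qed.

Lemma smoothkS {W : normedModType R} U k (f : V -> W) :
  smoothk k.+1 U f <->
  (forall x, U x -> differentiable f x) /\ forall v, smoothk k U ('D_v f).
Proof.
split=> [fs|[f0 fs]].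
  split=> [x Ux|v vs x vsk Ux]; first exact: smoothk_diff fs Ux.
  by rewrite -foldr_deriveE; apply: fs => //; rewrite size_rcons.
move=> vs x; case: (lastP vs) => [_ Ux|{}vs v]; first exact: f0.
by rewrite size_rcons ltnS foldr_deriveE => vsk Ux; exact: fs.
Qed.

Lemma smooth_on_diff {W : normedModType R} U (f : V -> W) x :
  smooth_on U f -> U x -> differentiable f x.
Proof. by move=> fs Ux; exact: (fs [::]). Qed.

Lemma smooth_on_derive {W : normedModType R} U (f : V -> W) v :
  smooth_on U f -> smooth_on U ('D_v f).
Proof. by move=> fs vs x Ux; rewrite -foldr_deriveE; exact: fs. Qed.

Lemma smooth_on_sub {W : normedModType R} U U' (f : V -> W) :
  U' `<=` U -> smooth_on U f -> smooth_on U' f.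
Proof. by move=> UU' fs vs x Ux; apply: fs; exact: UU'. Qed.

Lemma open_near U x (P : V -> Prop) :
  open U -> U x -> (forall y, U y -> P y) -> \forall y \near x, P y.
Proof. by move=> oU Ux UP; exact: filterS UP (open_nbhs_nbhs (conj oU Ux)). Qed.

Lemma near0_differentiable {W : normedModType R} (h : V -> W) x :
  (\near x, h x = 0) -> differentiable h x.
Proof.
move=> h0; have hx : h x = 0 by exact: nbhs_singleton h0.
apply/diffP.
apply: (@getPex _ (fun (dh : {linear V -> W}) => continuous dh /\
  forall y, h y = h (lim (nbhs x)) + dh (y - lim (nbhs x))
                  +o_(y \near x) (y - lim (nbhs x)))).
exists (\0 : {linear V -> W}); split; first exact: cst_continuous.
apply: eqaddoEx => y; rewrite lim_id // hx /= !add0r.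
rewrite littleoE //; move=> e e0; apply: filterS h0 => z ->.
by rewrite normr0 mulr_ge0 // ltW.
Qed.

Lemma near_eq_differentiable {W : normedModType R} (f g : V -> W) x :
  (\near x, f x = g x) -> differentiable f x -> differentiable g x.
Proof.
move=> fg df.
have -> : g = f + (g - f) by apply/funext => y; rewrite addrC subrK.
apply: differentiableD => //; apply: near0_differentiable.
by apply: filterS fg => y; rewrite !fctE => ->; rewrite subrr.
Qed.

Lemma smoothk_ext {W : normedModType R} U k (f g : V -> W) :
  open U -> (forall x, U x -> f x = g x) -> smoothk k U f -> smoothk k U g.
Proof.
move=> oU; elim: k f g => [|k IH] f g fg fs.
  move=> [|//] x _ Ux /=; apply: near_eq_differentiable (fs [::] x _ Ux) => //.
  exact: (open_near oU Ux).
have /smoothkS[f0 fv] := fs; apply/smoothkS; split=> [x Ux|v].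
  by apply: near_eq_differentiable (f0 x Ux); exact: (open_near oU Ux).
apply: IH (fv v) => x Ux; apply: near_eq_derive; exact: (open_near oU Ux).
Qed.

Lemma smooth_on_ext {W : normedModType R} U (f g : V -> W) :
  open U -> (forall x, U x -> f x = g x) -> smooth_on U f -> smooth_on U g.
Proof.
move=> oU fg /smoothkP fs; apply/smoothkP => k; exact: (smoothk_ext oU fg).
Qed.

Lemma differentiable_const {W : normedModType R} (a : W) x :
  differentiable (fun=> a) x.
Proof. exact: differentiable_cst. Qed.

Lemma smoothk_cst {W : normedModType R} U k (a : W) : smoothk k U (fun=> a).
Proof.
elim: k a => [|k IH] a; first by move=> [|//] x _ _; exact: differentiable_cst.
apply/smoothkS; split=> [x _|v]; first exact: differentiable_cst.
rewrite (_ : 'D_v _ = fun=> 0) //; apply/funext => x; exact: derive_cst.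
Qed.

Lemma deriveD' {W : normedModType R} (f g : V -> W) x v :
  differentiable f x -> differentiable g x ->
  'D_v (fun y => f y + g y) x = 'D_v f x + 'D_v g x.
Proof. by move=> df dg; rewrite -deriveD //; exact: diff_derivable. Qed.

Lemma smoothkD {W : normedModType R} U k (f g : V -> W) : open U ->
  smoothk k U f -> smoothk k U g -> smoothk k U (fun x => f x + g x).
Proof.
move=> oU; elim: k f g => [|k IH] f g fs gs.
  move=> [|//] x _ Ux /=; apply: differentiableD; [exact: (fs [::])|exact: (gs [::])].
have /smoothkS[f0 fv] := fs; have /smoothkS[g0 gv] := gs.
apply/smoothkS; split=> [x Ux|v].
  by apply: differentiableD; [exact: f0|exact: g0].
apply: smoothk_ext (IH _ _ (fv v) (gv v)) => // x Ux.
by rewrite deriveD' //; [exact: f0|exact: g0].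
Qed.

Lemma deriveMR (f g : V -> R) x v :
  differentiable f x -> differentiable g x ->
  'D_v (fun y => f y * g y) x = 'D_v f x * g x + f x * 'D_v g x.
Proof.
move=> df dg; rewrite -[fun y => _]/(f * g) deriveM;
  [|exact: diff_derivable|exact: diff_derivable].
by rewrite addrC mulrC.
Qed.

Lemma smoothkM U k (f g : V -> R) : open U ->
  smoothk k U f -> smoothk k U g -> smoothk k U (fun x => f x * g x).
Proof.
move=> oU; elim: k f g => [|k IH] f g fs gs.
  move=> [|//] x _ Ux /=; apply: differentiableM; [exact: (fs [::])|exact: (gs [::])].
have /smoothkS[f0 fv] := fs; have /smoothkS[g0 gv] := gs.
apply/smoothkS; split=> [x Ux|v].
  by apply: differentiableM; [exact: f0|exact: g0].
have fk := smoothk_le (leqnSn k) fs; have gk := smoothk_le (leqnSn k) gs.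
apply: smoothk_ext (smoothkD oU (IH _ _ (fv v) gk) (IH _ _ fk (gv v))) => // x Ux.
by rewrite deriveMR //; [exact: f0|exact: g0].
Qed.

Lemma smooth_on_cst {W : normedModType R} U (a : W) : smooth_on U (fun=> a).
Proof. by apply/smoothkP => k; exact: smoothk_cst. Qed.

Lemma smooth_onD {W : normedModType R} U (f g : V -> W) : open U ->
  smooth_on U f -> smooth_on U g -> smooth_on U (fun x => f x + g x).
Proof.
by move=> oU /smoothkP fs /smoothkP gs; apply/smoothkP => k; exact: smoothkD.
Qed.

Lemma smooth_onM U (f g : V -> R) : open U ->
  smooth_on U f -> smooth_on U g -> smooth_on U (fun x => f x * g x).
Proof.
by move=> oU /smoothkP fs /smoothkP gs; apply/smoothkP => k; exact: smoothkM.
Qed.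

Lemma smooth_on_sum {W : normedModType R} U (I : Type) (r : seq I) (P : pred I)
    (F : I -> V -> W) : open U -> (forall i, smooth_on U (F i)) ->
  smooth_on U (fun x => \sum_(i <- r | P i) F i x).
Proof.
move=> oU FS; elim: r => [|i r IH].
  by under [X in smooth_on _ X]funext do rewrite big_nil; exact: smooth_on_cst.
under [X in smooth_on _ X]funext do rewrite big_cons.
by case: (P i) => //; exact: smooth_onD.
Qed.

Lemma smooth_on_prod U (I : Type) (r : seq I) (P : pred I)
    (F : I -> V -> R) : open U -> (forall i, smooth_on U (F i)) ->
  smooth_on U (fun x => \prod_(i <- r | P i) F i x).
Proof.
move=> oU FS; elim: r => [|i r IH].
  by under [X in smooth_on _ X]funext do rewrite big_nil; exact: smooth_on_cst.
under [X in smooth_on _ X]funext do rewrite big_cons.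
by case: (P i) => //; exact: smooth_onM.
Qed.

Lemma smooth_onV U (f : V -> R) : open U -> (forall x, U x -> f x != 0) ->
  smooth_on U f -> smooth_on U (fun x => (f x)^-1).
Proof.
move=> oU fn0 fs; apply/smoothkP; elim=> [|k IH].
  move=> [|//] x _ Ux /=; apply: differentiableV; [exact: (fs [::])|exact: fn0].
apply/smoothkS; split=> [x Ux|v].
  by apply: differentiableV; [exact: (fs [::])|exact: fn0].
have /smoothkP fv := smooth_on_derive v fs.
have := smoothkM oU (smoothkM oU (@smoothk_cst R U k (-1)) (fv k))
  (smoothkM oU IH IH).
apply: smoothk_ext => // x Ux; rewrite deriveV; [|exact: fn0|].
  by rewrite -[_ *: _]/(_ * _) -exprVn expr2; ring.
apply: diff_derivable; exact: smooth_on_diff fs Ux.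
Qed.

Lemma linear_comp_derive {W W' : normedModType R} (L : {linear W -> W'})
    (f : V -> W) x v : continuous L -> differentiable f x ->
  'D_v (fun y => L (f y)) x = L ('D_v f x).
Proof.
move=> Lc df; have dL : differentiable L (f x) by exact: linear_differentiable.
rewrite deriveE; last exact: differentiable_comp.
by rewrite -[fun y => _]/(L \o f) diff_comp //= diff_lin // deriveE.
Qed.

Lemma smooth_on_linear_comp {W W' : normedModType R} (L : {linear W -> W'}) U
    (f : V -> W) : open U -> continuous L -> smooth_on U f ->
  smooth_on U (fun y => L (f y)).
Proof.
move=> oU Lc fs; apply/smoothkP => k.
have H (g : V -> W) x : smooth_on U g -> U x -> differentiable (fun y => L (g y)) x.
  move=> gs Ux; apply: differentiable_comp; first exact: (gs [::]).
  exact: linear_differentiable.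
elim: k f fs => [|k IH] f fs; first by move=> [|//] x _ Ux /=; exact: H.
apply/smoothkS; split=> [x Ux|v]; first exact: H.
apply: smoothk_ext (IH _ (smooth_on_derive v fs)) => // x Ux.
by rewrite linear_comp_derive //; exact: (fs [::]).
Qed.

Lemma smooth_onZ {W : normedModType R} U (f : V -> R) (w : W) : open U ->
  smooth_on U f -> smooth_on U (fun x => f x *: w).
Proof.
move=> oU fs.
have wlin : linear (fun a : R => a *: w).
  by move=> a b c; rewrite scalerDl scalerA.
pose L : {linear R -> W} := HB.pack (fun a : R => a *: w)
  (GRing.isLinear.Build _ _ _ _ _ wlin).
apply: (smooth_on_linear_comp (L := L) oU _ fs) => x; exact: scalel_continuous.
Qed.

Lemma smooth_on_id U : smooth_on U (@id V).
Proof.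
apply/smoothkP => k.
have H x : differentiable (@id V) x.
  by have [] := is_diff_id x.
case: k => [[]//|k].
apply/smoothkS; split=> [x _|v] //.
rewrite (_ : 'D_v _ = fun=> v); first exact: smoothk_cst.
by apply/funext => x; rewrite derive_id.
Qed.

End SmoothCalculus.

Lemma derive_comp {R : realType} {U V W : normedModType R} (f : U -> V)
    (g : V -> W) x v : differentiable f x -> differentiable g (f x) ->
  'D_v (fun y => g (f y)) x = 'D_('D_v f x) g (f x).
Proof.
move=> df dg; rewrite deriveE; last exact: differentiable_comp.
by rewrite -[fun y => _]/(g \o f) diff_comp //= !deriveE.
Qed.

Section Line.
Context {R : realType} {V : normedModType R}.

Lemma differentiable_line (w u : V) (s : R) :
  differentiable (fun s : R => w + s *: u) s.
Proof.
rewrite -[fun s => _]/(cst w + (fun s => s *: u)); apply: differentiableD.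
  refine (differentiable_const _ _).
by have [] := is_diff_scalel s u.
Qed.

Lemma derive_line (w u : V) (s : R) :
  'D_1 (fun s : R => w + s *: u) s = u.
Proof.
have [d E] := is_diff_scalel s u.
rewrite deriveD' //.
by rewrite derive_cst add0r deriveE // E scale1r.
Qed.

Lemma is_derive_line (W : normedModType R) (f : V -> W) (w u : V) (s : R) :
  differentiable f (w + s *: u) ->
  is_derive s 1 (fun s : R => f (w + s *: u)) ('D_u f (w + s *: u)).
Proof.
move=> df; have dl := differentiable_line w u s.
apply: DeriveDef.
  apply: diff_derivable; exact: (differentiable_comp dl df).
by rewrite (derive_comp (f := fun s : R => w + s *: u)) // derive_line.
Qed.

Lemma mvt_line (f : V -> R) (w u : V) (h : R) : 0 < h ->
  (forall s, 0 <= s <= h -> differentiable f (w + s *: u)) ->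
  exists2 s, 0 < s < h & f (w + h *: u) - f w = 'D_u f (w + s *: u) * h.
Proof.
move=> h0 df.
have d s : 0 <= s <= h -> is_derive s 1 (fun s : R => f (w + s *: u))
    ('D_u f (w + s *: u)) by move=> ?; apply: is_derive_line; exact: df.
have [||s] := @MVT _ (fun s : R => f (w + s *: u))
  (fun s => 'D_u f (w + s *: u)) 0 h h0.
- by move=> s; rewrite in_itv /= => /andP[s0 sh]; apply: d; rewrite !ltW.
- apply: derivable_within_continuous => s; rewrite in_itv /= => sh.
  by have [] := d s sh.
rewrite in_itv /= => sh; rewrite scale0r addr0 subr0 => E; by exists s.
Qed.

Lemma second_difference (U : set V) (f : V -> R) (u v x : V) (h : R) :
  smooth_on U f -> 0 < h ->
  (forall s t : R, 0 <= s <= h -> 0 <= t <= h -> U (x + s *: u + t *: v)) ->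
  exists s t : R, [/\ 0 <= s <= h, 0 <= t <= h &
    f (x + h *: u + h *: v) - f (x + h *: u) - (f (x + h *: v) - f x) =
    ('D_v ('D_u f) (x + s *: u + t *: v) : R) * h * h].
Proof.
move=> fs h0 dU.
have U0 (s : R) : 0 <= s <= h -> U (x + s *: u).
  move=> sh; have := dU s 0 sh; rewrite scale0r addr0; apply.
  by rewrite lexx ltW.
have h0h : 0 <= h <= h by apply/andP; split=> //; exact: ltW.
pose phi y := f (y + h *: v) - f y.
have dshift y : differentiable (fun y => y + h *: v) y.
  exact: differentiableD.
have dcomp y : U (y + h *: v) -> differentiable (fun y => f (y + h *: v)) y.
  move=> Uy; apply: (differentiable_comp (dshift y)).
  exact: smooth_on_diff fs Uy.
have dphi y : U y -> U (y + h *: v) -> differentiable phi y.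
  move=> Uy Uyv; apply: differentiableB; last exact: smooth_on_diff fs Uy.
  exact: dcomp.
have [s|s /andP[/ltW s0 /ltW sh] Es] := @mvt_line phi x u h h0.
  by move=> sh; apply: dphi; [exact: U0|exact: dU].
have s0h : 0 <= s <= h by rewrite s0.
have [t|t /andP[/ltW t0 /ltW th] Et] := @mvt_line ('D_u f) (x + s *: u) v h h0.
  by move=> th; apply: smooth_on_diff (smooth_on_derive u fs) _; exact: dU.
exists s, t; split; rewrite ?s0 ?t0 // -Et.
rewrite -[LHS]/(phi (x + h *: u) - phi x) Es; congr (_ * _).
have Us : U (x + s *: u) by exact: U0.
have Usv : U (x + s *: u + h *: v) by exact: dU.
rewrite -[phi]/((fun y => f (y + h *: v)) - f) deriveB.
- congr (_ - _); rewrite (derive_comp (f := fun y => y + h *: v)) //.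
    rewrite (deriveD' (f := id)) //.
    by rewrite derive_id derive_cst addr0.
  exact: smooth_on_diff fs Usv.
- by apply: diff_derivable; exact: dcomp.
- by apply: diff_derivable; exact: smooth_on_diff fs Us.
Qed.

Lemma le_dist_common (a b c k : R) :
  `|a - b| <= k / 2 -> `|c - b| <= k / 2 -> `|c - a| <= k.
Proof.
by rewrite !ler_norml => /andP[? ?] /andP[? ?]; apply/andP; split; lra.
Qed.

(** Both iterated derivatives are limits of the second difference of [f] on a
    small parallelogram: the mean value theorem, applied once in each
    direction, turns this difference into [h ^+ 2] times a value of either
    iterated derivative close to [x]. *)
Lemma derive_comm (U : set V) (f : V -> R) (u v x : V) :
  open U -> U x -> smooth_on U f -> 'D_u ('D_v f) x = 'D_v ('D_u f) x.
Proof.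
move=> oU Ux fs.
pose F : V -> R := 'D_v ('D_u f); pose G : V -> R := 'D_u ('D_v f).
have cF : {for x, continuous F}.
  exact/differentiable_continuous/(fs [:: v; u]).
have cG : {for x, continuous G}.
  exact/differentiable_continuous/(fs [:: u; v]).
apply/eqP; rewrite -subr_eq0 -normr_le0; apply/ler_addgt0Pr => e e0.
rewrite add0r.
have e20 : 0 < e / 2 by rewrite divr_gt0.
have /nbhs_ballP[d d0 dU] : nbhs x U by exact: open_nbhs_nbhs.
have /cvgrPdist_le/(_ _ e20)/nbhs_ballP[d1 d10 d1F] := cF.
have /cvgrPdist_le/(_ _ e20)/nbhs_ballP[d2 d20 d2G] := cG.
pose D : R := Num.min d (Num.min d1 d2).
have D0 : 0 < D by rewrite /D !lt_min d0 d10 d20.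
pose h : R := D / (`|u| + `|v| + 1).
have n0 : 0 < `|u| + `|v| + 1 by rewrite ltr_wpDl // addr_ge0.
have h0 : 0 < h by rewrite divr_gt0.
have inb s t : 0 <= s <= h -> 0 <= t <= h -> ball x D (x + s *: u + t *: v).
  move=> /andP[s0 sh] /andP[t0 th]; rewrite -ball_normE /ball_ /=.
  rewrite -addrA opprD addrA subrr add0r normrN.
  apply: le_lt_trans (ler_normD _ _) _; rewrite !normrZ !ger0_norm //.
  have -> : D = h * (`|u| + `|v| + 1) by rewrite /h divfK // gt_eqF.
  rewrite !mulrDr mulr1; apply: ltr_pwDr => //.
  by rewrite lerD // ler_wpM2r.
have dU' s t : 0 <= s <= h -> 0 <= t <= h -> U (x + s *: u + t *: v).
  by move=> sh th; apply: dU; apply: le_ball (inb s t sh th); rewrite ge_min lexx.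
have [s1 [t1 [s1h t1h E1]]] := second_difference fs h0 dU'.
have [|s2 [t2 [s2h t2h E2]]] := @second_difference U f v u x h fs h0.
  by move=> s t sh th; rewrite addrAC; exact: dU'.
rewrite -/F -/G in E1 E2.
have FG : F (x + s1 *: u + t1 *: v) = G (x + s2 *: v + t2 *: u).
  have aux (a b c k : R) : a - b - (c - k) = a - c - (b - k) by ring.
  have aux2 (a b k : R) : a * k * k = b * k * k -> k != 0 -> a = b.
    by move=> E k0; apply: (mulIf k0); exact: (mulIf k0).
  move: E1 E2; rewrite [x + h *: v + _]addrAC aux => ->.
  by move/aux2; apply; rewrite gt_eqF.
rewrite -[X in `|X|]/(G x - F x).
have H1 : `|F x - F (x + s1 *: u + t1 *: v)| <= e / 2.
  by apply: d1F; apply: le_ball (inb _ _ s1h t1h); rewrite !ge_min lexx !orbT.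
have H2 : `|G x - G (x + s2 *: v + t2 *: u)| <= e / 2.
  apply: d2G; rewrite addrAC; apply: le_ball (inb _ _ t2h s2h).
  by rewrite !ge_min lexx !orbT.
by rewrite -FG in H2; exact: le_dist_common H1 H2.
Qed.
End Line.

(** * Matrix-valued maps *)

Section MatrixCalculus.
Context {R : realType}.

Lemma differentiable_sumf {V W : normedModType R} k (F : 'I_k -> V -> W) (x : V) :
  (forall i, differentiable (F i) x) ->
  differentiable (fun y => \sum_i F i y) x.
Proof. by move=> FS; rewrite -fct_sumE; exact: differentiable_sum. Qed.

Lemma continuous_linear_mx {m n : nat} {W : normedModType R}
    (L : {linear 'M[R]_(m, n) -> W}) : continuous L.
Proof.
have -> : (L : _ -> _) =
    (fun A => \sum_i \sum_j (A i j) *: L (delta_mx i j)).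
  apply/funext => A; rewrite {1}[A]matrix_sum_delta linear_sum /=.
  apply: eq_bigr => i _; rewrite linear_sum /=; apply: eq_bigr => j _.
  by rewrite linearZ.
move=> A; apply: differentiable_continuous.
apply: differentiable_sumf => i; apply: differentiable_sumf => j.
by apply: differentiableZl; exact: differentiable_coord.
Qed.

Lemma entry_linear {m n : nat} (i : 'I_m) (j : 'I_n) :
  linear (fun A : 'M[R]_(m, n) => A i j : R).
Proof. by move=> a A B; rewrite !mxE. Qed.

Definition entry {m n : nat} (i : 'I_m) (j : 'I_n) :
  {linear 'M[R]_(m, n) -> R} :=
  HB.pack (fun A : 'M[R]_(m, n) => A i j : R)
    (GRing.isLinear.Build _ _ _ _ _ (entry_linear i j)).

Section Maps.
Context {V : normedModType R}.
Implicit Types (U : set V) (x v : V).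

Lemma smooth_on_linear_mx {m n : nat} {W : normedModType R}
    (L : {linear 'M[R]_(m, n) -> W}) U (f : V -> 'M[R]_(m, n)) :
  open U -> smooth_on U f -> smooth_on U (fun x => L (f x)).
Proof. by move=> oU; apply: smooth_on_linear_comp => //; exact: continuous_linear_mx. Qed.

Lemma derive_linear_mx {m n : nat} {W : normedModType R}
    (L : {linear 'M[R]_(m, n) -> W}) (f : V -> 'M[R]_(m, n)) x v :
  differentiable f x -> 'D_v (fun y => L (f y)) x = L ('D_v f x).
Proof. by move=> df; apply: linear_comp_derive => //; exact: continuous_linear_mx. Qed.

Lemma differentiable_linear_mx {m n : nat} {W : normedModType R}
    (L : {linear 'M[R]_(m, n) -> W}) (f : V -> 'M[R]_(m, n)) x :
  differentiable f x -> differentiable (fun y => L (f y)) x.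
Proof.
move=> df; apply: differentiable_comp => //; apply: linear_differentiable.
exact: continuous_linear_mx.
Qed.

Lemma smooth_on_entry {m n : nat} U (f : V -> 'M[R]_(m, n)) i j :
  open U -> smooth_on U f -> smooth_on U (fun x => f x i j : R).
Proof. by move=> oU fs; exact: (smooth_on_linear_mx (entry i j)). Qed.

Lemma derive_entry {m n : nat} (f : V -> 'M[R]_(m, n)) i j x v :
  differentiable f x -> 'D_v (fun y => f y i j : R) x = ('D_v f x) i j.
Proof. by move=> df; exact: (derive_linear_mx (entry i j)). Qed.

Lemma differentiable_entry {m n : nat} (f : V -> 'M[R]_(m, n)) i j x :
  differentiable f x -> differentiable (fun y => f y i j : R) x.
Proof. exact: (differentiable_linear_mx (entry i j)). Qed.

Lemma smooth_on_mx {m n : nat} U (f : V -> 'M[R]_(m, n)) : open U ->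
  (forall i j, smooth_on U (fun x => f x i j : R)) -> smooth_on U f.
Proof.
move=> oU fs.
have -> : f = (fun x => \sum_i \sum_j f x i j *: delta_mx i j).
  by apply/funext => x; rewrite -matrix_sum_delta.
apply: smooth_on_sum => // i; apply: smooth_on_sum => // j.
exact: smooth_onZ.
Qed.

Lemma differentiable_mx {m n : nat} (f : V -> 'M[R]_(m, n)) x :
  (forall i j, differentiable (fun x => f x i j : R) x) -> differentiable f x.
Proof.
move=> fs.
have -> : f = (fun x => \sum_i \sum_j f x i j *: delta_mx i j).
  by apply/funext => y; rewrite -matrix_sum_delta.
apply: differentiable_sumf => i; apply: differentiable_sumf => j.
exact: differentiableZl.
Qed.

Lemma derive_sumf {W : normedModType R} k (F : 'I_k -> V -> W) x v :
  (forall i, differentiable (F i) x) ->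
  'D_v (fun y => \sum_i F i y) x = \sum_i 'D_v (F i) x.
Proof.
move=> FS; rewrite -fct_sumE derive_sum // => i; exact: diff_derivable.
Qed.

Lemma smooth_on_mulmx {m n p : nat} U (f : V -> 'M[R]_(m, n))
    (g : V -> 'M[R]_(n, p)) : open U ->
  smooth_on U f -> smooth_on U g -> smooth_on U (fun x => f x *m g x).
Proof.
move=> oU fs gs; apply: smooth_on_mx => // i k.
under [X in smooth_on _ X]funext do rewrite mxE.
by apply: smooth_on_sum => // j; apply: smooth_onM => //; exact: smooth_on_entry.
Qed.

Lemma differentiable_mulmx {m n p : nat} (f : V -> 'M[R]_(m, n))
    (g : V -> 'M[R]_(n, p)) x :
  differentiable f x -> differentiable g x ->
  differentiable (fun x => f x *m g x) x.
Proof.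
move=> df dg; apply: differentiable_mx => i k.
under [X in differentiable X _]funext do rewrite mxE.
apply: differentiable_sumf => j.
by apply: differentiableM; exact: differentiable_entry.
Qed.

Lemma derive_mulmx {m n p : nat} (f : V -> 'M[R]_(m, n))
    (g : V -> 'M[R]_(n, p)) x v :
  differentiable f x -> differentiable g x ->
  'D_v (fun x => f x *m g x) x = 'D_v f x *m g x + f x *m 'D_v g x.
Proof.
move=> df dg; apply/matrixP => i k.
rewrite -derive_entry; last exact: differentiable_mulmx.
under [X in 'D_v X _]funext do rewrite mxE.
rewrite derive_sumf; last first.
  by move=> j; apply: differentiableM; exact: differentiable_entry.
rewrite !mxE -big_split; apply: eq_bigr => j _ /=.
by rewrite deriveMR ?derive_entry //; exact: differentiable_entry.
Qed.

Lemma smooth_on_scale {m n : nat} U (a : V -> R) (f : V -> 'M[R]_(m, n)) :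
  open U -> smooth_on U a -> smooth_on U f -> smooth_on U (fun x => a x *: f x).
Proof.
move=> oU as_ fs; apply: smooth_on_mx => // i j.
under [X in smooth_on _ X]funext do rewrite mxE.
by apply: smooth_onM => //; exact: smooth_on_entry.
Qed.

Lemma differentiable_scale {m n : nat} (a : V -> R) (f : V -> 'M[R]_(m, n)) x :
  differentiable a x -> differentiable f x ->
  differentiable (fun x => a x *: f x) x.
Proof.
move=> da df; apply: differentiable_mx => i j.
under [X in differentiable X _]funext do rewrite mxE.
by apply: differentiableM => //; exact: differentiable_entry.
Qed.

Lemma derive_scale {m n : nat} (a : V -> R) (f : V -> 'M[R]_(m, n)) x v :
  differentiable a x -> differentiable f x ->
  'D_v (fun x => a x *: f x) x = 'D_v a x *: f x + a x *: 'D_v f x.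
Proof.
move=> da df; apply/matrixP => i j.
rewrite -derive_entry; last exact: differentiable_scale.
under [X in 'D_v X _]funext do rewrite mxE.
rewrite deriveMR // ?derive_entry ?mxE //; exact: differentiable_entry.
Qed.

Lemma smooth_on_tr {m n : nat} U (f : V -> 'M[R]_(m, n)) : open U ->
  smooth_on U f -> smooth_on U (fun x => (f x)^T).
Proof. by move=> oU; exact: (smooth_on_linear_mx (@trmx R m n)). Qed.

Lemma smooth_on_mxtrace {n : nat} U (f : V -> 'M[R]_n) : open U ->
  smooth_on U f -> smooth_on U (fun x => \tr (f x)).
Proof. by move=> oU; exact: (smooth_on_linear_mx (@mxtrace R n)). Qed.

Lemma smooth_on_det {n : nat} U (f : V -> 'M[R]_n) : open U ->
  smooth_on U f -> smooth_on U (fun x => \det (f x)).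
Proof.
move=> oU fs; apply: smooth_on_sum => // s; apply: smooth_onM => //.
  exact: smooth_on_cst.
by apply: smooth_on_prod => // i; exact: smooth_on_entry.
Qed.

End Maps.

Lemma derive_comm_mx {V : normedModType R} {m n : nat} (U : set V)
    (f : V -> 'M[R]_(m, n)) (u v x : V) :
  open U -> U x -> smooth_on U f -> 'D_u ('D_v f) x = 'D_v ('D_u f) x.
Proof.
move=> oU Ux fs; apply/matrixP => i j.
have fd y w : U y -> differentiable ('D_w f) y.
  by move=> Uy; exact: (fs [:: w]).
have E w w' : ('D_w ('D_w' f) x) i j = 'D_w ('D_w' (fun y => f y i j : R)) x.
  rewrite -derive_entry; last exact: fd.
  apply: near_eq_derive; apply: (open_near oU Ux) => y Uy.
  by rewrite derive_entry //; exact: smooth_on_diff fs Uy.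
apply: etrans (E u v) (etrans _ (esym (E v u))).
exact: (derive_comm u v oU Ux (smooth_on_entry i j oU fs)).
Qed.

End MatrixCalculus.

Lemma near_differentiable {R : realType} {V W : normedModType R} (f : V -> W)
    (U : set W) (x : V) : differentiable f x -> open U -> U (f x) ->
  \forall y \near x, U (f y).
Proof.
move=> df oU Ufx; have H := differentiable_continuous df.
by apply: (H U); exact: open_nbhs_nbhs.
Qed.

Section DetInverse.
Context {R : realType} {n : nat}.
Local Notation E := 'M[R]_n.

Lemma differentiable_det (A : E) : differentiable (fun A : E => \det A : R) A.
Proof.
apply: (smooth_on_diff (U := setT)) => //.
by apply: smooth_on_det; [exact: openT|exact: smooth_on_id].
Qed.

Lemma det_line_delta (i j : 'I_n) (s : R) :
  \det (1%:M + s *: delta_mx i j) = 1 + s *: (i == j)%:R :> R.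
Proof.
have H (i' j' : 'I_n) : (j' <= i')%N ->
    \det (1%:M + s *: delta_mx i' j') = 1 + s *: (i' == j')%:R :> R.
  move=> ji; rewrite det_trig; last first.
    apply/is_trig_mxP => a b ab; rewrite !mxE.
    have -> : (a == b) = false by apply/negbTE; rewrite neq_ltn ab.
    case: (a =P i') => [ai|_]; case: (b =P j') => [bj|_]; rewrite ?mulr0 ?addr0 //.
    by move: ab; rewrite ai bj ltnNge ji.
  have [<-|ij] := eqVneq i' j'.
    rewrite (bigD1 i') //= !mxE !eqxx mulr1 big1 ?mulr1 //.
      by rewrite /GRing.scale /= mulr1.
    by move=> k ki; rewrite !mxE !eqxx (negbTE ki) mulr0 addr0.
  rewrite scaler0 addr0 big1 // => k _; rewrite !mxE eqxx.
  case: (k =P i') => [->|_]; last by rewrite mulr0 addr0.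
  by rewrite (negbTE ij) mulr0 addr0.
have [ji|/ltnW ij] := leqP j i; first exact: H.
rewrite -det_tr linearD linearZ /= trmx1 trmx_delta H //.
by rewrite eq_sym.
Qed.

(** A linear form on matrices is determined by its values on elementary
    matrices, and along an elementary direction the determinant is affine. *)
Lemma derive_det1 (V : E) : 'D_V (fun A : E => \det A : R) 1%:M = \tr V.
Proof.
have d1 := differentiable_det 1%:M.
rewrite deriveE // {1}[V]matrix_sum_delta linear_sum /= /mxtrace.
apply: eq_bigr => i _; rewrite linear_sum (bigD1 i) //= big1.
  rewrite addr0 linearZ /= -deriveE //.
  suff -> : 'D_(delta_mx i i) (fun A : E => \det A : R) 1%:M = 1.
    by rewrite /GRing.scale /= mulr1.
  have := @is_derive_line R E R (fun A : E => \det A : R) 1%:M (delta_mx i i) 0.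
  rewrite scale0r addr0 => /(_ d1) [_ <-].
  under [X in 'D__ X _]funext do rewrite det_line_delta eqxx.
  by rewrite derive_line.
move=> j ji; rewrite linearZ /= -deriveE //.
suff -> : 'D_(delta_mx i j) (fun A : E => \det A : R) 1%:M = 0.
  by rewrite scaler0.
have := @is_derive_line R E R (fun A : E => \det A : R) 1%:M (delta_mx i j) 0.
rewrite scale0r addr0 => /(_ d1) [_ <-].
under [X in 'D__ X _]funext do rewrite det_line_delta eq_sym (negbTE ji).
by rewrite derive_line.
Qed.

Section Maps.
Context {V : normedModType R}.
Implicit Types (U : set V) (x v : V) (f : V -> E).

Lemma derive_det f x v : differentiable f x -> f x \in unitmx ->
  'D_v (fun y => \det (f y) : R) x =
  \det (f x) * \tr (invmx (f x) *m 'D_v f x).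
Proof.
move=> df fu.
have -> : (fun y => \det (f y) : R) =
    (fun y => \det (f x) * \det (invmx (f x) *m f y)).
  by apply/funext => y; rewrite -det_mulmx mulKVmx.
have dif : differentiable (fun y => invmx (f x) *m f y) x.
  by apply: differentiable_mulmx.
have ddet := differentiable_det (invmx (f x) *m f x).
rewrite deriveMR //; last first.
  exact: (differentiable_comp dif ddet).
rewrite derive_cst mul0r add0r.
rewrite (derive_comp (f := fun y => invmx (f x) *m f y)) //; congr (_ * _).
by rewrite mulVmx // derive_det1 derive_mulmx // derive_cst mul0mx add0r.
Qed.

Lemma open_unitmx : open [set A : E | A \in unitmx].
Proof.
have -> : [set A : E | A \in unitmx] =
    (fun A : E => \det A : R) @^-1` [set x : R | x != 0].
  by apply/seteqP; split=> A /=; rewrite unitmxE unitfE.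
apply: open_comp; last exact: open_neq.
by move=> A _; exact/differentiable_continuous/differentiable_det.
Qed.

Lemma invmxE (A : E) : A \in unitmx -> invmx A = (\det A)^-1 *: \adj A.
Proof. by move=> Au; rewrite /invmx Au. Qed.

Lemma smooth_on_invmx U f : open U -> (forall x, U x -> f x \in unitmx) ->
  smooth_on U f -> smooth_on U (fun x => invmx (f x)).
Proof.
move=> oU fu fs.
apply: (@smooth_on_ext _ _ _ U (fun x => (\det (f x))^-1 *: \adj (f x))) => //.
  by move=> x Ux; rewrite invmxE // fu.
apply: smooth_on_scale => //.
  apply: smooth_onV => //; last exact: smooth_on_det.
  by move=> x /fu; rewrite unitmxE unitfE.
apply: smooth_on_mx => // i j.
under [X in smooth_on _ X]funext do rewrite mxE /cofactor.
apply: smooth_onM => //; first exact: smooth_on_cst.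
apply: smooth_on_det => //; apply: smooth_on_mx => // k l.
under [X in smooth_on _ X]funext do rewrite !mxE.
exact: smooth_on_entry.
Qed.

End Maps.

Lemma differentiable_invmx (A : E) : A \in unitmx ->
  differentiable (fun A : E => invmx A) A.
Proof.
move=> Au; apply: (smooth_on_diff (U := [set A : E | A \in unitmx])) => //.
apply: smooth_on_invmx => //; [exact: open_unitmx|exact: smooth_on_id].
Qed.

Lemma derive_invmx {V : normedModType R} (f : V -> E) x v :
  differentiable f x -> f x \in unitmx ->
  'D_v (fun y => invmx (f y)) x =
  - (invmx (f x) *m 'D_v f x *m invmx (f x)).
Proof.
move=> df fu.
have di : differentiable (fun y => invmx (f y)) x.
  exact: (differentiable_comp df (differentiable_invmx fu)).
have : 'D_v (fun y => f y *m invmx (f y)) x = 0.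
  rewrite -[RHS](derive_cst (1%:M : E) x v); apply: near_eq_derive.
  have : \forall y \near x, f y \in unitmx.
    exact: (near_differentiable df open_unitmx).
  by apply: filterS => y fy; rewrite mulmxV.
rewrite derive_mulmx // => /(congr1 (mulmx (invmx (f x)))).
rewrite mulmx0 mulmxDr mulKmx // mulmxA addrC => /eqP.
by rewrite addr_eq0 => /eqP.
Qed.

Lemma differentiable_invmx_comp {V : normedModType R} (f : V -> E) x :
  differentiable f x -> f x \in unitmx ->
  differentiable (fun y => invmx (f y)) x.
Proof.
by move=> df fu; exact: (differentiable_comp df (differentiable_invmx fu)).
Qed.

(** On a space of matrices, the derivative in a variable direction is a
    combination of finitely many derivatives in constant directions. *)
Lemma smooth_on_derive_along {m k : nat} (U : set E) (X : E -> E)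
    (Y : E -> 'M[R]_(m, k)) : open U -> smooth_on U X -> smooth_on U Y ->
  smooth_on U (fun A => 'D_(X A) Y A).
Proof.
move=> oU Xs Ys.
apply: (@smooth_on_ext _ _ _ U
  (fun A => \sum_i \sum_j X A i j *: 'D_(delta_mx i j) Y A)) => //.
  move=> A UA; have dY := smooth_on_diff Ys UA.
  rewrite [in RHS](matrix_sum_delta (X A)) deriveE // linear_sum.
  apply: eq_bigr => i _; rewrite linear_sum; apply: eq_bigr => j _.
  by rewrite linearZ -deriveE.
apply: smooth_on_sum => // i; apply: smooth_on_sum => // j.
apply: smooth_on_scale => //; first exact: smooth_on_entry.
exact: smooth_on_derive.
Qed.

End DetInverse.

(** * Symmetric matrices and their signature *)

Section Spectral.
Context {R : realType}.

Definition qform {n : nat} (A : 'M[R]_n) (x : 'rV[R]_n) : R :=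
  (x *m A *m x^T) ord0 ord0.

Lemma qformD {n : nat} (A : 'M[R]_n) x y : A^T = A ->
  qform A (x + y) = qform A x + 2 * (x *m A *m y^T) ord0 ord0 + qform A y.
Proof.
move=> As.
have sym : (y *m A *m x^T) ord0 ord0 = (x *m A *m y^T) ord0 ord0.
  have -> : y *m A *m x^T = (x *m A *m y^T)^T by rewrite !trmx_mul trmxK As mulmxA.
  by rewrite mxE.
have entryD (B C : 'M[R]_1) : (B + C) ord0 ord0 = B ord0 ord0 + C ord0 ord0.
  by rewrite mxE.
by rewrite /qform linearD /= !mulmxDl !mulmxDr !entryD sym; ring.
Qed.

Lemma qformZ {n : nat} (A : 'M[R]_n) a x : qform A (a *: x) = a ^+ 2 * qform A x.
Proof.
by rewrite /qform linearZ /= -!scalemxAl -scalemxAr !mxE mulrA -expr2.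
Qed.

Lemma mulmx_trE {n : nat} (x : 'rV[R]_n) : x *m x^T = (qform 1%:M x)%:M.
Proof.
apply/matrixP => i j; rewrite !ord1 /qform mulmx1 [RHS]mxE eqxx mulr1n.
by rewrite !ord1.
Qed.

Lemma qform1E {n : nat} (x : 'rV[R]_n) : qform 1%:M x = \sum_j x ord0 j ^+ 2.
Proof.
by rewrite /qform mulmx1 mxE; apply: eq_bigr => j _; rewrite mxE -expr2.
Qed.

Lemma qform1_ge0 {n : nat} (x : 'rV[R]_n) : 0 <= qform 1%:M x.
Proof. by rewrite qform1E; apply: sumr_ge0 => j _; exact: sqr_ge0. Qed.

Lemma qform1_eq0 {n : nat} (x : 'rV[R]_n) : qform 1%:M x = 0 -> x = 0.
Proof.
rewrite qform1E => /eqP; rewrite psumr_eq0; last by move=> j _; exact: sqr_ge0.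
move=> /allP H; apply/rowP => j; rewrite mxE; apply/eqP.
by have := H j (mem_index_enum j); rewrite sqrf_eq0.
Qed.

Lemma qform1_gt0 {n : nat} (x : 'rV[R]_n) : x != 0 -> 0 < qform 1%:M x.
Proof.
move=> x0; rewrite lt_def qform1_ge0 andbT; apply: contra x0 => /eqP.
by move=> /qform1_eq0 ->.
Qed.

Lemma differentiable_qform {n : nat} (A : 'M[R]_n) x : differentiable (qform A) x.
Proof.
apply: (smooth_on_diff (U := setT)) => //.
apply: (@smooth_on_entry _ _ 1 1 setT (fun x => x *m A *m x^T)); first exact: openT.
have idS : smooth_on setT (@id 'rV[R]_n) by exact: smooth_on_id.
apply: smooth_on_mulmx; [exact: openT| |apply: smooth_on_tr => //; exact: openT].
by apply: smooth_on_mulmx => //; [exact: openT|exact: smooth_on_cst].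
Qed.

Lemma compact_sphere (n : nat) : compact [set x : 'rV[R]_n | qform 1%:M x = 1].
Proof.
apply: bounded_closed_compact.
  exists 1; split; first exact: num_real.
  move=> M M1 x /= x1; apply: le_trans (ltW M1).
  rewrite /Num.Def.normr /= mx_normrE; apply: bigmax_le => // -[i j] _ /=.
  rewrite (ord1 i) -[1]normr1 -ler_sqr ?nnegrE // !real_normK ?num_real //.
  rewrite expr1n -x1 qform1E (bigD1 j) //= lerDl.
  by apply: sumr_ge0 => k _; exact: sqr_ge0.
have -> : [set x : 'rV[R]_n | qform 1%:M x = 1] = qform 1%:M @^-1` [set y | y = 1].
  by [].
apply: preimage_closed; last exact: closed_eq.
by move=> x _; exact/differentiable_continuous/differentiable_qform.
Qed.

(** A maximum of the quadratic form on the unit sphere is an eigenvector: the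
    form [qform (lam%:M - A)] is nonnegative and vanishes there, hence so does
    its differential. *)
Lemma exists_eigenvector {n : nat} (A : 'M[R]_n.+1) : A^T = A ->
  exists (lam : R) (v : 'rV[R]_n.+1), v *m v^T = 1%:M /\ v *m A = lam *: v.
Proof.
move=> As; pose S := [set x : 'rV[R]_n.+1 | qform 1%:M x = 1].
have S0 : S !=set0.
  exists (delta_mx 0 0); rewrite /S /= qform1E (bigD1 ord0) //= big1.
    by rewrite mxE !eqxx expr1n addr0.
  by move=> j j0; rewrite mxE eqxx (negbTE j0) expr0n.
have cS : {within S, continuous (qform A)}.
  apply: continuous_subspaceT => x.
  exact/differentiable_continuous/differentiable_qform.
have [c] := EVT_max_rV S0 (@compact_sphere n.+1) cS.
rewrite inE => c1 cmax; exists (qform A c), c; split.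
  by rewrite mulmx_trE c1.
set lam := qform A c; pose B := lam%:M - A.
have Bs : B^T = B by rewrite /B linearB /= tr_scalar_mx As.
have qB x : qform B x = lam * qform 1%:M x - qform A x.
  have entryB (C D : 'M[R]_1) : (C - D) ord0 ord0 = C ord0 ord0 - D ord0 ord0.
    by rewrite !mxE.
  rewrite /qform /B mulmxBr mulmxBl entryB; congr (_ - _).
  by rewrite mul_mx_scalar -scalemxAl mulmx1 mxE.
have B0 x : 0 <= qform B x.
  have [->|x0] := eqVneq x 0; first by rewrite /qform !mul0mx mxE.
  have xp := qform1_gt0 x0.
  have := cmax ((Num.sqrt (qform 1%:M x))^-1 *: x).
  rewrite inE /S /= !qformZ exprVn sqr_sqrtr ?(ltW xp) // mulVf ?gt_eqF // => /(_ erefl).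
  rewrite mulrC ler_pdivrMr // qB => ?; rewrite subr_ge0 //.
have Bc : qform B c = 0 by rewrite qB c1 mulr1 subrr.
pose y := c *m B.
suff : qform 1%:M y = 0.
  move=> /qform1_eq0 /eqP; rewrite /y /B mulmxBr mul_mx_scalar subr_eq0.
  by move=> /eqP.
have key t : 0 <= 2 * t * qform 1%:M y + t ^+ 2 * qform B y.
  have := B0 (c + t *: y); rewrite qformD // Bc add0r qformZ.
  by rewrite linearZ /= -scalemxAr mxE /qform mulmx1 -/y mulrA.
have y0 := qform1_ge0 y; have By0 := B0 y.
move: (qform 1%:M y) (qform B y) y0 By0 key => a b a0 b0 key.
apply/eqP; rewrite eq_le a0 andbT leNgt; apply/negP => ap.
have := key (- (a / (b + 1))).
have b1 : 0 < b + 1 by rewrite ltr_wpDl.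
have -> : 2 * (- (a / (b + 1))) * a + (- (a / (b + 1))) ^+ 2 * b =
   (a / (b + 1)) ^+ 2 * (- b - 2) by field; rewrite gt_eqF.
have : 0 < (a / (b + 1)) ^+ 2 by rewrite exprn_gt0 // divr_gt0.
nra.
Qed.

(** The reflection exchanging the unit vectors [delta_mx 0 i0] and [v] does. *)
Lemma exists_orthogonal_row {n : nat} (i0 : 'I_n) (v : 'rV[R]_n) :
  v *m v^T = 1%:M -> exists H : 'M[R]_n, H *m H^T = 1%:M /\ row i0 H = v.
Proof.
move=> v1; pose e : 'rV[R]_n := delta_mx 0 i0; pose w := v - e.
have e1 : e *m e^T = 1%:M.
  by rewrite trmx_delta mul_delta_mx; apply/matrixP => i j; rewrite !ord1 !mxE.
have [w0|w0] := eqVneq w 0.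
  exists 1%:M; rewrite trmx1 mulmx1; split=> //.
  by rewrite rowE mulmx1 -/e; apply/esym/eqP; rewrite -subr_eq0 -/w w0.
pose q := qform 1%:M w.
have q0 : q != 0 by rewrite gt_eqF // qform1_gt0.
have wq : w *m w^T = q%:M.
  exact: mulmx_trE.
pose H := 1%:M - (2 / q) *: (w^T *m w).
have Hs : H^T = H by rewrite /H linearB linearZ /= trmx_mul trmxK trmx1.
exists H; split.
  rewrite Hs /H mulmxBr mulmx1 mulmxBl mul1mx -scalemxAl -scalemxAr scalerA.
  rewrite -[w^T *m w *m _]mulmxA [w *m (_ *m _)]mulmxA wq mul_scalar_mx.
  rewrite -scalemxAr scalerA opprB.
  have -> : 2 / q * (2 / q) * q = 2 / q + 2 / q by field.
  by rewrite scalerDl addrK subrK.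
rewrite rowE -/e /H mulmxBr mulmx1 -scalemxAr mulmxA.
suff ew : e *m w^T = (- (q / 2))%:M.
  rewrite ew mul_scalar_mx scalerA mulrN -scaleNr mulrA divfK // mulfV // opprK.
  by rewrite scale1r /w addrC subrK.
have ve : v *m e^T = e *m v^T.
  by apply/matrixP => i j; rewrite !ord1 -[v *m e^T]trmxK mxE trmx_mul trmxK.
have qE : (q%:M : 'M[R]_1) = (1%:M - e *m v^T) *+ 2.
  rewrite -wq /w linearB /= mulmxBr !mulmxBl v1 e1 ve mulr2n.
  by rewrite opprB addrA addrAC -addrA.
have ew2 : (e *m w^T) *+ 2 = - q%:M.
  by rewrite qE /w linearB /= mulmxBr e1 -mulNrn opprB.
have two0 : (2 : R) != 0 by [].
apply: (scalerI two0); rewrite scaler_nat ew2 scale_scalar_mx mulrN.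
by rewrite mulrCA mulfV // mulr1 raddfN.
Qed.

(** Spectral theorem: in an orthonormal basis that starts with an eigenvector, a
    symmetric matrix is block diagonal, and the induction hypothesis applies to
    the second block. *)
Lemma spectral {n : nat} (A : 'M[R]_n) : A^T = A ->
  exists (Q : 'M[R]_n) (d : 'rV[R]_n),
    Q *m Q^T = 1%:M /\ A = Q^T *m diag_mx d *m Q.
Proof.
elim: n A => [|n IH] A As.
  by exists 1%:M, 0; split; apply/matrixP => -[].
have [lam [v [v1 vA]]] := exists_eigenvector As.
have [H [HH Hv]] := exists_orthogonal_row ord0 v1.
have HH' : H^T *m H = 1%:M by exact: mulmx1C.
pose B : 'M[R]_(1 + n) := H *m A *m H^T.
have Bs : B^T = B by rewrite /B !trmx_mul trmxK As mulmxA.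
have B0 : row ord0 B = lam *: delta_mx 0 0.
  rewrite /B !row_mul Hv vA -scalemxAl -Hv rowE -mulmxA HH.
  by rewrite mulmx1.
have B0E j : B ord0 j = lam *+ (j == 0).
  by have /rowP/(_ j) := B0; rewrite mxE => ->; rewrite mxE mxE eqxx mulr_natr.
pose B' := drsubmx B.
have BE : B = block_mx lam%:M 0 0 B'.
  rewrite -[LHS]submxK; congr block_mx; apply/matrixP => i k.
  - by rewrite !ord1 mxE mxE [RHS]mxE !lshift0 B0E.
  - rewrite !ord1 mxE mxE [RHS]mxE !lshift0 B0E.
    by rewrite (_ : rshift 1 k == 0 = false) // -val_eqE.
  - rewrite !ord1 mxE mxE [RHS]mxE -Bs [LHS]mxE !lshift0 B0E.
    by rewrite (_ : rshift 1 i == 0 = false) // -val_eqE.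
have Bs' : B'^T = B'.
  by rewrite /B' trmx_drsub Bs.
have [Q [d [QQ B'E]]] := IH _ Bs'.
pose P : 'M[R]_(1 + n) := block_mx 1%:M 0 0 Q.
have PP : P *m P^T = 1%:M.
  rewrite /P tr_block_mx mulmx_block !trmx0 trmx1 !mulmx0 !mul0mx !addr0 add0r.
  by rewrite QQ mulmx1 -scalar_mx_block.
have BP : B = P^T *m diag_mx (row_mx lam%:M d) *m P.
  rewrite BE B'E /P tr_block_mx diag_mx_row !mulmx_block !trmx0 trmx1.
  rewrite !(mulmx0, mul0mx, addr0, add0r, mul1mx, mulmx1).
  by congr block_mx; apply/matrixP => i j; rewrite !ord1 !mxE.
exists (P *m H), (row_mx lam%:M d); split.
  by rewrite trmx_mul mulmxA -[P *m H *m H^T]mulmxA HH mulmx1.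
have -> : A = H^T *m B *m H.
  by rewrite /B !mulmxA HH' mul1mx -mulmxA HH' mulmx1.
rewrite trmx_mul -!mulmxA; congr (_ *m _); rewrite !mulmxA; congr (_ *m _).
exact: BP.
Qed.

End Spectral.

Section Signature.
Context {R : realType}.

(** The roots of a split polynomial are unique up to order, so that
    [has_signature] determines its two numbers. *)
Lemma perm_eq_prod_XsubC (s t : seq R) :
  \prod_(x <- s) ('X - x%:P) = \prod_(x <- t) ('X - x%:P) -> perm_eq s t.
Proof.
elim: s t => [|x s IH] t E.
  have := congr1 (fun p : {poly R} => size p) E.
  by rewrite !size_prod_XsubC /=; case: t E.
have xt : x \in t.
  by rewrite -root_prod_XsubC -E root_prod_XsubC mem_head.
have tE := perm_to_rem xt; rewrite perm_sym (perm_trans tE) // perm_cons perm_sym.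
apply: IH; move: E; rewrite (perm_big _ tE) /= !big_cons.
by apply: mulfI; rewrite polyXsubC_eq0.
Qed.

Lemma has_signature_uniq {n : nat} (A : 'M[R]_n) p q p' q' :
  has_signature A p q -> has_signature A p' q' -> p = p' /\ q = q'.
Proof.
move=> [s [sA <- <-]] [t [tA <- <-]].
have /permP st : perm_eq s t by apply: perm_eq_prod_XsubC; rewrite -sA.
by rewrite !st.
Qed.

Definition sgn_row (n p : nat) : 'rV[R]_n := \row_j (if (j < p)%N then 1 else -1).

Definition sgn_mx (n p : nat) : 'M[R]_n := diag_mx (sgn_row n p).

Lemma char_poly_diag_conj {n : nat} (Q : 'M[R]_n) (d : 'rV[R]_n) :
  Q *m Q^T = 1%:M ->
  char_poly (Q^T *m diag_mx d *m Q) = \prod_(x <- [seq d 0 j | j : 'I_n]) ('X - x%:P).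
Proof.
move=> QQ; have QQ' : Q^T *m Q = 1%:M by exact: mulmx1C.
rewrite big_image /=.
have E : char_poly_mx (Q^T *m diag_mx d *m Q) =
    (map_mx polyC Q^T) *m char_poly_mx (diag_mx d) *m (map_mx polyC Q).
  rewrite /char_poly_mx mulmxBr mulmxBl -!map_mxM; congr (_ - _).
  rewrite mul_mx_scalar -scalemxAl -map_mxM QQ' map_mx1.
  by rewrite scale_scalar_mx mulr1.
rewrite /char_poly E !det_mulmx mulrAC -det_mulmx -map_mxM QQ' map_mx1 det1 mul1r.
rewrite -/(char_poly _) char_poly_trig ?diag_mx_is_trig //.
by apply: eq_bigr => i _; rewrite mxE eqxx mulr1n.
Qed.

(** The positive eigenvectors are listed before the negative ones and scaled
    by the square root of the modulus of their eigenvalue. *)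
Lemma sylvester {n : nat} (A : 'M[R]_n) : A^T = A -> A \in unitmx ->
  exists (p : nat) (P : 'M[R]_n), [/\ (p <= n)%N, P \in unitmx,
    A = P *m sgn_mx n p *m P^T & has_signature A p (n - p)].
Proof.
move=> As Au; have [Q [d [QQ AE]]] := spectral As.
have d0 j : d 0 j != 0.
  have : diag_mx d \in unitmx.
    by move: Au; rewrite AE !unitmx_mul => /andP[/andP[]].
  rewrite unitmxE det_diag unitfE => /prodf_neq0 H; exact: H.
pose pos := [seq j <- enum 'I_n | 0 < d 0 j].
pose neg := [seq j <- enum 'I_n | ~~ (0 < d 0 j)].
pose e := pos ++ neg; pose p := size pos.
have pe : perm_eq e (enum 'I_n) by rewrite perm_filterC.
have se : size e = n by rewrite (perm_size pe) size_enum_ord.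
have ue : uniq e by rewrite (perm_uniq pe) enum_uniq.
have pn : (p <= n)%N by rewrite -se size_cat leq_addr.
pose s (j : 'I_n) : 'I_n := nth j e j.
have sE (j0 j : 'I_n) : s j = nth j0 e j by apply: set_nth_default; rewrite se.
have sinj : injective s.
  move=> i j /eqP; rewrite (sE i) (sE i j) nth_uniq ?se // => /eqP; exact: val_inj.
have spos j : (0 < d 0 (s j)) = (j < p)%N.
  rewrite /s nth_cat -/p; case: ltnP => jp.
    by have := mem_nth j jp; rewrite mem_filter => /andP[].
  have : nth j neg (j - p) \in neg.
    by apply: mem_nth; rewrite -(ltn_add2r p) subnK // [X in (_ < X)%N]addnC -size_cat -/e se.
  by rewrite mem_filter => /andP[/negbTE].
pose P : 'M[R]_n := \matrix_(i, j) (Num.sqrt `|d 0 (s j)| * Q (s j) i).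
have AP : A = P *m sgn_mx n p *m P^T.
  rewrite AE; apply/matrixP => i k; rewrite /sgn_mx !mul_mx_diag !mxE.
  rewrite (reindex_inj sinj) /=; apply: eq_bigr => j _; rewrite !mxE.
  rewrite -spos; case: ifPn => dj.
    by rewrite gtr0_norm // -{1}[d 0 (s j)]sqr_sqrtr ?ltW //; ring.
  have dn : d 0 (s j) < 0 by rewrite lt_neqAle d0 leNgt.
  rewrite ltr0_norm //.
  have -> : d 0 (s j) = - (Num.sqrt (- d 0 (s j)) ^+ 2).
    by rewrite sqr_sqrtr ?opprK // oppr_ge0 ltW.
  rewrite opprK; set r := Num.sqrt _; rewrite sqrtr_sqr ger0_norm ?sqrtr_ge0 //.
  ring.
exists p, P; split=> //.
  by move: Au; rewrite AP !unitmx_mul => /andP[/andP[]].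
exists [seq d 0 j | j : 'I_n]; split.
- by rewrite AE char_poly_diag_conj.
- by rewrite /p size_filter /image_mem count_map.
have np : (n - p)%N = size neg by rewrite -[in LHS]se size_cat -/p addKn.
rewrite np /image_mem count_map size_filter.
by apply: eq_count => j /=; rewrite lt_neqAle d0 leNgt.
Qed.

(** A subspace on which the form is positive meets trivially a subspace on which
    it is nonpositive. *)
Lemma inertia_le {n m1 m2 : nat} (A : 'M[R]_n) (U : 'M[R]_(m1, n)) (N : 'M[R]_(m2, n)) :
  (forall z : 'rV[R]_n, (z <= U)%MS -> z != 0 -> 0 < qform A z) ->
  (forall z : 'rV[R]_n, (z <= N)%MS -> qform A z <= 0) ->
  (\rank U + \rank N <= n)%N.
Proof.
move=> Up Nn; rewrite -mxrank_sum_cap.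
have -> : (U :&: N)%MS = 0.
  apply/eqP; rewrite -submx0; apply/rV_subP => z; rewrite sub_capmx => /andP[zU zN].
  rewrite submx0; apply: contraT => z0.
  by have := Up z zU z0; rewrite ltNge Nn.
by rewrite mxrank0 addn0 rank_leq_col.
Qed.

Lemma qform_sgn (n p : nat) (y : 'rV[R]_n) :
  qform (sgn_mx n p) y = \sum_(j < n) (if (j < p)%N then 1 else -1) * y ord0 j ^+ 2.
Proof.
rewrite /qform /sgn_mx mul_mx_diag mxE; apply: eq_bigr => j _.
by rewrite !mxE; ring.
Qed.

Lemma qform_congr {n : nat} (A P : 'M[R]_n) (z : 'rV[R]_n) :
  qform (P *m A *m P^T) z = qform A (z *m P).
Proof. by rewrite /qform trmx_mul !mulmxA. Qed.

Lemma sub_pid {n p : nat} (y : 'rV[R]_n) (j : 'I_n) :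
  (y <= (pid_mx p : 'M[R]_n))%MS -> (p <= j)%N -> y ord0 j = 0.
Proof.
move=> /submxP[x ->] pj; rewrite mxE big1 // => k _; rewrite mxE.
by case: eqP => [->|_]; rewrite ?mulr0 // ltnNge pj mulr0.
Qed.

Lemma sub_copid {n p : nat} (y : 'rV[R]_n) (j : 'I_n) :
  (y <= (copid_mx p : 'M[R]_n))%MS -> (j < p)%N -> y ord0 j = 0.
Proof.
move=> /submxP[x ->] pj; rewrite mxE big1 // => k _; rewrite !mxE.
have [->|kj] := eqVneq k j; first by rewrite !eqxx pj subrr mulr0.
by rewrite (negbTE (_ : k != j :> nat)) // subrr mulr0.
Qed.

Lemma qform_pid (n p : nat) (y : 'rV[R]_n) :
  (y <= (pid_mx p : 'M[R]_n))%MS -> qform (sgn_mx n p) y = qform 1%:M y.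
Proof.
move=> yp; rewrite qform_sgn qform1E; apply: eq_bigr => j _.
case: ltnP => jp; first by rewrite mul1r.
by rewrite (sub_pid yp jp) expr0n mulr0.
Qed.

Lemma qform_copid (n p : nat) (y : 'rV[R]_n) :
  (y <= (copid_mx p : 'M[R]_n))%MS -> qform (sgn_mx n p) y = - qform 1%:M y.
Proof.
move=> yp; rewrite qform_sgn qform1E -sumrN; apply: eq_bigr => j _.
case: ltnP => jp; last by rewrite mulN1r.
by rewrite (sub_copid yp jp) expr0n mulr0 oppr0.
Qed.

Lemma sub_mulVmx {n : nat} (z : 'rV[R]_n) (B P : 'M[R]_n) : P \in unitmx ->
  (z <= B *m invmx P)%MS -> (z *m P <= B)%MS.
Proof. by move=> Pu zB; rewrite -[B](mulmxKV Pu) submxMr. Qed.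

(** Sylvester's law of inertia in a form that is stable under perturbation: only
    positivity on a space of dimension [p] and negativity on a complement are
    asked, not a normal form. *)
Lemma signature_of_split {n : nat} (B P : 'M[R]_n) (p : nat) :
  (p <= n)%N -> B^T = B -> P \in unitmx ->
  (forall y : 'rV[R]_n, (y <= (pid_mx p : 'M[R]_n))%MS -> y != 0 ->
     0 < qform B (y *m invmx P)) ->
  (forall y : 'rV[R]_n, (y <= (copid_mx p : 'M[R]_n))%MS -> y != 0 ->
     qform B (y *m invmx P) < 0) ->
  B \in unitmx -> has_signature B p (n - p).
Proof.
move=> pn Bs Pu Bp Bn Bu.
have [p' [P' [pn' Pu' BE sB]]] := sylvester Bs Bu.
have wlog0 (z : 'rV[R]_n) Q : Q \in unitmx -> z != 0 -> z *m Q != 0.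
  move=> Qu; apply: contra => /eqP zQ.
  by rewrite -[z](mulmxK Qu) zQ mul0mx.
have rk m (D : 'M[R]_(m, n)) Q : Q \in unitmx -> \rank (D *m invmx Q) = \rank D.
  by move=> Qu; rewrite mxrankMfree // row_free_unit unitmx_inv.
have q'p z : (z <= (pid_mx p' : 'M[R]_n) *m invmx P')%MS -> z != 0 -> 0 < qform B z.
  move=> zp z0; rewrite BE qform_congr qform_pid; last exact: sub_mulVmx.
  by apply: qform1_gt0; exact: wlog0.
have q'n z : (z <= (copid_mx p' : 'M[R]_n) *m invmx P')%MS -> qform B z <= 0.
  move=> zp; rewrite BE qform_congr qform_copid; last exact: sub_mulVmx.
  by rewrite oppr_le0 qform1_ge0.
have qp z : (z <= (pid_mx p : 'M[R]_n) *m invmx P)%MS -> z != 0 -> 0 < qform B z.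
  move=> zp z0; rewrite -[z](mulmxK Pu); apply: Bp; first exact: sub_mulVmx.
  exact: wlog0.
have qn z : (z <= (copid_mx p : 'M[R]_n) *m invmx P)%MS -> qform B z <= 0.
  move=> zp; have [->|z0] := eqVneq z 0; first by rewrite /qform !mul0mx mxE.
  rewrite ltW // -[z](mulmxK Pu); apply: Bn; first exact: sub_mulVmx.
  exact: wlog0.
have := inertia_le qp q'n; have := inertia_le q'p qn.
rewrite !rk // !rank_copid_mx // !rank_pid_mx // => H1 H2.
suff -> : p = p' by [].
apply/eqP; rewrite eqn_leq; apply/andP; split.
  by rewrite -(leq_add2r (n - p')) subnKC.
by rewrite -(leq_add2r (n - p)) subnKC.
Qed.

Lemma sgn_mx_unit (n p : nat) : sgn_mx n p \in unitmx.
Proof.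
rewrite unitmxE det_diag unitfE; apply/prodf_neq0 => j _; rewrite mxE.
by case: ifP => _; rewrite ?oppr_eq0 oner_eq0.
Qed.

Lemma sgn_mx_tr (n p : nat) : (sgn_mx n p)^T = sgn_mx n p.
Proof. exact: tr_diag_mx. Qed.

(** The spectral theorem gives one direction, the law of inertia the other. *)
Lemma GLSymP {n p : nat} (A : 'M[R]_n) : (p <= n)%N ->
  GLSym p A <-> exists2 P : 'M[R]_n, P \in unitmx & A = P *m sgn_mx n p *m P^T.
Proof.
move=> pn; split=> [[As Au sA]|[P Pu AE]].
  have [p' [P [pn' Pu AE sA']]] := sylvester As Au.
  have [pp' _] := has_signature_uniq sA sA'.
  by exists P => //; rewrite pp'.
have As : A^T = A by rewrite AE !trmx_mul trmxK sgn_mx_tr mulmxA.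
have Au : A \in unitmx by rewrite AE !unitmx_mul unitmx_tr Pu sgn_mx_unit.
split=> //; apply: (signature_of_split (P := P)) => // y yp y0.
  by rewrite AE qform_congr mulmxKV // qform_pid // qform1_gt0.
by rewrite AE qform_congr mulmxKV // qform_copid // oppr_lt0 qform1_gt0.
Qed.

Lemma le_mx_norm {m n : nat} (D : 'M[R]_(m, n)) i j : `|D i j| <= `|D|.
Proof.
rewrite [leRHS]/Num.Def.normr /= mx_normrE.
exact: (le_bigmax _ (fun k : 'I_m * 'I_n => `|D k.1 k.2|) (i, j)).
Qed.

Lemma qform_bound {n : nat} (D : 'M[R]_n) (y : 'rV[R]_n) :
  `|qform D y| <= `|D| * n%:R * qform 1%:M y.
Proof.
have amgm (a b c e : R) : 0 <= c -> c <= e ->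
    a * c * b <= e * ((a ^+ 2 + b ^+ 2) / 2).
  move=> c0 ce; have h1 := sqr_ge0 (a - b); have h2 := sqr_ge0 a; have h3 := sqr_ge0 b.
  rewrite mulrAC mulrC; apply: (@le_trans _ _ (c * ((a ^+ 2 + b ^+ 2) / 2))).
    by apply: ler_wpM2l => //; nra.
  by apply: ler_wpM2r => //; lra.
rewrite /qform mxE; under eq_bigr do rewrite mxE mxE big_distrl /=.
apply: le_trans (ler_norm_sum _ _ _) _.
apply: (@le_trans _ _ (\sum_(i < n) \sum_(k < n)
    `|D| * ((y ord0 k ^+ 2 + y ord0 i ^+ 2) / 2))).
  apply: ler_sum => i _; apply: le_trans (ler_norm_sum _ _ _) _.
  apply: ler_sum => k _; rewrite !normrM -[y ord0 k ^+ 2]real_normK ?num_real //.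
  rewrite -[y ord0 i ^+ 2]real_normK ?num_real //.
  by apply: amgm => //; exact: le_mx_norm.
under eq_bigr do rewrite -mulr_sumr -mulr_suml big_split /= sumr_const card_ord.
rewrite -mulr_sumr -mulr_suml big_split /= sumr_const card_ord -/(qform _ _).
rewrite -mulrA; apply: ler_wpM2l => //.
rewrite sumrMnl -qform1E -mulr_natl; lra.
Qed.

(** Under a small perturbation the form remains positive on the span of the
    first [p] vectors of an adapted basis and negative on the span of the
    others. *)
Lemma GLSym_open {n p : nat} (A : 'M[R]_n) : (p <= n)%N -> GLSym p A ->
  exists U : set 'M[R]_n, [/\ open U, U A &
    forall B, U B -> B^T = B -> GLSym p B].
Proof.
move=> pn /(GLSymP _ pn)[P Pu AE].
pose f (B : 'M[R]_n) := invmx P *m B *m invmx P^T.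
have df B : differentiable f B.
  by apply: differentiable_mulmx => //; apply: differentiable_mulmx.
pose e : R := (n%:R + 1)^-1.
have e0 : 0 < e by rewrite invr_gt0 ltr_wpDl.
exists ([set B : 'M[R]_n | B \in unitmx] `&` (f @^-1` ball (sgn_mx n p) e)).
have fA : f A = sgn_mx n p.
  by rewrite /f AE !mulmxA mulVmx // mul1mx -mulmxA mulmxV ?mulmx1 // unitmx_tr.
split.
- apply: openI; first exact: open_unitmx.
  apply: open_comp; last exact: ball_open.
  by move=> B _; exact/differentiable_continuous/df.
- split=> /=; last by rewrite fA; exact: ballxx.
  by rewrite AE !unitmx_mul unitmx_tr Pu sgn_mx_unit.
move=> B [/= Bu]; rewrite -ball_normE /ball_ /= => fB Bs; split=> //.
have BE y : qform B (y *m invmx P) = qform (sgn_mx n p) y + qform (f B - sgn_mx n p) y.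
  have entryD (C D : 'M[R]_1) : C ord0 ord0 + D ord0 ord0 = (C + D) ord0 ord0.
    by rewrite mxE.
  rewrite /qform entryD -mulmxDl -mulmxDr [_ + (_ - _)]addrC subrK /f.
  by rewrite trmx_mul trmx_inv !mulmxA.
have small y : y != 0 -> `|qform (f B - sgn_mx n p) y| < qform 1%:M y.
  move=> y0; apply: le_lt_trans (qform_bound _ _) _.
  have yp := qform1_gt0 y0; rewrite -[ltRHS]mul1r ltr_pM2r //.
  rewrite distrC; apply: (@le_lt_trans _ _ (e * n%:R)).
    by apply: ler_wpM2r => //; exact: ltW.
  by rewrite mulrC ltr_pdivrMr ?ltr_wpDl // mul1r ltrDl.
apply: (signature_of_split (P := P)) => // y yp y0; have := small y y0.
  rewrite ltr_norml => /andP[H _]; rewrite BE qform_pid //.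
  by rewrite -ltrBlDl sub0r.
rewrite ltr_norml => /andP[_ H]; rewrite BE qform_copid //.
by rewrite addrC subr_lt0.
Qed.

End Signature.

(** * The matrix exponential *)

Section MatrixExponential.
Context {R : realType} {n : nat}.
Local Notation E := 'M[R]_n.
Implicit Types (X Y : E) (t : R).

Lemma mx_norm_mulmx (A B : E) : `|A *m B| <= n%:R * `|A| * `|B|.
Proof.
rewrite [leLHS]/Num.Def.normr /= mx_normrE; apply: bigmax_le.
  by rewrite !mulr_ge0.
move=> -[i j] _ /=; rewrite mxE; apply: le_trans (ler_norm_sum _ _ _) _.
apply: (@le_trans _ _ (\sum_(k < n) `|A| * `|B|)).
  apply: ler_sum => k _; rewrite normrM.
  by apply: ler_pM => //; exact: le_mx_norm.
by rewrite sumr_const card_ord -[(_ * _) *+ n]mulr_natl mulrA.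
Qed.

(** The left factor [Y] makes the family of series stable under termwise
    differentiation in [t] after [X] is replaced by [t *: X]. *)
Definition mxexp_term Y X (k : nat) : E := (k`!%:R : R)^-1 *: (Y *m X ^+ k).

Lemma mxpowS X k : X ^+ k.+1 = X *m X ^+ k.
Proof. exact: exprS. Qed.

Lemma mxpowSr X k : X ^+ k.+1 = X ^+ k *m X.
Proof. exact: exprSr. Qed.

Lemma mxpowZ X t k : (t *: X) ^+ k = t ^+ k *: X ^+ k.
Proof.
elim: k => [|k IH]; first by rewrite !expr0 scale1r.
by rewrite !mxpowS IH -scalemxAl -scalemxAr scalerA -exprS.
Qed.

Lemma cvg_mx {m k : nat} (u : nat -> 'M[R]_(m, k)) (l : 'M[R]_(m, k)) :
  (forall i j, u h i j @[h --> \oo] --> (l i j : R)) -> u @ \oo --> l.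
Proof.
move=> ul; apply/cvgrPdist_le => /= e e0; near=> h.
rewrite [leLHS]/Num.Def.normr /= mx_normrE (bigmax_le _ (ltW e0)) //= => i _.
rewrite !mxE; move: i; near: h; apply: filter_forall => /= i.
by have /cvgrPdist_le := ul i.1 i.2; exact.
Unshelve. all: by end_near. Qed.

Lemma is_cvg_mxexp Y X : cvgn (series (mxexp_term Y X)).
Proof.
have bnd k : `|mxexp_term Y X k| <= `|Y| * exp_coeff (n%:R * `|X|) k.
  rewrite /mxexp_term normrZ ger0_norm ?invr_ge0 //= /exp_coeff /=.
  rewrite [X in _ <= _ * X]mulrC mulrCA; apply: ler_wpM2l; first by rewrite invr_ge0.
  elim: k => [|k IH]; first by rewrite !expr0 mulr1 mulmx1.
  rewrite mxpowSr mulmxA; apply: le_trans (mx_norm_mulmx _ _) _.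
  rewrite [in leRHS]exprSr mulrA -mulrA [`|_| * `|X|]mulrC mulrA mulrC.
  by apply: ler_wpM2r => //; rewrite mulr_ge0.
have cv i j : cvgn (series (fun k => mxexp_term Y X k i j : R)).
  apply: normed_cvg.
  apply: (series_le_cvg (v_ := fun k => `|Y| * exp_coeff (n%:R * `|X|) k)) => //=.
  - by move=> k; rewrite mulr_ge0 // exp_coeff_ge0 // mulr_ge0.
  - by move=> k; apply: le_trans (bnd k); exact: le_mx_norm.
  rewrite -[fun k => _]/(`|Y| *: exp_coeff (n%:R * `|X|)).
  by apply: is_cvg_seriesZ; exact: is_cvg_series_exp_coeff.
apply/cvg_ex; exists (\matrix_(i, j) limn (series (fun k => mxexp_term Y X k i j))).
apply: cvg_mx => i j; rewrite mxE.
under [X in X @ _]funext do rewrite /series /= summxE.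
exact: cv.
Qed.

Lemma cvg_linear_mx {m k : nat} {W : normedModType R} (L : {linear 'M[R]_(m, k) -> W})
    (u : nat -> 'M[R]_(m, k)) l :
  u i @[i --> \oo] --> l -> L (u i) @[i --> \oo] --> L l.
Proof. by move=> ul; apply: (cvg_comp _ _ ul); exact: continuous_linear_mx. Qed.

Arguments cvg_linear_mx {m k W} L {u l}.

Lemma mxexp_termE X : mxexp_term 1%:M X = (fun k => (k`!%:R : R)^-1 *: X ^+ k).
Proof. by apply/funext => k; rewrite /mxexp_term mul1mx. Qed.

Lemma mxexp_cvg X : series (mxexp_term 1%:M X) @ \oo --> mxexp X.
Proof. by rewrite /mxexp -mxexp_termE; exact: is_cvg_mxexp. Qed.

Arguments mxexp_cvg : clear implicits.

Lemma series_mulmxl Y X k :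
  Y *m series (mxexp_term 1%:M X) k = series (mxexp_term Y X) k.
Proof.
rewrite /series /= mulmx_sumr; apply: eq_bigr => i _.
by rewrite /mxexp_term -scalemxAr mulmxA mulmx1.
Qed.

Lemma mxexp_mull Y X : limn (series (mxexp_term Y X)) = Y *m mxexp X.
Proof.
apply: cvg_lim => //; have := cvg_linear_mx (mulmx Y) (mxexp_cvg X).
by apply: cvg_trans; apply: near_eq_cvg; apply: nearW => k /=; rewrite series_mulmxl.
Qed.

Lemma mxexp_comm_gen Y X Z : (forall k, Y *m X ^+ k = Z ^+ k *m Y) ->
  Y *m mxexp X = mxexp Z *m Y.
Proof.
move=> YXZ; rewrite -mxexp_mull; apply: cvg_lim => //.
have := cvg_linear_mx (mulmxr Y) (mxexp_cvg Z).
apply: cvg_trans; apply: near_eq_cvg; apply: nearW => k /=.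
rewrite /series /= mulmx_suml; apply: eq_bigr => i _.
by rewrite /mxexp_term -scalemxAl mul1mx YXZ.
Qed.

Lemma mxexp_intertwine Y X Z : Y *m X = Z *m Y -> Y *m mxexp X = mxexp Z *m Y.
Proof.
move=> YX; apply: mxexp_comm_gen; elim=> [|k IH]; first by rewrite !expr0 mulmx1 mul1mx.
by rewrite mxpowSr mulmxA IH -mulmxA YX mulmxA -mxpowSr.
Qed.

Lemma mxexp_tr X : (mxexp X)^T = mxexp X^T.
Proof.
apply/esym; apply: cvg_lim => //.
have := cvg_linear_mx (@trmx R n n) (mxexp_cvg X).
apply: cvg_trans; apply: near_eq_cvg; apply: nearW => k /=.
rewrite /series /= linear_sum; apply: eq_bigr => i _ /=.
rewrite /mxexp_term mul1mx linearZ /=; congr (_ *: _).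
by elim: i => [|i IH]; rewrite ?trmx1 // mxpowS trmx_mul IH -mxpowSr.
Qed.

Lemma mxexp0 : mxexp (0 : E) = 1%:M.
Proof.
apply: cvg_lim => //; rewrite -mxexp_termE.
rewrite -(cvg_shiftS (series (mxexp_term 1%:M 0))).
have -> : [sequence series (mxexp_term 1%:M 0) k.+1]_k = (fun=> 1%:M) :> (nat -> E).
  apply/funext => k; rewrite /series /= big_nat_recl // big1 ?addr0.
    by rewrite /mxexp_term expr0 mulmx1 invr1 scale1r.
  by move=> i _; rewrite /mxexp_term mxpowS mul0mx mulmx0 scaler0.
exact: cvg_cst.
Qed.

(** Every entry of [Y *m mxexp (t *: X)] is a power series in [t] with infinite
    radius of convergence, and [pseries_diffs] replaces [Y] by [Y *m X]. *)
Definition mxexp_coeff Y X i j (k : nat) : R := (k`!%:R)^-1 * (Y *m X ^+ k) i j.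

Lemma pseries_mxexp Y X i j t :
  pseries (mxexp_coeff Y X i j) t = (fun k => (series (mxexp_term Y (t *: X)) k) i j).
Proof.
apply/funext => k; rewrite /pseries /series /= summxE; apply: eq_bigr => l _.
rewrite /mxexp_coeff /mxexp_term mxpowZ -scalemxAr scalerA [RHS]mxE.
by rewrite mulrAC.
Qed.

Lemma cvg_pseries_mxexp Y X i j t :
  pseries (mxexp_coeff Y X i j) t @ \oo --> (Y *m mxexp (t *: X)) i j.
Proof.
rewrite pseries_mxexp -mxexp_mull.
have H := cvg_linear_mx (entry i j) (is_cvg_mxexp (Y := Y) (X := t *: X)).
exact: H.
Qed.

Lemma pseries_diffs_mxexp Y X i j :
  pseries_diffs (mxexp_coeff Y X i j) = mxexp_coeff (Y *m X) X i j.
Proof.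
apply/funext => k; rewrite /pseries_diffs /mxexp_coeff factS natrM invfM mxpowS.
by rewrite -mulmxA mulrA mulrA mulfV ?mul1r.
Qed.

Lemma is_derive_mxexp_entry Y X i j t :
  is_derive t 1 (fun t => (Y *m mxexp (t *: X)) i j : R)
    ((Y *m X *m mxexp (t *: X)) i j).
Proof.
have limE Z u : limn (pseries (mxexp_coeff Z X i j) u) = (Z *m mxexp (u *: X)) i j.
  by apply: cvg_lim => //; exact: cvg_pseries_mxexp.
have cv Z u : cvgn (pseries (mxexp_coeff Z X i j) u).
  by apply/cvg_ex; eexists; exact: cvg_pseries_mxexp.
have -> : (fun t => (Y *m mxexp (t *: X)) i j : R) =
    (fun t => limn (pseries (mxexp_coeff Y X i j) t)).
  by apply/funext => u; rewrite limE.
rewrite -limE -pseries_diffs_mxexp.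
apply: (@pseries_snd_diffs _ _ (`|t| + 1)); rewrite ?pseries_diffs_mxexp //.
by rewrite [ltRHS]ger0_norm ?ltrDl // addr_ge0.
Qed.

Lemma differentiable_mxexp Y X t : differentiable (fun t => Y *m mxexp (t *: X)) t.
Proof.
apply: differentiable_mx => i j; apply/derivable1_diffP.
by have [] := is_derive_mxexp_entry Y X i j t.
Qed.

Lemma derive_mxexp Y X t :
  'D_1 (fun t => Y *m mxexp (t *: X)) t = Y *m X *m mxexp (t *: X).
Proof.
apply/matrixP => i j; rewrite -derive_entry; last exact: differentiable_mxexp.
by have [_ ->] := is_derive_mxexp_entry Y X i j t.
Qed.

Lemma derive_scale1 {W : normedModType R} (c : R -> W) (t v : R) :
  differentiable c t -> 'D_v c t = v *: 'D_1 c t.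
Proof.
by move=> dc; rewrite !deriveE // -linearZ /= /GRing.scale /= mulr1.
Qed.

Lemma smooth_on_mxexp Y X : smooth_on setT (fun t : R => Y *m mxexp (t *: X)).
Proof.
apply/smoothkP => k; elim: k Y => [|k IH] Y.
  by move=> [|//] t _ _ /=; exact: differentiable_mxexp.
apply/smoothkS; split=> [t _|v]; first exact: differentiable_mxexp.
have -> : 'D_v (fun t : R => Y *m mxexp (t *: X)) =
    (fun t : R => (v *: (Y *m X)) *m mxexp (t *: X)).
  apply/funext => t; rewrite derive_scale1; last exact: differentiable_mxexp.
  by rewrite derive_mxexp -scalemxAl.
exact: IH.
Qed.

End MatrixExponential.

Section Constant.
Context {R : realType}.

Lemma derive0_cst_interval (I : set R) (f : R -> R) : is_interval I ->
  (forall t, I t -> is_derive t 1 f 0) -> forall s t, I s -> I t -> f s = f t.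
Proof.
move=> iI f0; have W s t : I s -> I t -> s < t -> f s = f t.
  move=> Is It st.
  have sub x : s <= x <= t -> I x by exact: iI.
  have [||x _] := @MVT _ f (fun=> 0) s t st.
  - by move=> x; rewrite in_itv /= => /andP[sx xt]; apply/f0/sub; rewrite !ltW.
  - apply: derivable_within_continuous => x; rewrite in_itv /= => sxt.
    by have [] := f0 x (sub x sxt).
  by rewrite mul0r => /eqP; rewrite subr_eq0 => /eqP.
move=> s t Is It; have [st|ts|->//] := ltgtP s t; first exact: W.
by apply/esym; exact: W.
Qed.

Lemma derive0_cst_mx {m n : nat} (I : set R) (f : R -> 'M[R]_(m, n)) :
  is_interval I -> (forall t, I t -> differentiable f t) ->
  (forall t, I t -> 'D_1 f t = 0) -> forall s t, I s -> I t -> f s = f t.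
Proof.
move=> iI df f0 s t Is It; apply/matrixP => i j.
apply: (derive0_cst_interval (I := I) (f := fun t => f t i j)) => // u Iu.
apply: DeriveDef.
  by apply: diff_derivable; apply: differentiable_entry; exact: df.
by rewrite derive_entry ?f0 ?mxE //; exact: df.
Qed.

End Constant.

Section OneParameterGroup.
Context {R : realType} {n : nat}.
Local Notation E := 'M[R]_n.
Implicit Types (X Y K V : E) (t : R).

Lemma differentiable_mxexp1 X t : differentiable (fun t : R => mxexp (t *: X)) t.
Proof.
have := differentiable_mxexp 1%:M X t.
by under [X in differentiable X _]funext do rewrite mul1mx.
Qed.

Lemma derive_mxexp1 X t : 'D_1 (fun t : R => mxexp (t *: X)) t = X *m mxexp (t *: X).
Proof.
have := derive_mxexp 1%:M X t; rewrite mul1mx.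
by under [X in 'D__ X _]funext do rewrite mul1mx.
Qed.

Lemma mxexp_comm X t : X *m mxexp (t *: X) = mxexp (t *: X) *m X.
Proof. by apply: mxexp_intertwine; rewrite -scalemxAl -scalemxAr. Qed.

(** The derivative of [mxexp (x *: X) *m mxexp ((s + t - x) *: X)] in [x]
    vanishes. *)
Lemma mxexpD X s t : mxexp (s *: X) *m mxexp (t *: X) = mxexp ((s + t) *: X).
Proof.
pose u := s + t; pose r (x : R) : R := u - x.
have dr x : differentiable r x by apply: differentiableB.
have r1 x : 'D_1 r x = - 1.
  rewrite /r deriveB; [|exact: derivable_cst|exact: derivable_id].
  by rewrite derive_cst derive_id sub0r.
have de x : differentiable (fun x => mxexp (r x *: X)) x.
  exact: (differentiable_comp (dr x) (differentiable_mxexp1 X (r x))).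
have De x : 'D_1 (fun x => mxexp (r x *: X)) x = - (X *m mxexp (r x *: X)).
  rewrite (derive_comp (f := r) (g := fun y : R => mxexp (y *: X))) //.
    by rewrite r1 derive_scale1 ?derive_mxexp1 ?scaleN1r //; exact: differentiable_mxexp1.
  exact: differentiable_mxexp1.
have := @derive0_cst_mx R n n setT (fun x : R => mxexp (x *: X) *m mxexp (r x *: X)).
move=> /(_ (fun _ _ _ _ _ _ => I)).
have dx (x : R) : differentiable (fun x : R => mxexp (x *: X) *m mxexp (r x *: X)) x.
  by apply: differentiable_mulmx => //; exact: differentiable_mxexp1.
move=> /(_ (fun x _ => dx x)) H.
have {}H : forall a b, mxexp (a *: X) *m mxexp (r a *: X) =
    mxexp (b *: X) *m mxexp (r b *: X).
  move=> a b; apply: H => // x _; rewrite derive_mulmx //; last exact: differentiable_mxexp1.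
  by rewrite derive_mxexp1 De mulmxN mulmxA mxexp_comm subrr.
have := H s 0; rewrite scale0r mxexp0 mul1mx /r subr0 /u => <-.
by rewrite addrAC subrr add0r.
Qed.

Lemma mxexpN X t : mxexp (t *: X) *m mxexp ((- t) *: X) = 1%:M.
Proof. by rewrite mxexpD subrr scale0r mxexp0. Qed.

Lemma mxexp_unit X t : mxexp (t *: X) \in unitmx.
Proof. by have [] := mulmx1_unit (mxexpN X t). Qed.

(** By Jacobi's formula the logarithmic derivative of the determinant is the
    trace of [X]. *)
Lemma det_mxexp X t : \tr X = 0 -> \det (mxexp (t *: X)) = 1.
Proof.
move=> trX; have <- : \det (mxexp (0 *: X)) = 1 by rewrite scale0r mxexp0 det1.
apply: (@derive0_cst_interval R setT (fun t => \det (mxexp (t *: X)))) => // s _.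
have ds := differentiable_mxexp1 X s.
apply: DeriveDef.
  apply: diff_derivable.
  exact: (differentiable_comp ds (differentiable_det _)).
rewrite derive_det //; last exact: mxexp_unit.
by rewrite derive_mxexp1 mxexp_comm mulKmx ?mxexp_unit // trX mulr0.
Qed.

(** [K *m mxexp (t *: X)] is the congruence of [K] by a square root of the
    exponential, because [K] intertwines [X] and its transpose. *)
Lemma mxexp_congr K V t : K^T = K -> V^T = V -> K \in unitmx ->
  let X := invmx K *m V in
  K *m mxexp (t *: X) =
  (mxexp ((t / 2) *: X))^T *m K *m (mxexp ((t / 2) *: X))^T^T.
Proof.
move=> Ks Vs Ku X; rewrite trmxK.
have -> : (mxexp ((t / 2) *: X))^T *m K = K *m mxexp ((t / 2) *: X).
  rewrite mxexp_tr; apply/esym; apply: mxexp_intertwine.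
  rewrite -scalemxAr [(_ *: _)^T]linearZ /= -scalemxAl /X trmx_mul Vs trmx_inv Ks.
  by rewrite mulKVmx // mulmxKV.
by rewrite -mulmxA mxexpD -splitr.
Qed.

End OneParameterGroup.

(** * Tangential derivatives *)

Section TangentialDerivative.
Context {R : realType} {n : nat}.
Local Notation E := 'M[R]_n.
Implicit Types (M : set E) (A v : E).

Lemma curve_comp {W : normedModType R} M (U : set E) (F : E -> W) A v c :
  curve_through M A v c -> differentiable F A ->
  'D_1 (fun t => F (c t)) 0 = 'D_v F A.
Proof.
move=> [J [oJ J0 cs cM [c0 cv]]] dF.
have dc : differentiable c 0 by exact: smooth_on_diff cs J0.
rewrite (derive_comp (f := c)) ?c0 //; congr ('D_ _ _ _).
by rewrite -cv derive1E.
Qed.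

Lemma curve_near M A v c (U : set E) :
  curve_through M A v c -> open U -> U A -> \forall t \near 0, U (c t) /\ M (c t).
Proof.
move=> [J [oJ J0 cs cM [c0 cv]]] oU UA.
have dc : differentiable c 0 by exact: smooth_on_diff cs J0.
have nU : \forall t \near 0, U (c t) by apply: (near_differentiable dc) => //; rewrite c0.
have nM : \forall t \near 0, M (c t) by exact: (open_near oJ J0).
by apply: filterS2 nU nM.
Qed.

(** A tangential derivative only sees the values on [M], because it can be
    computed along a curve in [M]. *)
Lemma derive_ext_uniq {W : normedModType R} M (U : set E) (F G : E -> W) A v :
  tangent M A v -> open U -> U A -> differentiable F A -> differentiable G A ->
  (forall B, U B -> M B -> F B = G B) -> 'D_v F A = 'D_v G A.
Proof.
move=> [c cc] oU UA dF dG FG.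
rewrite -(curve_comp U cc dF) -(curve_comp U cc dG); apply: near_eq_derive.
by apply: filterS (curve_near cc oU UA) => t [Ut Mt]; exact: FG.
Qed.

Lemma tderivE {W : normedModType R} M (U : set E) (f F : E -> W) A v :
  tangent M A v -> open U -> U A -> differentiable F A ->
  (forall B, U B -> M B -> F B = f B) -> tderiv M f A v = 'D_v F A.
Proof.
move=> Tv oU UA dF Ff; rewrite /tderiv.
have cc := xgetPex (cst A) Tv.
set c := xget _ _ in cc *; rewrite derive1E -(curve_comp U cc dF).
apply: near_eq_derive.
by apply: filterS (curve_near cc oU UA) => t [Ut Mt]; rewrite /= Ff.
Qed.

Lemma smooth_map_of {W : normedModType R} M (U : set E) (F : E -> W) :
  open U -> M `<=` U -> smooth_on U F -> smooth_map M F.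
Proof. by move=> oU MU Fs A MA; exists U, F; split => //; exact: MU. Qed.

(** Smoothness on a subset provides local extensions on unrelated
    neighbourhoods, but the calculations at a point differentiate expressions in
    up to three of them. *)
Lemma smooth_map3 {W1 W2 W3 : normedModType R} M (O : set E) (f1 : E -> W1)
    (f2 : E -> W2) (f3 : E -> W3) A : open O -> O A ->
  smooth_map M f1 -> smooth_map M f2 -> smooth_map M f3 -> M A ->
  exists U : set E, exists F1 : E -> W1, exists F2 : E -> W2, exists F3 : E -> W3,
    [/\ [/\ open U, U A & U `<=` O],
      smooth_on U F1 /\ (forall B, U B -> M B -> F1 B = f1 B),
      smooth_on U F2 /\ (forall B, U B -> M B -> F2 B = f2 B) &
      smooth_on U F3 /\ (forall B, U B -> M B -> F3 B = f3 B)].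
Proof.
move=> oO OA s1 s2 s3 MA.
have [U1 [F1 [oU1 UA1 Fs1 E1]]] := s1 A MA.
have [U2 [F2 [oU2 UA2 Fs2 E2]]] := s2 A MA.
have [U3 [F3 [oU3 UA3 Fs3 E3]]] := s3 A MA.
exists (O `&` U1 `&` U2 `&` U3), F1, F2, F3; split.
- by split=> //; [do 3! apply: openI => //|move=> B [[[]]]].
- by split=> [|B [[[_ ?] _] _]]; [apply: smooth_on_sub Fs1 => B [[[]]]|exact: E1].
- by split=> [|B [[[_ _] ?] _]]; [apply: smooth_on_sub Fs2 => B [[[]]]|exact: E2].
by split=> [|B [_ ?]]; [apply: smooth_on_sub Fs3 => B []|exact: E3].
Qed.

End TangentialDerivative.

(** * The two manifolds of symmetric matrices *)

Section Manifolds.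
Context {R : realType} {n p : nat}.
Context (n_gt0 : (0 < n)%N) (pn : (p <= n)%N).
Local Notation E := 'M[R]_n.
Local Notation g := (@trace_metric R n).
Implicit Types (b : bool) (A B K V v w : E).

(** [GLSym p] and [SLSym p] are treated together: the boolean tells whether the
    determinant is normalized, and then tangent vectors satisfy one more
    equation. *)
Definition symmfd b : set E := if b then SLSym p else GLSym p.

Definition symtan b A v : Prop := v^T = v /\ (b -> \tr (invmx A *m v) = 0).

Lemma symmfd_GL b A : symmfd b A -> GLSym p A.
Proof. by case: b => // -[]. Qed.

Lemma symmfd_tr b A : symmfd b A -> A^T = A.
Proof. by move=> /symmfd_GL[]. Qed.

Lemma symmfd_unit b A : symmfd b A -> A \in unitmx.
Proof. by move=> /symmfd_GL[]. Qed.

Lemma symmfd_det A : symmfd true A -> \det A = (-1) ^+ (n - p).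
Proof. by case. Qed.

Lemma symmfd_congr b A C : C \in unitmx -> (b -> \det C ^+ 2 = 1) ->
  symmfd b A -> symmfd b (C *m A *m C^T).
Proof.
move=> Cu dC MA; have [P Pu AE] := (GLSymP A pn).1 (symmfd_GL MA).
have GLC : GLSym p (C *m A *m C^T).
  apply/(GLSymP _ pn); exists (C *m P); first by rewrite unitmx_mul Cu.
  by rewrite AE trmx_mul !mulmxA.
case: b dC MA => // dC MA; split=> //.
rewrite !det_mulmx det_tr mulrAC -expr2 dC // mul1r.
exact: symmfd_det.
Qed.

Lemma symtan_mxexp b K V t : symmfd b K -> symtan b K V ->
  symmfd b (K *m mxexp (t *: (invmx K *m V))).
Proof.
move=> MK [Vs Vt]; have Ks := symmfd_tr MK; have Ku := symmfd_unit MK.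
rewrite mxexp_congr //; apply: symmfd_congr => //.
  by rewrite unitmx_tr mxexp_unit.
by move=> /Vt tr0; rewrite det_tr det_mxexp // expr1n.
Qed.

Lemma symtan_curve b K V : symmfd b K -> symtan b K V ->
  curve_through (symmfd b) K V (fun t => K *m mxexp (t *: (invmx K *m V))).
Proof.
move=> MK TV; exists setT; split => //.
- exact: openT.
- exact: smooth_on_mxexp.
- by move=> t _; exact: symtan_mxexp.
split; first by rewrite scale0r mxexp0 mulmx1.
by rewrite derive1E derive_mxexp scale0r mxexp0 mulmx1 mulKVmx // (symmfd_unit MK).
Qed.

Lemma velocity_symtan b (J : set R) (c : R -> E) t : open J -> J t ->
  smooth_on J c -> (forall t, J t -> symmfd b (c t)) -> symtan b (c t) ('D_1 c t).
Proof.
move=> oJ Jt cs cM; have dc := smooth_on_diff cs Jt; split.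
  rewrite -(derive_linear_mx (@trmx R n n)) //; apply: near_eq_derive.
  by apply: (open_near oJ Jt) => u Ju; exact: (symmfd_tr (cM u Ju)).
move=> bT; have cu := symmfd_unit (cM t Jt).
have := derive_det (1 : R) dc cu.
have -> : 'D_1 (fun y => \det (c y) : R) t = 0.
  rewrite -[RHS](derive_cst ((-1) ^+ (n - p) : R) t (1 : R)); apply: near_eq_derive.
  apply: (open_near oJ Jt) => u Ju; apply: symmfd_det.
  by have := cM u Ju; rewrite bT.
move=> /esym/eqP; rewrite mulf_eq0 => /orP[|/eqP//].
by move: cu; rewrite unitmxE unitfE => /negbTE ->.
Qed.

(** A tangent vector satisfies the equations of [symtan] because the transpose
    and the determinant are constant along curves (Jacobi's formula);
    conversely it is the velocity of an exponential curve. *)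
Lemma tangentP b A v : symmfd b A -> tangent (symmfd b) A v <-> symtan b A v.
Proof.
move=> MA; split=> [[c [J [oJ J0 cs cM [c0 cv]]]]|Tv]; last first.
  by eexists; exact: symtan_curve.
by have := velocity_symtan oJ J0 cs cM; rewrite c0 -derive1E cv.
Qed.

(** ** The trace metric *)

Lemma gDl A u v w : g A (u + v) w = g A u w + g A v w.
Proof. by rewrite /trace_metric mulmxDr !mulmxDl linearD. Qed.

Lemma gNl A u w : g A (- u) w = - g A u w.
Proof. by rewrite /trace_metric mulmxN !mulNmx linearN. Qed.

Lemma gZl A a u w : g A (a *: u) w = a * g A u w.
Proof. by rewrite /trace_metric -scalemxAr -!scalemxAl linearZ. Qed.

Lemma gC A u w : g A u w = g A w u.
Proof. by rewrite /trace_metric -mulmxA mxtrace_mulC mulmxA. Qed.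

Lemma gDr A u v w : g A u (v + w) = g A u v + g A u w.
Proof. by rewrite gC gDl !(gC A u). Qed.

Lemma gNr A u w : g A u (- w) = - g A u w.
Proof. by rewrite gC gNl gC. Qed.

Lemma g_self A w : A \in unitmx -> g A A w = \tr (invmx A *m w).
Proof. by move=> Au; rewrite /trace_metric mulVmx // mul1mx. Qed.

Lemma natr_n0 : (n%:R : R) != 0.
Proof. by rewrite pnatr_eq0 -lt0n. Qed.

(** [w] is tested against the tangential projection of [A *m w *m A], for which
    the metric gives the squared Euclidean norm of [w]. *)
Lemma g_nondegenerate b A w : symmfd b A -> symtan b A w ->
  (forall z, symtan b A z -> g A w z = 0) -> w = 0.
Proof.
move=> MA [ws wt] H; have Au := symmfd_unit MA; have As := symmfd_tr MA.
pose y := A *m w *m A; pose a := b%:R * (\tr (invmx A *m y) / n%:R).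
have ys : y^T = y by rewrite /y !trmx_mul As ws mulmxA.
have Tz : symtan b A (y - a *: A).
  split; first by rewrite linearB linearZ /= ys As.
  move=> bT; rewrite mulmxBr -scalemxAr mulVmx // linearB linearZ /= mxtrace1.
  by rewrite /a bT mul1r divfK ?subrr // natr_n0.
have := H _ Tz; rewrite gDr -scaleNr [g A w (_ *: _)]gC gZl g_self //.
have -> : - a * \tr (invmx A *m w) = 0.
  by rewrite /a; case: (b) wt => [->//|_]; rewrite ?mulr0 // mul0r oppr0 mul0r.
rewrite addr0 /trace_metric /y.
rewrite mxtrace_mulC !mulmxA mulmxK // -!mulmxA mxtrace_mulC -!mulmxA.
rewrite mulVmx // mulmx1 => trw.
have sq_ge0 i : 0 <= \sum_j w i j ^+ 2 by apply: sumr_ge0 => j _; exact: sqr_ge0.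
have {}trw : \sum_i \sum_j w i j ^+ 2 = 0.
  apply: etrans trw; rewrite /mxtrace; apply: eq_bigr => i _; rewrite mxE; apply: eq_bigr => j _.
  have -> : w j i = w i j by rewrite -{1}ws mxE.
  by rewrite expr2.
have row0 i : \sum_j w i j ^+ 2 = 0.
  by apply: (psumr_eq0P _ trw) => // k _; exact: sq_ge0.
apply/matrixP => i j; rewrite mxE; apply/eqP; rewrite -sqrf_eq0; apply/eqP.
by apply: (psumr_eq0P _ (row0 i)) => // k _; exact: sqr_ge0.
Qed.

(** ** Vector fields *)

(** A global field through a given tangent vector: the constant field [z],
    projected along the position vector when the determinant is fixed. *)
Definition symfield b (z : E) : E -> E :=
  fun B => z - (b%:R * (\tr (invmx B *m z) / n%:R)) *: B.

Lemma smooth_on_inv : smooth_on [set A : E | A \in unitmx] (fun A : E => invmx A).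
Proof.
apply: smooth_on_invmx => //; [exact: open_unitmx|exact: smooth_on_id].
Qed.

Lemma symfield_smooth b z : smooth_on [set A : E | A \in unitmx] (symfield b z).
Proof.
have oU := @open_unitmx R n.
apply: smooth_onD => //; first exact: smooth_on_cst.
have -> : (fun x : E => - ((b%:R * (\tr (invmx x *m z) / n%:R)) *: x)) =
    (fun x => (- (b%:R / n%:R) * \tr (invmx x *m z)) *: x).
  by apply/funext => x; rewrite -scaleNr; congr (_ *: _); ring.
apply: smooth_on_scale => //; last exact: smooth_on_id.
apply: smooth_onM => //; first exact: smooth_on_cst.
apply: smooth_on_mxtrace => //; apply: smooth_on_mulmx => //.
  exact: smooth_on_inv.
exact: smooth_on_cst.
Qed.

Lemma symfield_tan b z A : z^T = z -> symmfd b A -> symtan b A (symfield b z A).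
Proof.
move=> zs MA; have Au := symmfd_unit MA; split.
  by rewrite /symfield linearB linearZ /= zs (symmfd_tr MA).
move=> bT; rewrite /symfield mulmxBr -scalemxAr mulVmx // linearB linearZ /= mxtrace1.
by rewrite bT mul1r divfK ?subrr // natr_n0.
Qed.

Lemma symfield_vf b z : z^T = z -> vector_field (symmfd b) (symfield b z).
Proof.
move=> zs; split; last by move=> A MA; apply/tangentP => //; exact: symfield_tan.
apply: (smooth_map_of (U := [set A : E | A \in unitmx])); first exact: open_unitmx.
  by move=> A; exact: symmfd_unit.
exact: symfield_smooth.
Qed.

Lemma symfieldE b z A : symtan b A z -> symfield b z A = z.
Proof.
move=> [_ zt]; rewrite /symfield; case: b zt => [->//|_].
  by rewrite mul0r mulr0 scale0r subr0.
by rewrite mul0r scale0r subr0.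
Qed.

(** ** The Levi-Civita connection *)

(** The Christoffel tensor of the trace metric, up to sign: the Levi-Civita
    connection is the flat derivative minus this symmetric tensor. *)
Definition chris A v w : E := 2^-1 *: (v *m invmx A *m w + w *m invmx A *m v).

Definition conn b : connection := fun X Y A =>
  tderiv (symmfd b) Y A (X A) - chris A (X A) (Y A).

Lemma chrisC A v w : chris A v w = chris A w v.
Proof. by rewrite /chris addrC. Qed.

Lemma chrisDl A u v w : chris A (u + v) w = chris A u w + chris A v w.
Proof. by rewrite /chris !mulmxDl !mulmxDr -scalerDr addrACA. Qed.

Lemma chrisZl A a v w : chris A (a *: v) w = a *: chris A v w.
Proof.
by rewrite /chris -!scalemxAl -scalemxAr -scalerDr scalerA mulrC -scalerA.
Qed.

Lemma chrisDr A u v w : chris A w (u + v) = chris A w u + chris A w v.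
Proof. by rewrite chrisC chrisDl !(chrisC A w). Qed.

Lemma chrisZr A a v w : chris A w (a *: v) = a *: chris A w v.
Proof. by rewrite chrisC chrisZl chrisC. Qed.

Lemma chris_tr A v w : A^T = A -> v^T = v -> w^T = w -> (chris A v w)^T = chris A v w.
Proof.
move=> As vs ws; rewrite /chris linearZ linearD /= !trmx_mul trmx_inv As vs ws.
by rewrite !mulmxA addrC.
Qed.

Lemma tr_chris A v w : A \in unitmx -> \tr (invmx A *m chris A v w) = g A v w.
Proof.
move=> Au; rewrite /chris -scalemxAr mxtraceZ mulmxDr mxtraceD !mulmxA.
rewrite -!/(trace_metric _ _ _) (gC A w); set x := g A v w.
by rewrite -mulr2n -[x *+ 2]mulr_natl mulKf.
Qed.

Lemma derive_inv A v : A \in unitmx ->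
  'D_v (fun B : E => invmx B) A = - (invmx A *m v *m invmx A).
Proof. by move=> Au; rewrite derive_invmx // derive_id. Qed.

(** The cyclic symmetry of this trace is what makes the connection compatible
    with the metric. *)
Definition tr3 A u v w : R := \tr (invmx A *m u *m (invmx A *m v) *m (invmx A *m w)).

Lemma tr3_rot A u v w : tr3 A u v w = tr3 A v w u.
Proof. by rewrite /tr3 -mulmxA mxtrace_mulC. Qed.

Lemma g_chris A u v w : g A (chris A u v) w = 2^-1 * (tr3 A u v w + tr3 A v u w).
Proof.
rewrite /trace_metric /chris /tr3 -scalemxAr -!scalemxAl mxtraceZ.
by rewrite mulmxDr !mulmxDl mxtraceD !mulmxA.
Qed.

Lemma half_sum4 (s t a c : R) :
  - s + a + (- t) + c = a - 2^-1 * (s + t) + (c - 2^-1 * (t + s)).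
Proof. by field. Qed.

(** The differential of the metric tensor is compensated by [chris]. *)
Lemma derive_g A v (Y Z : E -> E) : A \in unitmx ->
  differentiable Y A -> differentiable Z A ->
  'D_v (fun B => g B (Y B) (Z B) : R) A =
  g A ('D_v Y A - chris A v (Y A)) (Z A) + g A (Y A) ('D_v Z A - chris A v (Z A)).
Proof.
move=> Au dY dZ; have di := differentiable_invmx Au.
have d1 : differentiable (fun B : E => invmx B *m Y B) A by exact: differentiable_mulmx.
have d2 : differentiable (fun B : E => invmx B *m Y B *m invmx B) A.
  exact: differentiable_mulmx.
have d3 : differentiable (fun B : E => invmx B *m Y B *m invmx B *m Z B) A.
  exact: differentiable_mulmx.
rewrite gDl gNl gDr gNr (gC A (Y A) (chris _ _ _)) !g_chris.
rewrite (tr3_rot A v (Z A) (Y A)) (tr3_rot A (Z A) (Y A) v) (tr3_rot A (Z A) v (Y A)).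
rewrite -half_sum4.
rewrite /trace_metric (derive_linear_mx (@mxtrace R n)) //.
rewrite derive_mulmx // derive_mulmx // derive_mulmx // derive_inv // /tr3.
by rewrite /= !mulNmx !mulmxN !mulmxDl !mulNmx !mxtraceD !raddfN /= !mulmxA.
Qed.

(** Differentiating the equation of the tangent space gives the second equation
    of [symtan] for covariant derivatives. *)
Lemma derive_tr_inv {V : normedModType R} (c Y : V -> E) (x w : V) : c x \in unitmx ->
  differentiable c x -> differentiable Y x ->
  'D_w (fun y => \tr (invmx (c y) *m Y y) : R) x =
  \tr (invmx (c x) *m ('D_w Y x - chris (c x) ('D_w c x) (Y x))).
Proof.
move=> Au dc dY; have di := differentiable_invmx_comp dc Au.
rewrite (derive_linear_mx (@mxtrace R n)); last exact: differentiable_mulmx.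
rewrite derive_mulmx // derive_invmx // mulmxBr linearD linearB /= tr_chris //.
by rewrite mulNmx linearN addrC.
Qed.

Lemma connE b (X Y F : E -> E) (U : set E) A :
  symtan b A (X A) -> symmfd b A -> open U -> U A -> differentiable F A ->
  (forall B, U B -> symmfd b B -> F B = Y B) ->
  conn b X Y A = 'D_(X A) F A - chris A (X A) (Y A).
Proof.
move=> TX MA oU UA dF FY; rewrite /conn (tderivE (U := U) (F := F)) //.
exact/tangentP.
Qed.

Lemma vf_symtan b X A : vector_field (symmfd b) X -> symmfd b A -> symtan b A (X A).
Proof. by move=> [_ Xt] MA; apply/tangentP => //; exact: Xt. Qed.

(** A directional derivative along a tangent vector of a field which is tangent
    along the manifold; only the values on the manifold matter, so that the
    field may come from a larger manifold. *)
Lemma derive_symtan b (F : E -> E) (U : set E) A v :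
  symtan b A v -> symmfd b A -> open U -> U A -> differentiable F A ->
  (forall B, U B -> symmfd b B -> symtan b B (F B)) ->
  symtan b A ('D_v F A - chris A v (F A)).
Proof.
move=> Tv MA oU UA dF Ft; have Au := symmfd_unit MA.
have Tv' : tangent (symmfd b) A v by apply/tangentP.
have [Fs _] := Ft A UA MA.
split.
  rewrite linearB /= chris_tr ?(symmfd_tr MA) //; last by case: Tv.
  congr (_ - _); rewrite -(derive_linear_mx (@trmx R n n)) //.
  apply: (derive_ext_uniq Tv' oU UA) => //.
    exact: (differentiable_linear_mx (@trmx R n n)).
  by move=> B UB MB; case: (Ft B UB MB).
have did : differentiable (fun B : E => B) A by have [] := is_diff_id A.
move=> bT; have := @derive_tr_inv E (fun B => B) F A v Au did dF.
rewrite derive_id => <-; rewrite -[RHS](derive_cst (0 : R) A v).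
apply: (derive_ext_uniq Tv' oU UA) => //.
  apply: (differentiable_linear_mx (@mxtrace R n)).
  by apply: differentiable_mulmx => //; exact: differentiable_invmx.
by move=> B UB MB; case: (Ft B UB MB) => _; exact.
Qed.

Lemma smooth_on_chris {V : normedModType R} (U : set V) (c F G : V -> E) :
  open U -> (forall x, U x -> c x \in unitmx) ->
  smooth_on U c -> smooth_on U F -> smooth_on U G ->
  smooth_on U (fun x => chris (c x) (F x) (G x)).
Proof.
move=> oU Uu cs Fs Gs; rewrite /chris.
have si : smooth_on U (fun x => invmx (c x)) by exact: smooth_on_invmx.
apply: smooth_on_scale => //; first exact: smooth_on_cst.
apply: smooth_onD => //; apply: smooth_on_mulmx => //; exact: smooth_on_mulmx.
Qed.

Lemma smooth_onB_mx {V : normedModType R} {m k : nat} (U : set V)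
    (f h : V -> 'M[R]_(m, k)) : open U ->
  smooth_on U f -> smooth_on U h -> smooth_on U (fun x => f x - h x).
Proof.
move=> oU fs hs; apply: smooth_onD => //.
have -> : (fun x => - h x) = (fun x => (-1 : R) *: h x).
  by apply/funext => x; rewrite scaleN1r.
by apply: smooth_on_scale => //; exact: smooth_on_cst.
Qed.

Lemma smooth_map_conn b X Y : vector_field (symmfd b) X -> vector_field (symmfd b) Y ->
  smooth_map (symmfd b) (conn b X Y).
Proof.
move=> vX vY A MA.
have [U [F [G [_ [[oU UA Uu] [Fs FX] [Gs GY] _]]]]] :=
  smooth_map3 (@open_unitmx R n) (symmfd_unit MA) vX.1 vY.1 vY.1 MA.
exists U, (fun B => 'D_(F B) G B - chris B (F B) (G B)); split=> //.
  apply: smooth_onB_mx => //; first exact: smooth_on_derive_along.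
  by apply: (smooth_on_chris (c := fun B => B)) => //; exact: smooth_on_id.
move=> B UB MB; rewrite (connE (F := G) (U := U)) //.
- by rewrite FX // GY.
- exact: vf_symtan.
exact: smooth_on_diff Gs UB.
Qed.

Lemma vector_field_conn b X Y : vector_field (symmfd b) X ->
  vector_field (symmfd b) Y -> vector_field (symmfd b) (conn b X Y).
Proof.
move=> vX vY; split; first exact: smooth_map_conn.
move=> A MA; apply/tangentP => //.
have [U [F [oU UA Fs FY]]] := vY.1 A MA; have TX := vf_symtan vX MA.
have dF := smooth_on_diff Fs UA.
rewrite (connE (F := F) (U := U)) // -FY //.
by apply: (derive_symtan (U := U)) => // B UB MB; rewrite FY //; exact: vf_symtan.
Qed.

Lemma g_levi_civita b : is_levi_civita (symmfd b) g (conn b).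
Proof.
split=> [X Y|f X X' Y sf vX vX' vY A MA|X Y Y' vX vY vY' A MA|f X Y sf vX vY A MA|X Y vX vY A MA|X Y Z vX vY vZ A MA].
- exact: vector_field_conn.
- have [U [F [oU UA Fs FY]]] := vY.1 A MA; have dF := smooth_on_diff Fs UA.
  have [[X1 X2] [X1' X2']] := (vf_symtan vX MA, vf_symtan vX' MA).
  rewrite !(connE (F := F) (U := U)) //; last first.
    split; first by rewrite linearD linearZ /= X1 X1'.
    by move=> bT; rewrite mulmxDr -scalemxAr mxtraceD mxtraceZ X2 // X2' // mulr0 addr0.
  rewrite !deriveE // linearD linearZ /= chrisDl chrisZl scalerBr.
  by rewrite opprD addrACA.
- have [U [_ [F [F' [[oU UA _] _ [Fs FY] [Fs' FY']]]]]] :=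
    smooth_map3 (@open_unitmx R n) (symmfd_unit MA) vX.1 vY.1 vY'.1 MA.
  have dF := smooth_on_diff Fs UA; have dF' := smooth_on_diff Fs' UA.
  have TX := vf_symtan vX MA.
  rewrite (connE (F := F) (U := U) (Y := Y)) // (connE (F := F') (U := U) (Y := Y')) //.
  rewrite (connE (F := fun B => F B + F' B) (U := U)) //.
  - by rewrite deriveD' // chrisDr opprD addrACA.
  - exact: differentiableD.
  by move=> B UB MB; rewrite FY // FY'.
- have [U [_ [h [F [[oU UA _] _ [hs hf] [Fs FY]]]]]] :=
    smooth_map3 (@open_unitmx R n) (symmfd_unit MA) vX.1 sf vY.1 MA.
  have dF := smooth_on_diff Fs UA; have dh := smooth_on_diff hs UA.
  have TX := vf_symtan vX MA.
  have TX' : tangent (symmfd b) A (X A) by apply/tangentP.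
  rewrite (connE (F := F) (U := U) (Y := Y)) //.
  rewrite (connE (F := fun B => h B *: F B) (U := U)) //; last first.
  - by move=> B UB MB; rewrite hf // FY.
  - exact: differentiable_scale.
  rewrite (tderivE (F := h) TX' oU UA) // derive_scale // chrisZr hf // FY //.
  by rewrite scalerBr addrA.
- have TX' : tangent (symmfd b) A (X A) by exact: vX.2.
  have TY' : tangent (symmfd b) A (Y A) by exact: vY.2.
  by rewrite /conn /bracket chrisC opprB addrA subrK.
have [U [_ [F [F' [[oU UA Uu] _ [Fs FY] [Fs' FZ]]]]]] :=
  smooth_map3 (@open_unitmx R n) (symmfd_unit MA) vX.1 vY.1 vZ.1 MA.
have dF := smooth_on_diff Fs UA; have dF' := smooth_on_diff Fs' UA.
have TX := vf_symtan vX MA.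
have TX' : tangent (symmfd b) A (X A) by apply/tangentP.
have Au := symmfd_unit MA.
rewrite (connE (F := F) (U := U) (Y := Y)) // (connE (F := F') (U := U) (Y := Z)) //.
rewrite (tderivE (U := U) (F := fun B => g B (F B) (F' B))) //.
- by rewrite derive_g // FY // FZ.
- apply: (differentiable_linear_mx (@mxtrace R n)).
  have di := differentiable_invmx Au.
  by apply: differentiable_mulmx => //; apply: differentiable_mulmx => //; exact: differentiable_mulmx.
by move=> B UB MB; rewrite FY // FZ.
Qed.

Lemma koszul_arith (a1 a2 a3 b1 b2 b3 : R) :
  (a1 + b1) + (a2 + b2) - (a3 + b3) + (a1 - b2) - (b1 - a3) - (a2 - b3) = 2 * a1.
Proof. ring. Qed.

(** Koszul formula: the metric rule for the three cyclic arrangements of the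
    fields, combined by means of the vanishing torsion, leaves a single covariant
    derivative. *)
Lemma koszul b D X Y Z A : is_levi_civita (symmfd b) g D ->
  vector_field (symmfd b) X -> vector_field (symmfd b) Y ->
  vector_field (symmfd b) Z -> symmfd b A ->
  2 * g A (D X Y A) (Z A) =
  tderiv (symmfd b) (fun B => g B (Y B) (Z B) : R) A (X A) +
  tderiv (symmfd b) (fun B => g B (Z B) (X B) : R) A (Y A) -
  tderiv (symmfd b) (fun B => g B (X B) (Y B) : R) A (Z A) +
  g A (bracket (symmfd b) X Y A) (Z A) -
  g A (bracket (symmfd b) X Z A) (Y A) -
  g A (bracket (symmfd b) Y Z A) (X A).
Proof.
move=> LC vX vY vZ MA.
rewrite !(lc_metric LC) // -!(lc_torsion_free LC) // !gDl !gNl.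
rewrite (gC A (Y A) (D X Z A)) (gC A (Z A) (D Y X A)) (gC A (X A) (D Z Y A)).
by rewrite koszul_arith.
Qed.

(** The right-hand side of the Koszul formula does not mention the connection,
    and every tangent vector is the value of a vector field. *)
Lemma levi_civita_uniq b D D' X Y A : is_levi_civita (symmfd b) g D ->
  is_levi_civita (symmfd b) g D' -> vector_field (symmfd b) X ->
  vector_field (symmfd b) Y -> symmfd b A -> D X Y A = D' X Y A.
Proof.
move=> LC LC' vX vY MA.
have TD := vf_symtan (lc_field LC vX vY) MA.
have TD' := vf_symtan (lc_field LC' vX vY) MA.
apply/eqP; rewrite -subr_eq0; apply/eqP; apply: (g_nondegenerate MA).
  split; first by rewrite linearB /= TD.1 TD'.1.
  by move=> bT; rewrite mulmxBr linearB /= TD.2 // TD'.2 // subr0.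
move=> z Tz; have vz := symfield_vf b Tz.1.
have two0 : (2 : R) != 0 by [].
apply: (mulfI two0); rewrite mulr0 gDl gNl mulrBr -(symfieldE Tz).
by rewrite (koszul LC) // (koszul LC') // subrr.
Qed.

Lemma levi_civita_symmfd b : is_levi_civita (symmfd b) g (levi_civita (symmfd b) g).
Proof.
have H : exists D, [set D | is_levi_civita (symmfd b) g D] D.
  by exists (conn b); exact: g_levi_civita.
exact: (xgetPex (fun _ _ _ => 0) H).
Qed.

Lemma levi_civitaE b X Y A : vector_field (symmfd b) X ->
  vector_field (symmfd b) Y -> symmfd b A ->
  levi_civita (symmfd b) g X Y A = conn b X Y A.
Proof.
move=> vX vY MA.
exact: (levi_civita_uniq (levi_civita_symmfd b) (g_levi_civita b) vX vY MA).
Qed.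

(** The connections of both manifolds are given by the same formula, which
    preserves tangency to the smaller one. *)
Lemma symmfd_totally_geodesic : totally_geodesic (symmfd true) (symmfd false) g.
Proof.
move=> A U X Y MA oU UA vX vY XYt.
have MA' : symmfd false A by exact: symmfd_GL MA.
have [TX TY] := XYt A MA UA.
have [U' [F [oU' UA' Fs FY]]] := vY.1 A MA'; have dF := smooth_on_diff Fs UA'.
rewrite levi_civitaE // (connE (F := F) (U := U')) //; last exact: vf_symtan.
apply/tangentP => //; rewrite -FY //.
apply: (derive_symtan (U := U `&` U')) => //.
- exact/tangentP.
- exact: openI.
move=> B [UB UB'] MB; rewrite FY //; last exact: symmfd_GL MB.
by apply/tangentP => //; case: (XYt B MB UB).
Qed.

(** ** Isometries *)

Lemma smooth_on_congr (C : E) : smooth_on setT (congruence C).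
Proof.
have oT : open [set: E] := openT.
apply: smooth_on_mulmx => //; last exact: smooth_on_cst.
by apply: smooth_on_mulmx => //; [exact: smooth_on_cst|exact: smooth_on_id].
Qed.

Lemma derive_congr (C A v : E) : 'D_v (congruence C) A = congruence C v.
Proof.
rewrite /congruence derive_mulmx // ?derive_cst ?mulmx0 ?addr0; last first.
  exact: differentiable_mulmx.
by rewrite derive_mulmx // derive_cst mul0mx add0r derive_id.
Qed.

Lemma tderiv_congr b C A v : symmfd b A -> symtan b A v ->
  tderiv (symmfd b) (congruence C) A v = congruence C v.
Proof.
move=> MA Tv; rewrite (tderivE (U := setT) (F := congruence C)) ?derive_congr //.
- exact/tangentP.
- exact: openT.
exact: smooth_on_diff (smooth_on_congr C) I.
Qed.

Lemma smooth_on_congr_inv (C : E) :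
  smooth_on [set A : E | A \in unitmx] (fun A => congruence C (invmx A)).
Proof.
have oU := @open_unitmx R n.
apply: smooth_on_mulmx => //; last exact: smooth_on_cst.
by apply: smooth_on_mulmx => //; [exact: smooth_on_cst|exact: smooth_on_inv].
Qed.

Lemma tderiv_congr_inv b C A v : symmfd b A -> symtan b A v ->
  tderiv (symmfd b) (fun A => congruence C (invmx A)) A v =
  - congruence C (invmx A *m v *m invmx A).
Proof.
move=> MA Tv; have Au := symmfd_unit MA; have di := differentiable_invmx Au.
rewrite (tderivE (U := [set A : E | A \in unitmx])
  (F := fun A => congruence C (invmx A))) //.
- rewrite (derive_comp (f := fun A : E => invmx A)) //.
    by rewrite derive_congr derive_inv // /congruence mulmxN mulNmx.
  exact: smooth_on_diff (smooth_on_congr C) I.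
- exact/tangentP.
- exact: open_unitmx.
exact: smooth_on_diff (smooth_on_congr_inv C) Au.
Qed.

Lemma congr_unit (C A : E) : C \in unitmx -> A \in unitmx -> congruence C A \in unitmx.
Proof. by move=> Cu Au; rewrite !unitmx_mul unitmx_tr Cu Au. Qed.

Lemma invmx_congr (C A : E) : C \in unitmx -> A \in unitmx ->
  invmx (congruence C A) = congruence (invmx C)^T (invmx A).
Proof.
move=> Cu Au; have CAu := congr_unit Cu Au.
have H : congruence C A *m congruence (invmx C)^T (invmx A) = 1%:M.
  rewrite /congruence trmxK trmx_inv !mulmxA mulmxK ?unitmx_tr // mulmxK //.
  by rewrite mulmxV.
by rewrite -[RHS](mulKmx CAu) H mulmx1.
Qed.

Lemma g_congr (C A v w : E) : C \in unitmx -> A \in unitmx ->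
  g (congruence C A) (congruence C v) (congruence C w) = g A v w.
Proof.
move=> Cu Au; rewrite /trace_metric invmx_congr // /congruence trmxK trmx_inv.
have Cu' : C^T \in unitmx by rewrite unitmx_tr.
rewrite !mulmxA !mulmxKV // mulmxK //.
by rewrite -!mulmxA mxtrace_mulC -!mulmxA mulmxV // mulmx1 !mulmxA.
Qed.

Lemma g_inv (A v w : E) : A \in unitmx ->
  g (invmx A) (invmx A *m v *m invmx A) (invmx A *m w *m invmx A) = g A v w.
Proof.
move=> Au; rewrite /trace_metric invmxK !mulmxA !mulmxV // !mul1mx.
by rewrite mulmxKV // mxtrace_mulC !mulmxA.
Qed.

Lemma symmfd_inv b A : symmfd b A -> symmfd b (invmx A).
Proof.
move=> MA; have Au := symmfd_unit MA; have As := symmfd_tr MA.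
have -> : invmx A = invmx A *m A *m (invmx A)^T by rewrite mulVmx // mul1mx trmx_inv As.
apply: symmfd_congr => //; first by rewrite unitmx_inv.
case: b MA => // MA _; rewrite det_inv exprVn (symmfd_det MA).
by rewrite -exprM mulnC exprM sqrrN !expr1n invr1.
Qed.

Lemma congruence_isometry b C : C \in unitmx -> (b -> \det C ^+ 2 = 1) ->
  is_isometry (symmfd b) g (congruence C).
Proof.
move=> Cu dC; have Mc A : symmfd b A -> symmfd b (congruence C A).
  exact: symmfd_congr.
have Mi A : symmfd b A -> symmfd b (congruence (invmx C) A).
  apply: symmfd_congr; first by rewrite unitmx_inv.
  by move=> /dC; rewrite det_inv exprVn => ->; rewrite invr1.
have sm D : smooth_map (symmfd b) (congruence D).
  by apply: (smooth_map_of (U := setT)) => //; [exact: openT|exact: smooth_on_congr].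
split=> //.
  exists (congruence (invmx C)); split=> // A MA; split; first exact: Mi.
    by rewrite /congruence !mulmxA mulVmx // mul1mx trmx_inv mulmxK // unitmx_tr.
  by rewrite /congruence !mulmxA mulmxV // mul1mx trmx_inv mulmxKV // unitmx_tr.
move=> A v w MA /tangentP-/(_ MA) Tv /tangentP-/(_ MA) Tw.
by rewrite !tderiv_congr // g_congr // (symmfd_unit MA).
Qed.

Lemma congruence_inv_isometry b C : C \in unitmx -> (b -> \det C ^+ 2 = 1) ->
  is_isometry (symmfd b) g (fun A => congruence C (invmx A)).
Proof.
move=> Cu dC.
have Mc D : D \in unitmx -> (b -> \det D ^+ 2 = 1) -> forall A,
    symmfd b A -> symmfd b (congruence D (invmx A)).
  by move=> Du dD A MA; apply: symmfd_congr => //; exact: symmfd_inv.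
have sm D : smooth_map (symmfd b) (fun A => congruence D (invmx A)).
  apply: (smooth_map_of (U := [set A : E | A \in unitmx])) => //.
  - exact: open_unitmx.
  - by move=> A /symmfd_unit.
  exact: smooth_on_congr_inv.
split=> //; first exact: Mc.
  exists (fun A => congruence C^T (invmx A)); split=> // A MA.
  have Au := symmfd_unit MA; have iAu : invmx A \in unitmx by rewrite unitmx_inv.
  have CTu : C^T \in unitmx by rewrite unitmx_tr.
  split; first by apply: Mc => //; rewrite det_tr.
    rewrite invmx_congr // invmxK /congruence !trmxK trmx_inv !mulmxA mulmxV //.
    by rewrite mul1mx mulmxKV.
  rewrite invmx_congr // invmxK /congruence !trmxK trmx_inv trmxK !mulmxA mulmxV //.
  by rewrite mul1mx mulmxKV.
move=> A v w MA /tangentP-/(_ MA) Tv /tangentP-/(_ MA) Tw.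
have Au := symmfd_unit MA.
rewrite !tderiv_congr_inv // gNl gNr opprK g_congr ?unitmx_inv //.
exact: g_inv.
Qed.

Lemma inversion_isometry b : is_isometry (symmfd b) g inversion.
Proof.
have -> : inversion = (fun A : E => congruence 1%:M (invmx A)).
  by apply/funext => A; rewrite /congruence trmx1 mulmx1 mul1mx.
by apply: congruence_inv_isometry; rewrite ?unitmx1 // det1 expr1n.
Qed.

Lemma symmfd_symmetry b Q : symmfd b Q ->
  symmetry_at (symmfd b) g Q (congruence Q \o inversion).
Proof.
move=> MQ; have Qu := symmfd_unit MQ; have Qs := symmfd_tr MQ; split.
- apply: congruence_inv_isometry => //; case: b MQ => // MQ _.
  by rewrite (symmfd_det MQ) -exprM mulnC exprM sqrrN !expr1n.
- by rewrite /= /congruence /inversion mulmxV // mul1mx Qs.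
move=> v /tangentP-/(_ MQ) Tv.
rewrite -[_ \o _]/(fun A => congruence Q (invmx A)) tderiv_congr_inv //.
by rewrite /congruence !mulmxA mulmxV // mul1mx Qs mulmxKV.
Qed.

Lemma symmfd_homogeneous : homogeneous (symmfd true) g.
Proof.
move=> A B MA MB.
have [P Pu AE] := (GLSymP A pn).1 (symmfd_GL MA).
have [Q Qu BE] := (GLSymP B pn).1 (symmfd_GL MB).
have QPu : Q *m invmx P \in unitmx by rewrite unitmx_mul Qu unitmx_inv.
have AB : congruence (Q *m invmx P) A = B.
  rewrite /congruence trmx_mul trmx_inv AE BE !mulmxA mulmxKV //.
  by rewrite mulmxK // unitmx_tr.
exists (congruence (Q *m invmx P)); split=> //; apply: congruence_isometry => // _.
have dA : \det A != 0 by rewrite -unitfE -unitmxE (symmfd_unit MA).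
have := congr1 determinant AB; rewrite /congruence !det_mulmx det_tr.
rewrite (symmfd_det MB) -(symmfd_det MA) -det_mulmx => E0.
by apply: (mulIf dA); rewrite mul1r -[RHS]E0 expr2 mulrAC.
Qed.

(** ** Geodesics *)

Lemma half_double (x : E) : 2^-1 *: (x + x) = x.
Proof.
have -> : x + x = (2 : R) *: x by rewrite scaler_nat mulr2n.
by rewrite scalerA mulVf // scale1r.
Qed.

Section AlongCurve.
Context (b : bool) (I : set R) (c : R -> E).
Context (oI : open I) (cs : smooth_on I c) (cM : forall t, I t -> symmfd b (c t)).
Local Notation M := (symmfd b).

Definition covD (Z : R -> E) (t : R) : E := 'D_1 Z t - chris (c t) ('D_1 c t) (Z t).

Lemma along_symtan Z t : field_along M I c Z -> I t -> symtan b (c t) (Z t).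
Proof. by move=> [_ ZT] It; apply/tangentP; [exact: cM|exact: ZT]. Qed.

Lemma field_alongP Z : smooth_on I Z -> (forall t, I t -> symtan b (c t) (Z t)) ->
  field_along M I c Z.
Proof. by move=> Zs ZT; split=> // t It; apply/tangentP; [exact: cM|exact: ZT]. Qed.

Lemma field_along_velocity : field_along M I c ('D_1 c).
Proof.
by apply: field_alongP => [|t It]; [exact: smooth_on_derive|exact: velocity_symtan It cs cM].
Qed.

Lemma field_along0 : field_along M I c (fun=> 0).
Proof.
apply: field_alongP => [|t It]; first exact: smooth_on_cst.
by split; [rewrite linear0|rewrite mulmx0 linear0].
Qed.

Lemma field_alongD Z Z' : field_along M I c Z -> field_along M I c Z' ->
  field_along M I c (fun t => Z t + Z' t).
Proof.
move=> fZ fZ'; apply: field_alongP => [|t It].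
  by apply: smooth_onD => //; [case: fZ|case: fZ'].
have [[s1 t1] [s2 t2]] := (along_symtan fZ It, along_symtan fZ' It); split.
  by rewrite linearD /= s1 s2.
by move=> bT; rewrite mulmxDr linearD /= t1 // t2 // addr0.
Qed.

Lemma field_alongZ (h : R -> R) Z : smooth_on I h -> field_along M I c Z ->
  field_along M I c (fun t => h t *: Z t).
Proof.
move=> hs fZ; apply: field_alongP => [|t It].
  by apply: smooth_on_scale => //; case: fZ.
have [s1 t1] := along_symtan fZ It; split; first by rewrite linearZ /= s1.
by move=> bT; rewrite -scalemxAr linearZ /= t1 // mulr0.
Qed.

Lemma covD_is_covariant : is_covariant_derivative_along M g I c covD.
Proof.
have dc t : I t -> differentiable c t by move=> It; exact: smooth_on_diff cs It.
split=> [Z fZ|Z Z' [sZ _] [sZ' _] t It|h Z hs [sZ _] t It|X Y vX vY t It Xc].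
- have sZ := fZ.1; apply: field_alongP => [|t It].
    apply: smooth_onB_mx => //; first exact: smooth_on_derive.
    apply: smooth_on_chris => //; last exact: smooth_on_derive.
    by move=> t It; exact: symmfd_unit (cM It).
  have [cs1 _] := velocity_symtan oI It cs cM.
  have cu := symmfd_unit (cM It); have dZ := smooth_on_diff sZ It.
  split.
    have [Zt _] := along_symtan fZ It.
    rewrite linearB /= chris_tr ?(symmfd_tr (cM It)) //; congr (_ - _).
    rewrite -(derive_linear_mx (@trmx R n n)) //; apply: near_eq_derive.
    by apply: (open_near oI It) => u Iu; exact: (along_symtan fZ Iu).1.
  move=> bT; rewrite -derive_tr_inv //; last exact: dc.
  rewrite -[RHS](derive_cst (0 : R) t (1 : R)); apply: near_eq_derive.
  by apply: (open_near oI It) => u Iu; exact: (along_symtan fZ Iu).2.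
- have dZ := smooth_on_diff sZ It; have dZ' := smooth_on_diff sZ' It.
  by rewrite /covD deriveD' // chrisDr opprD addrACA.
- have dZ := smooth_on_diff sZ It; have dh := smooth_on_diff hs It.
  by rewrite /covD derive_scale // chrisZr derive1E scalerBr addrA.
have MA := cM It; have [U [F [oU UA Fs FY]]] := vY.1 _ MA.
have dF := smooth_on_diff Fs UA; have TX := vf_symtan vX MA.
rewrite levi_civitaE // (connE (F := F) (U := U)) // /covD /= Xc derive1E.
congr (_ - _); rewrite -derive_comp //; last exact: dc.
have nU := near_differentiable (dc t It) oU UA.
apply: near_eq_derive; apply: filterS2 nU (open_near oI It (fun u Iu => Iu)) => u Uu Iu.
by rewrite /= FY //; exact: cM.
Qed.

Section Uniqueness.
Context (P : (R -> E) -> R -> E).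
Context (Pcov : is_covariant_derivative_along M g I c P).

Lemma cov0 t : I t -> P (fun=> 0) t = 0.
Proof.
move=> It; have := ca_add Pcov field_along0 field_along0 It.
have -> : (fun u : R => 0 + 0 : E) = (fun=> 0) by apply/funext => u; rewrite addr0.
by move=> /eqP; rewrite -subr_eq0 opprD addrA subrr sub0r oppr_eq0 => /eqP.
Qed.

(** A field which vanishes on [I] equals its multiple by a function which is
    [0] on [I] and [1] outside; the Leibniz rule then shows that its covariant
    derivative vanishes on [I]. *)
Lemma cov_ext Z Z' t : field_along M I c Z -> (forall u, I u -> Z u = Z' u) ->
  I t -> P Z t = P Z' t.
Proof.
move=> fZ ZZ' It; pose W u := Z' u - Z u.
have W0 u : I u -> W u = 0 by move=> Iu; rewrite /W ZZ' // subrr.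
pose h (u : R) : R := if `[< I u >] then 0 else 1.
have hI u : I u -> 0 = h u by move=> Iu; rewrite /h; case: asboolP.
have hs : smooth_on I h by apply: smooth_on_ext oI hI _; exact: smooth_on_cst.
have fW : field_along M I c W.
  split; first by apply: (smooth_on_ext oI (f := fun=> 0)) => [u Iu|];
    [rewrite W0|exact: smooth_on_cst].
  by move=> u Iu; rewrite W0 //; apply: field_along0.2.
have hW : (fun u => h u *: W u) = W.
  apply/funext => u; rewrite /h; case: asboolP => Iu; last by rewrite scale1r.
  by rewrite scale0r W0.
have PW : P W t = 0.
  rewrite -hW (ca_leibniz Pcov hs fW It) -(hI t It) scale0r addr0 derive1E.
  have -> : 'D_1 h t = 0.
    rewrite -[RHS](derive_cst (0 : R) t (1 : R)); apply: near_eq_derive.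
    by apply: (open_near oI It) => u /hI.
  by rewrite scale0r.
have -> : Z' = (fun u => Z u + W u) by apply/funext => u; rewrite /W addrC subrK.
by rewrite (ca_add Pcov fZ fW It) PW addr0.
Qed.

(** The right-hand side does not mention [P]: the Leibniz rule reduces
    combinations of restricted fields to the Levi-Civita connection. The
    direction field [symfield b ('D_1 c t)] depends on [t]; it is only needed to
    have the velocity as its value at [c t]. *)
Lemma cov_sum (J : Type) (r : seq J) (f : J -> R -> R) (z : J -> E) t :
  I t -> (forall j, smooth_on I (f j)) -> (forall j, (z j)^T = z j) ->
  field_along M I c (fun u => \sum_(j <- r) f j u *: symfield b (z j) (c u)) /\
  P (fun u => \sum_(j <- r) f j u *: symfield b (z j) (c u)) t =
  \sum_(j <- r) ('D_1 (f j) t *: symfield b (z j) (c t) + f j t *: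
    levi_civita M g (symfield b ('D_1 c t)) (symfield b (z j)) (c t)).
Proof.
move=> It fs zs; elim: r => [|j r [IHf IHP]].
  have -> : (fun u => \sum_(j <- [::]) f j u *: symfield b (z j) (c u)) = (fun=> 0).
    by apply/funext => u; rewrite big_nil.
  by rewrite big_nil cov0 //; split=> //; exact: field_along0.
have -> : (fun u => \sum_(k <- j :: r) f k u *: symfield b (z k) (c u)) =
    (fun u => f j u *: symfield b (z j) (c u) +
      \sum_(k <- r) f k u *: symfield b (z k) (c u)).
  by apply/funext => u; rewrite big_cons.
have fX : field_along M I c (fun u => symfield b (z j) (c u)).
  apply: field_alongP => [|u Iu]; last exact: symfield_tan (cM Iu).
  have sc : smooth_on I (fun u => invmx (c u)).
    by apply: smooth_on_invmx => // u Iu; exact: symmfd_unit (cM Iu).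
  rewrite /symfield; apply: smooth_onB_mx => //; first exact: smooth_on_cst.
  apply: smooth_on_scale => //; apply: smooth_onM => //; first exact: smooth_on_cst.
  apply: smooth_onM => //; last exact: smooth_on_cst.
  apply: smooth_on_mxtrace => //; apply: smooth_on_mulmx => //; exact: smooth_on_cst.
have fhX := field_alongZ (fs j) fX.
split; first exact: field_alongD.
rewrite (ca_add Pcov fhX IHf It) IHP big_cons; congr (_ + _).
rewrite (ca_leibniz Pcov (fs j) fX It) derive1E; congr (_ + _ *: _).
have Tc := velocity_symtan oI It cs cM.
apply: (ca_restrict Pcov _ _ It).
- by apply: symfield_vf; case: Tc.
- exact: symfield_vf.
by rewrite derive1E symfieldE.
Qed.

End Uniqueness.

(** Along the curve, a tangent field is a combination with smooth coefficients
    of restrictions of finitely many global fields. *)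
Lemma cov_uniq P P' Z t : is_covariant_derivative_along M g I c P ->
  is_covariant_derivative_along M g I c P' -> field_along M I c Z -> I t ->
  P Z t = P' Z t.
Proof.
move=> HP HP' fZ It.
pose f (k : 'I_n * 'I_n) (u : R) : R := Z u k.1 k.2.
have fs k : smooth_on I (f k) by apply: smooth_on_entry => //; case: fZ.
have [z [zs sumz]] : exists z : 'I_n * 'I_n -> E, (forall k, (z k)^T = z k) /\
    (forall u, I u -> \sum_k f k u *: z k = Z u).
  exists (fun k => 2^-1 *: (delta_mx k.1 k.2 + delta_mx k.2 k.1)); split=> [k|u Iu].
    by rewrite linearZ linearD /= !trmx_delta addrC.
  have [Zs _] := along_symtan fZ Iu.
  have E1 : \sum_k f k u *: delta_mx k.1 k.2 = Z u.
    by rewrite [RHS]matrix_sum_delta pair_big.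
  have E2 : \sum_k f k u *: delta_mx k.2 k.1 = Z u.
    rewrite -[RHS]Zs -E1 linear_sum; apply: eq_bigr => k _.
    by rewrite linearZ /= trmx_delta.
  rewrite (eq_bigr (fun k => 2^-1 *: (f k u *: delta_mx k.1 k.2 +
      f k u *: delta_mx k.2 k.1))); last first.
    by move=> k _; rewrite scalerA mulrC -scalerA scalerDr.
  by rewrite -scaler_sumr big_split /= E1 E2 half_double.
have ZE u : I u -> Z u = \sum_k f k u *: symfield b (z k) (c u).
  move=> Iu; have TZ := along_symtan fZ Iu.
  rewrite -[LHS](symfieldE TZ) -{1}(sumz u Iu) /symfield.
  rewrite [RHS](eq_bigr (fun k => f k u *: z k -
     (b%:R * (\tr (invmx (c u) *m (f k u *: z k)) / n%:R)) *: c u)); last first.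
    by move=> k _; rewrite -(scalemxAr (f k u)) mxtraceZ scalerBr scalerA; congr (_ - _ *: _); ring.
  rewrite sumrB -scaler_suml -mulr_sumr -mulr_suml -linear_sum -mulmx_sumr.
  by rewrite /= sumz.
have fS := (cov_sum HP (index_enum _) It fs zs).1.
have S1 := (cov_sum HP (index_enum _) It fs zs).2.
have S2 := (cov_sum HP' (index_enum _) It fs zs).2.
by rewrite (cov_ext HP fZ ZE It) (cov_ext HP' fZ ZE It) S1 S2.
Qed.

End AlongCurve.

Lemma chris_diag A v : chris A v v = v *m invmx A *m v.
Proof. exact: half_double. Qed.

(** Since the covariant derivative along a curve is unique, it may be taken to be
    [covD]. *)
Lemma geodesicP b (I : set R) (c : R -> E) : open_interval I ->
  geodesic (symmfd b) g I c <->
  [/\ smooth_on I c, forall t, I t -> symmfd b (c t) &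
    forall t, I t -> 'D_1 ('D_1 c) t = 'D_1 c t *m invmx (c t) *m 'D_1 c t].
Proof.
move=> oiI; have [oI _ _] := oiI.
have c1 : c^`() = 'D_1 c by apply/funext => t; rewrite derive1E.
split=> [[_ cs cM [P [HP P0]]]|[cs cM ceq]].
  split=> // t It; apply/eqP; rewrite -subr_eq0 -chris_diag; apply/eqP.
  rewrite -[LHS]/(covD c ('D_1 c) t).
  have HP0 := covD_is_covariant oI cs cM.
  rewrite (cov_uniq oI cs cM HP0 HP (field_along_velocity oI cs cM) It) -c1.
  exact: P0.
split=> //; exists (covD c); split; first exact: covD_is_covariant.
by move=> t It; rewrite c1 /covD chris_diag ceq // subrr.
Qed.

Lemma geodesic_mxexp b (I : set R) (c : R -> E) K V : open_interval I ->
  symmfd b K -> symtan b K V ->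
  (forall t, I t -> c t = K *m mxexp (t *: (invmx K *m V))) ->
  geodesic (symmfd b) g I c.
Proof.
move=> oiI MK TV cE; have [oI _ _] := oiI; have Ku := symmfd_unit MK.
have [X XE] : exists X, X = invmx K *m V by eexists.
rewrite -XE in cE; pose e (t : R) := K *m mxexp (t *: X).
have e1 : 'D_1 e = (fun t => K *m X *m mxexp (t *: X)).
  by apply/funext => t; rewrite derive_mxexp.
have ce t : I t -> e t = c t by move=> It; rewrite cE.
have Dce t : I t -> 'D_1 e t = 'D_1 c t.
  by move=> It; apply: near_eq_derive; apply: (open_near oI It).
apply/geodesicP => //; split.
- by apply: smooth_on_ext oI ce _; apply: smooth_on_sub (smooth_on_mxexp K X).
- by move=> t It; rewrite cE // XE; exact: symtan_mxexp.
move=> t It; have <- : 'D_1 ('D_1 e) t = 'D_1 ('D_1 c) t.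
  by apply: near_eq_derive; apply: (open_near oI It) => u; exact: Dce.
rewrite -Dce // -ce // e1 derive_mxexp /e /= derive_mxexp.
have eu : K *m mxexp (t *: X) \in unitmx by rewrite unitmx_mul Ku mxexp_unit.
have C := mxexp_comm X t; move: (mxexp (t *: X)) C eu => F C Fu.
have -> : K *m X *m F = K *m F *m X by rewrite -!mulmxA C.
have -> : K *m X *m X *m F = K *m F *m X *m X.
  by rewrite -!mulmxA C [X *m (F *m X)]mulmxA C !mulmxA.
by rewrite -[RHS]mulmxA [invmx (K *m F) *m _]mulKmx.
Qed.

(** A geodesic satisfies [c'' = c' c^-1 c'], which says that [c^-1 c'] is a
    constant [X]; then [c (t) exp (- t X)] is constant too. *)
Lemma mxexp_of_geodesic b (I : set R) (c : R -> E) : open_interval I ->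
  geodesic (symmfd b) g I c -> exists K V, [/\ symmfd b K, symtan b K V &
    forall t, I t -> c t = K *m mxexp (t *: (invmx K *m V))].
Proof.
move=> oiI /(geodesicP b c oiI)[cs cM ceq]; have [oI iI [t0 It0]] := oiI.
have cu t : I t -> c t \in unitmx by move=> It; exact: symmfd_unit (cM t It).
have dc t : I t -> differentiable c t by move=> It; exact: smooth_on_diff cs It.
have dc' t : I t -> differentiable ('D_1 c) t.
  by move=> It; exact: smooth_on_diff (smooth_on_derive _ cs) It.
have di t : I t -> differentiable (fun t => invmx (c t)) t.
  by move=> It; exact: differentiable_invmx_comp (dc t It) (cu t It).
pose f t := invmx (c t) *m 'D_1 c t; pose X := f t0.
have fX t : I t -> f t = X.
  move=> It; apply: (derive0_cst_mx iI _ _ It It0) => u Iu.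
    by apply: differentiable_mulmx; [exact: di|exact: dc'].
  rewrite derive_mulmx; [|exact: di|exact: dc'].
  rewrite derive_invmx; [|exact: dc|exact: cu].
  by rewrite ceq // mulNmx !mulmxA addrC subrr.
have c1 t : I t -> 'D_1 c t = c t *m X by move=> It; rewrite -(fX t It) mulKVmx // cu.
pose r (t : R) : R := - t.
have dr t : differentiable r t by exact: differentiableN.
have Dr t : 'D_1 r t = - 1 by rewrite /r deriveN // derive_id.
have de t : differentiable (fun t => mxexp (r t *: X)) t.
  exact: (differentiable_comp (dr t) (differentiable_mxexp1 X (r t))).
have De t : 'D_1 (fun t => mxexp (r t *: X)) t = - (X *m mxexp (r t *: X)).
  rewrite (derive_comp (f := r) (g := fun y : R => mxexp (y *: X))) //.
    by rewrite Dr derive_scale1 ?derive_mxexp1 ?scaleN1r //; exact: differentiable_mxexp1.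
  exact: differentiable_mxexp1.
pose K := c t0 *m mxexp (r t0 *: X).
have cK t : I t -> c t *m mxexp (r t *: X) = K.
  move=> It; apply: (derive0_cst_mx (f := fun t => c t *m mxexp (r t *: X)) iI _ _ It It0) => u Iu.
    by apply: differentiable_mulmx; [exact: dc|exact: de].
  rewrite derive_mulmx; [|exact: dc|exact: de].
  by rewrite De c1 // mulmxN !mulmxA subrr.
pose A := c t0; pose v := 'D_1 c t0.
have MA : symmfd b A by exact: cM.
have TA : symtan b A v by exact: velocity_symtan oI It0 cs cM.
have cc := symtan_curve MA TA.
have MK : symmfd b K by exact: symtan_mxexp MA TA.
have Ku := symmfd_unit MK.
have TK : symtan b K (K *m X).
  have := @velocity_symtan b setT (fun t => A *m mxexp (t *: (invmx A *m v))) (r t0).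
  rewrite derive_mxexp -/(f t0) -/X -[c t0 *m _ *m _]mulmxA mxexp_comm mulmxA -/K.
  apply=> //; [exact: openT|exact: smooth_on_mxexp|].
  by move=> t _; exact: symtan_mxexp.
exists K, (K *m X); split=> // t It.
by rewrite mulKmx // -(cK t It) -mulmxA mxexpD addNr scale0r mxexp0 mulmx1.
Qed.

Lemma open_interval_setT : @open_interval R setT.
Proof. by split; [exact: openT|by []|exists 0]. Qed.

Lemma symmfd_geodesically_complete b : geodesically_complete (symmfd b) g.
Proof.
move=> I c geo; have [oiI _ _ _] := geo.
have [K [V [MK TV cE]]] := mxexp_of_geodesic oiI geo.
exists (fun t => K *m mxexp (t *: (invmx K *m V))); split.
  exact: geodesic_mxexp open_interval_setT MK TV _.
by move=> t /cE.
Qed.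

(** ** Orthonormal bases of the tangent spaces *)

Definition sgnr (i : 'I_n) : R := if (i < p)%N then 1 else -1.

Implicit Types (k l : 'I_n * 'I_n).

Local Notation D := (@sgn_mx R n p).

Lemma sgnr_sqr i : sgnr i * sgnr i = 1.
Proof. by rewrite /sgnr; case: ifP => _; rewrite ?mulr1 // mulN1r opprK. Qed.

Lemma sgnr_neq0 i : sgnr i != 0.
Proof. by rewrite /sgnr; case: ifP => _; rewrite ?oppr_eq0 oner_eq0. Qed.

Lemma sgn_mxE i j : D i j = sgnr i *+ (i == j).
Proof. by rewrite !mxE. Qed.

Lemma invmx_sgn : invmx D = D.
Proof.
have DD : D *m D = 1%:M.
  rewrite /sgn_mx mulmx_diag; apply/matrixP => i j; rewrite !mxE.
  by case: eqP => // _; rewrite sgnr_sqr.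
by rewrite -[LHS]mulmx1 -DD mulKmx // sgn_mx_unit.
Qed.

Lemma g_sgn (V W : E) : g D V W = \sum_i \sum_j sgnr i * sgnr j * V i j * W j i.
Proof.
rewrite /trace_metric invmx_sgn /sgn_mx -mulmxA mulmxA.
rewrite /mxtrace; apply: eq_bigr => i _; rewrite mxE; apply: eq_bigr => j _.
by rewrite mul_mx_diag mul_diag_mx mxE mxE mxE !mxE /sgnr; ring.
Qed.

Let i0 : 'I_n := Ordinal n_gt0.

(** The first row of this orthogonal matrix makes the position vector [D] a
    member of the basis, up to a scalar. *)
Lemma exists_sgn_frame : exists H : E,
  H *m H^T = 1%:M /\ row i0 H = (Num.sqrt (n%:R))^-1 *: \row_j sgnr j.
Proof.
apply: exists_orthogonal_row; rewrite mulmx_trE; congr _%:M.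
rewrite qform1E (eq_bigr (fun=> n%:R^-1)); last first.
  move=> j _; rewrite !mxE exprMn exprVn sqr_sqrtr ?ler0n // expr2 sgnr_sqr.
  by rewrite mulr1.
by rewrite sumr_const card_ord -[_ *+ n]mulr_natl mulfV // natr_n0.
Qed.

Definition frame : E := sval (cid exists_sgn_frame).

Lemma frame_orth : frame *m frame^T = 1%:M.
Proof. by have [] := svalP (cid exists_sgn_frame). Qed.

Lemma frame_row0 j : frame i0 j = (Num.sqrt (n%:R))^-1 * sgnr j.
Proof.
have [_ /rowP/(_ j)] := svalP (cid exists_sgn_frame).
by rewrite -/frame !mxE.
Qed.

(** The pairs [i < j] index the off-diagonal elementary symmetric matrices and the
    pairs [(i, i)] the diagonal matrices of the rows of [frame]. *)
Definition ebase (k : 'I_n * 'I_n) : E :=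
  if k.1 == k.2 then diag_mx (row k.1 frame)
  else (Num.sqrt 2)^-1 *: (delta_mx k.1 k.2 + delta_mx k.2 k.1).

Definition esgn (k : 'I_n * 'I_n) : R := sgnr k.1 * sgnr k.2.

Lemma ebase_tr k : (ebase k)^T = ebase k.
Proof.
rewrite /ebase; case: ifP => _; first by rewrite tr_diag_mx.
by rewrite linearZ linearD /= !trmx_delta addrC.
Qed.

Lemma g_ebase_diag i (W : E) : g D (ebase (i, i)) W = \sum_j frame i j * W j j.
Proof.
rewrite g_sgn; apply: eq_bigr => j _; rewrite /ebase /= eqxx (bigD1 j) //= big1.
  by rewrite !mxE eqxx mulr1n addr0 sgnr_sqr mul1r.
by move=> k kj; rewrite !mxE eq_sym (negbTE kj) mulr0n mulr0 mul0r.
Qed.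

Lemma g_delta i j (W : E) : g D (delta_mx i j) W = sgnr i * sgnr j * W j i.
Proof.
rewrite g_sgn (bigD1 i) //= [X in _ + X]big1 ?addr0; last first.
  by move=> k ki; rewrite big1 // => l _; rewrite mxE (negbTE ki) mulr0 mul0r.
rewrite (bigD1 j) //= big1 ?addr0 ?mxE ?eqxx ?mulr1 //.
by move=> l lj; rewrite mxE (negbTE lj) andbF mulr0 mul0r.
Qed.

Lemma sqrt2_neq0 : Num.sqrt (2 : R) != 0.
Proof. by rewrite gt_eqF // sqrtr_gt0. Qed.

Lemma sqrt2_half (a : R) : (Num.sqrt (2 : R))^-1 * (a + a) = Num.sqrt 2 * a.
Proof.
have s2 : Num.sqrt (2 : R) * Num.sqrt 2 = 2 by rewrite -expr2 sqr_sqrtr.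
have -> : a + a = Num.sqrt 2 * (Num.sqrt 2 * a) by rewrite mulrA s2 mulr_natl mulr2n.
by rewrite mulKf // sqrt2_neq0.
Qed.

Lemma g_ebase_off i j (W : E) : i != j -> W^T = W ->
  g D (ebase (i, j)) W = Num.sqrt 2 * (sgnr i * sgnr j * W i j).
Proof.
move=> ij Ws; rewrite /ebase /= (negbTE ij) gZl gDl !g_delta.
have -> : W j i = W i j by rewrite -{1}Ws mxE.
by rewrite (mulrC (sgnr j)) sqrt2_half.
Qed.

Lemma ebase_orthonormal (k l : 'I_n * 'I_n) : (k.1 <= k.2)%N -> (l.1 <= l.2)%N ->
  g D (ebase k) (ebase l) = if k == l then esgn k else 0.
Proof.
case: k l => [i j] [i' j'] /= ij ij'; have [ij_eq|ij_neq] := eqVneq i j.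
  rewrite -ij_eq g_ebase_diag /ebase /=.
  have [ij'_eq|ij'_neq] := eqVneq i' j'.
    rewrite -ij'_eq xpair_eqE andbb /esgn /= sgnr_sqr.
    have E1 : \sum_j frame i j * frame i' j = (i == i')%:R.
      have := congr1 (fun M : E => M i i') frame_orth; rewrite mxE [RHS]mxE => <-.
      by apply: eq_bigr => m _; rewrite [in RHS]mxE.
    rewrite (eq_bigr (fun j => frame i j * frame i' j)) ?E1; last first.
      by move=> m _; rewrite !mxE eqxx mulr1n.
    by case: eqP.
  rewrite big1; last first.
    move=> k _; rewrite !mxE; case: (k =P i') => [->|_] /=; last first.
      by rewrite andbF addr0 mulr0 mulr0.
    by rewrite (negbTE ij'_neq) addr0 mulr0 mulr0.
  by case: eqP => // -[] Ei Ej; rewrite -Ei -Ej eqxx in ij'_neq.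
rewrite g_ebase_off ?ebase_tr // /ebase /= xpair_eqE.
have [ij'_eq|ij'_neq] := eqVneq i' j'.
  rewrite !mxE (negbTE ij_neq) mulr0n !mulr0.
  by case: eqP => //= Ei; case: eqP => // Ej; rewrite Ei Ej ij'_eq eqxx in ij_neq.
rewrite !mxE (_ : (i == j') && (j == i') = false) ?addr0; last first.
  apply/negbTE/negP => /andP[/eqP Ei /eqP Ej].
  have lt1 : (i < j)%N by rewrite ltn_neqAle ij andbT.
  have lt2 : (i' < j')%N by rewrite ltn_neqAle ij' andbT.
  by rewrite -Ei -Ej in lt2; move: (ltn_trans lt1 lt2); rewrite ltnn.
case: ifP => _; last by rewrite !mulr0.
by rewrite mulr1 mulrCA mulfV ?mulr1 // sqrt2_neq0.
Qed.

(** Orthogonality to the off-diagonal members kills the off-diagonal entries, and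
    [frame] is invertible. *)
Lemma ebase_complete (W : E) : W^T = W ->
  (forall k : 'I_n * 'I_n, (k.1 <= k.2)%N -> g D (ebase k) W = 0) -> W = 0.
Proof.
move=> Ws H.
have off (i j : 'I_n) : (i < j)%N -> W i j = 0.
  move=> ij; have := H (i, j) (ltnW ij); rewrite g_ebase_off //; last first.
    by rewrite neq_ltn ij.
  move=> /eqP; rewrite mulf_eq0 (negbTE sqrt2_neq0) /= mulf_eq0 mulf_eq0.
  by rewrite !(negbTE (sgnr_neq0 _)) /= => /eqP.
have dW : \col_j W j j = 0.
  have FW : frame *m \col_j W j j = 0.
    apply/colP => i; rewrite mxE [RHS]mxE -[RHS](H (i, i) (leqnn _)) g_ebase_diag.
    by apply: eq_bigr => j _; rewrite mxE.
  by rewrite -[LHS]mul1mx -(mulmx1C frame_orth) -mulmxA FW mulmx0.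
apply/matrixP => i j; rewrite [RHS]mxE.
case: (ltngtP i j) => [ij|ji|/val_inj ->]; first exact: off.
  by rewrite -Ws mxE off.
by have /colP/(_ j) := dW; rewrite !mxE.
Qed.

(** The member [(i0, i0)] is proportional to the position vector [D], which is
    normal to the hypersurface of constant determinant. *)
Definition index_set b : seq ('I_n * 'I_n) :=
  [seq k : 'I_n * 'I_n <- enum {: 'I_n * 'I_n} | (k.1 <= k.2)%N && ~~ (b && (k == (i0, i0)))].

Lemma mem_index_set b k :
  (k \in index_set b) = (k.1 <= k.2)%N && ~~ (b && (k == (i0, i0))).
Proof. by rewrite mem_filter mem_enum andbT. Qed.

Lemma ebase00 : ebase (i0, i0) = (Num.sqrt n%:R)^-1 *: D.
Proof.
apply/matrixP => i j; rewrite /ebase /= mxE [RHS]mxE sgn_mxE mxE frame_row0.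
by case: eqP => // _; rewrite mulr0.
Qed.

Lemma g_ebase00 (W : E) : g D (ebase (i0, i0)) W = (Num.sqrt n%:R)^-1 * \tr (invmx D *m W).
Proof. by rewrite ebase00 gZl g_self // sgn_mx_unit. Qed.

Lemma sqrtn_neq0 : Num.sqrt (n%:R : R) != 0.
Proof. by rewrite gt_eqF // sqrtr_gt0 ltr0n. Qed.

Lemma ebase_symtan b k : k \in index_set b -> symtan b D (ebase k).
Proof.
rewrite mem_index_set => /andP[k12 k0]; split; first exact: ebase_tr.
move=> bT; rewrite bT /= in k0.
have := @ebase_orthonormal (i0, i0) k (leqnn _) k12.
rewrite g_ebase00 eq_sym (negbTE k0) => /eqP.
by rewrite mulf_eq0 invr_eq0 (negbTE sqrtn_neq0) => /eqP.
Qed.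

Lemma esgn_sqr k : esgn k * esgn k = 1.
Proof. by rewrite /esgn mulrACA !sgnr_sqr mulr1. Qed.

Lemma esgn_neg k : (k.1 <= k.2)%N ->
  esgn k = if (k.1 < p)%N && (p <= k.2)%N then -1 else 1.
Proof.
move=> k12; rewrite /esgn /sgnr; have [k1p|pk1] := ltnP k.1 p.
  by have [|] := ltnP k.2 p; rewrite mul1r.
have -> : (k.2 < p)%N = false by apply/negbTE; rewrite -leqNgt (leq_trans pk1).
by rewrite mulN1r opprK.
Qed.

Definition neg_index b := [seq k : 'I_n * 'I_n <- index_set b | (k.1 < p)%N && (p <= k.2)%N].
Definition pos_index b := [seq k : 'I_n * 'I_n <- index_set b | ~~ ((k.1 < p)%N && (p <= k.2)%N)].

Lemma card_lt_p : #|[pred i : 'I_n | (i < p)%N]| = p.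
Proof.
rewrite -[RHS](card_ord p) -(card_codom (f := widen_ord pn)).
  apply: eq_card => i; rewrite inE; apply/idP/codomP => [ip|[j ->]]; last exact: (valP j).
  by exists (Ordinal ip); apply: val_inj.
by move=> i j /(congr1 val) ij; apply: val_inj.
Qed.

Lemma size_filter_enum (T : finType) (a : pred T) :
  size [seq k <- enum T | a k] = #|[pred k | a k]|.
Proof.
rewrite cardE [in RHS]/enum_mem -enumT; congr size; exact: eq_filter.
Qed.

Lemma size_neg_index b : size (neg_index b) = (p * (n - p))%N.
Proof.
rewrite /neg_index /index_set -filter_predI size_filter_enum.
rewrite (eq_card (B := [predX [pred i : 'I_n | (i < p)%N] & [pred i : 'I_n | (p <= i)%N]])).
  rewrite cardX card_lt_p; congr (_ * _)%N.
  have := cardC [pred i : 'I_n | (i < p)%N]; rewrite card_lt_p card_ord => En.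
  rewrite -[in RHS]En addKn; apply: eq_card => i; by rewrite !inE -leqNgt.
move=> k; rewrite !inE /=.
case: (ltnP k.1 p) => //= k1; case: (leqP p k.2) => //= k2.
rewrite (ltnW (leq_trans k1 k2)) /=; apply/negP => /andP[_ /eqP k0].
by move: k1 k2; rewrite k0 /= => lt0 le0; have := leq_trans lt0 le0; rewrite ltnn.
Qed.

Lemma size_index_set b : size (index_set b) = ((n * n.+1)./2 - b)%N.
Proof.
have full : #|[pred k : 'I_n * 'I_n | (k.1 <= k.2)%N]| = ((n * n.+1)./2)%N.
  rewrite -sum1_card (eq_bigl (fun k : 'I_n * 'I_n => true && (k.1 <= k.2)%N)) //.
  rewrite -(pair_big_dep xpredT (fun i j : 'I_n => (i <= j)%N) (fun _ _ => 1%N)) /=.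
  rewrite (exchange_big_dep xpredT) //= (eq_bigr (fun j : 'I_n => j.+1)); last first.
    move=> j _; rewrite sum1_card -[RHS](card_ord j.+1).
    rewrite -(card_codom (f := widen_ord (ltn_ord j))).
      apply: eq_card => i; rewrite unfold_in; apply/idP/codomP => [ij|[k ->]].
        by exists (Ordinal (ij : (i < j.+1)%N)); apply: val_inj.
      exact: (valP k).
    by move=> i k /(congr1 val) ik; apply: val_inj.
  have := bin2_sum n.+1; rewrite big_nat_recl // add0n bin2 /= mulnC => <-.
  by rewrite big_mkord.
rewrite /index_set size_filter_enum -full.
case: b => /=; last first.
  by rewrite subn0; apply: eq_card => k; rewrite !inE andbT.
rewrite [in RHS](cardD1 (i0, i0)) !inE /= addKn.
by apply: eq_card => k; rewrite !inE andbC.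
Qed.

Lemma size_pos_index b : size (pos_index b) = ((n * n.+1)./2 - p * (n - p) - b)%N.
Proof.
have := size_index_set b.
rewrite -(count_predC (fun k => (k.1 < p)%N && (p <= k.2)%N)) -!size_filter.
rewrite -/(neg_index b) size_neg_index => E1.
rewrite subnAC -E1 addKn; congr size; exact: eq_filter.
Qed.

(** Pairing a vanishing combination with a member isolates its coefficient up to
    sign. *)
Lemma free_orthonormal (A : E) (s : seq ('I_n * 'I_n)) (e : 'I_n * 'I_n -> E) :
  uniq s -> {in s &, forall k l, g A (e k) (e l) = if k == l then esgn k else 0} ->
  free (map e s).
Proof.
move=> us on; rewrite -[map e s]/(val (in_tuple (map e s))); apply/freeP => a a0 i.
have si : (i < size s)%N by rewrite -(size_map e).
have ei (j : 'I_(size (map e s))) : (in_tuple (map e s))`_j = e (nth (i0, i0) s j).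
  by rewrite (nth_map (i0, i0)) // -(size_map e).
have mi (j : 'I_(size (map e s))) : nth (i0, i0) s j \in s.
  by rewrite mem_nth // -(size_map e).
have := congr1 (fun V => g A V (e (nth (i0, i0) s i))) a0.
have -> : g A 0 (e (nth (i0, i0) s i)) = 0 by rewrite /trace_metric mulmx0 !mul0mx mxtrace0.
have gsum (F : 'I_(size (map e s)) -> E) w :
    g A (\sum_j F j) w = \sum_j g A (F j) w.
  by rewrite /trace_metric mulmx_sumr !mulmx_suml linear_sum.
rewrite gsum (bigD1 i) //= big1 ?addr0; last first.
  move=> j ji; have sj : (j < size s)%N by rewrite -(size_map e).
  rewrite gZl ei on // nth_uniq //.
  by rewrite (negbTE (_ : j != i :> nat)) ?mulr0 // val_eqE.
rewrite gZl ei on // eqxx => /eqP; rewrite mulf_eq0 => /orP[/eqP //|/eqP s0].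
by have := esgn_sqr (nth (i0, i0) s i); rewrite s0 mulr0 => /esym/eqP; rewrite oner_eq0.
Qed.

Lemma symtanD b A v w : symtan b A v -> symtan b A w -> symtan b A (v + w).
Proof.
move=> [v1 v2] [w1 w2]; split; first by rewrite linearD /= v1 w1.
by move=> bT; rewrite mulmxDr mxtraceD v2 // w2 // addr0.
Qed.

Lemma symtanZ b A a v : symtan b A v -> symtan b A (a *: v).
Proof.
move=> [v1 v2]; split; first by rewrite linearZ /= v1.
by move=> bT; rewrite -scalemxAr mxtraceZ v2 // mulr0.
Qed.

Lemma symtan0 b A : symtan b A 0.
Proof. by split; [rewrite linear0|rewrite mulmx0 linear0]. Qed.

Lemma tr_inv_congr (P A v : E) : P \in unitmx -> A \in unitmx ->
  \tr (invmx (congruence P A) *m congruence P v) = \tr (invmx A *m v).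
Proof. by move=> Pu Au; rewrite -!g_self ?congr_unit // g_congr. Qed.

Lemma symtan_congr b (P A v : E) : P \in unitmx -> A \in unitmx ->
  symtan b A v -> symtan b (congruence P A) (congruence P v).
Proof.
move=> Pu Au [vs vt]; split.
  by rewrite /congruence !trmx_mul trmxK vs mulmxA.
by move=> bT; rewrite tr_inv_congr // vt.
Qed.

Lemma congrK (P v : E) : P \in unitmx -> congruence P (congruence (invmx P) v) = v.
Proof.
by move=> Pu; rewrite /congruence !mulmxA mulmxV // mul1mx trmx_inv mulmxKV // unitmx_tr.
Qed.

Lemma g_suml A (J : Type) (r : seq J) (F : J -> E) w :
  g A (\sum_(j <- r) F j) w = \sum_(j <- r) g A (F j) w.
Proof. by rewrite /trace_metric mulmx_sumr !mulmx_suml linear_sum. Qed.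

Section FrameAt.
Context (b : bool) (P : E) (s : seq ('I_n * 'I_n)).
Context (Pu : P \in unitmx) (us : uniq s) (si : s =i index_set b).
Local Notation A := (congruence P D).
Local Notation e := (fun k => congruence P (ebase k)).

Lemma frame_at_orthonormal :
  {in s &, forall k l, g A (e k) (e l) = if k == l then esgn k else 0}.
Proof.
move=> k l; rewrite !si !mem_index_set => /andP[k12 _] /andP[l12 _].
by rewrite g_congr ?sgn_mx_unit // ebase_orthonormal.
Qed.

Lemma frame_at_symtan k : k \in s -> symtan b A (e k).
Proof.
rewrite si => ks; apply: symtan_congr => //; first exact: sgn_mx_unit.
exact: ebase_symtan.
Qed.

(** The difference of a tangent vector and its expansion is orthogonal to the
    whole family, including the position vector if that was left out. *)
Lemma frame_at_span w : w \in <<map e s>>%VS <-> symtan b A w.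
Proof.
split=> [ws|Tw].
  rewrite (coord_span (X := in_tuple (map e s)) ws).
  apply: big_ind => [|u v Tu Tv|j _]; first exact: symtan0.
    exact: symtanD.
  apply: symtanZ; have js : (j < size s)%N by rewrite -(size_map e).
  rewrite (nth_map (i0, i0)) //; apply: frame_at_symtan; exact: mem_nth.
pose w' := w - \sum_(k <- s) (esgn k * g A w (e k)) *: e k.
have Tw' : symtan b A w'.
  apply: symtanD => //; rewrite -scaleN1r; apply: symtanZ.
  rewrite big_seq; apply: big_ind => [|u v Tu Tv|k ks]; first exact: symtan0.
    exact: symtanD.
  by apply: symtanZ; exact: frame_at_symtan.
have Du : D \in unitmx := sgn_mx_unit n p.
have ort k : (k.1 <= k.2)%N -> g A (e k) w' = 0.
  move=> k12; have [ks|] := boolP (k \in s); last first.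
    rewrite si mem_index_set k12 /= negbK => /andP[bT /eqP ->].
    rewrite -(congrK w' Pu) g_congr // g_ebase00 -(tr_inv_congr _ Pu) // congrK //.
    by rewrite (Tw'.2 bT) mulr0.
  rewrite gC gDl gNl g_suml (bigD1_seq k) //= gZl.
  rewrite frame_at_orthonormal // eqxx mulrAC esgn_sqr mul1r.
  rewrite big_seq_cond big1 ?addr0 ?subrr // => l /andP[ls lk].
  by rewrite gZl frame_at_orthonormal // (negbTE lk) mulr0.
have W0 : congruence (invmx P) w' = 0.
  apply: ebase_complete => [|k k12].
    by rewrite /congruence !trmx_mul trmxK Tw'.1 mulmxA.
  by rewrite -(g_congr _ _ Pu Du) congrK // ort.
have /eqP : w' = 0 by rewrite -(congrK w' Pu) W0 /congruence mulmx0 mul0mx.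
rewrite subr_eq0 => /eqP ->; rewrite big_seq; apply: rpred_sum => k ks.
by apply: rpredZ; apply: memv_span; apply: map_f.
Qed.

End FrameAt.

(** [scalar_product] asks for the positive directions to come first. *)
Definition pn_index b := pos_index b ++ neg_index b.

Lemma perm_pn_index b : perm_eq (pn_index b) (index_set b).
Proof. by rewrite perm_catC perm_filterC. Qed.

Lemma uniq_pn_index b : uniq (pn_index b).
Proof. by rewrite (perm_uniq (perm_pn_index b)) filter_uniq // enum_uniq. Qed.

Lemma mem_pn_index b : pn_index b =i index_set b.
Proof. exact: perm_mem (perm_pn_index b). Qed.

Definition pos_dim b := ((n * n.+1)./2 - p * (n - p) - b)%N.

Lemma size_pn_index b : size (pn_index b) = (pos_dim b + p * (n - p))%N.
Proof. by rewrite size_cat size_pos_index size_neg_index. Qed.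

Lemma esgn_pn_index b i : (i < size (pn_index b))%N ->
  esgn (nth (i0, i0) (pn_index b) i) = if (i < pos_dim b)%N then 1 else -1.
Proof.
move=> ilt; rewrite nth_cat size_pos_index -/(pos_dim b); case: ltnP => ip.
  have : nth (i0, i0) (pos_index b) i \in pos_index b.
    by apply: mem_nth; rewrite size_pos_index.
  rewrite mem_filter mem_index_set => /andP[/negbTE kp /andP[k12 _]].
  by rewrite esgn_neg // kp.
have : nth (i0, i0) (neg_index b) (i - pos_dim b) \in neg_index b.
  apply: mem_nth; rewrite -(ltn_add2r (pos_dim b)) subnK // size_neg_index addnC.
  by rewrite -size_pn_index.
rewrite mem_filter mem_index_set => /andP[kp /andP[k12 _]].
by rewrite esgn_neg // kp.
Qed.

Lemma symmfd_congrP b A : symmfd b A -> exists2 P : E, P \in unitmx & A = congruence P D.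
Proof. by move=> MA; have [P Pu AE] := (GLSymP A pn).1 (symmfd_GL MA); exists P. Qed.

Lemma memv_tspace b A v : symmfd b A -> v \in tspace (symmfd b) A <-> symtan b A v.
Proof.
move=> MA; have [P Pu AE] := symmfd_congrP MA.
pose L0 := <<map (fun k => congruence P (ebase k)) (pn_index b)>>%VS.
have H : exists L1 : {vspace E},
    [set L : {vspace E} | forall u, u \in L <-> tangent (symmfd b) A u] L1.
  exists L0 => u /=; rewrite (tangentP u MA) AE.
  exact: (frame_at_span Pu (uniq_pn_index b) (mem_pn_index b)).
rewrite -(tangentP v MA); exact: (xgetPex 0%VS H).
Qed.

Lemma scalar_product_tspace b A : symmfd b A ->
  scalar_product (tspace (symmfd b) A) (g A) (pos_dim b) (p * (n - p)).
Proof.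
move=> MA; have [P Pu AE] := symmfd_congrP MA; split.
- by move=> u v _ _; exact: gC.
- by move=> a u v w _ _ _; rewrite gDl gZl.
pose e k := congruence P (ebase k).
have st : size (map e (pn_index b)) == (pos_dim b + p * (n - p))%N.
  by rewrite size_map size_pn_index.
exists (Tuple st); split.
  apply/andP; split.
    apply/eqP/vspaceP => v; apply/idP/idP => vL.
      by apply/memv_tspace => //; rewrite AE; apply/(frame_at_span Pu (uniq_pn_index b) (mem_pn_index b)).
    by apply/(frame_at_span Pu (uniq_pn_index b) (mem_pn_index b)); rewrite -AE; apply/memv_tspace.
  apply: (free_orthonormal (A := A)); first exact: uniq_pn_index.
  by rewrite AE; apply: frame_at_orthonormal Pu (mem_pn_index b).
move=> i j; have sz := size_pn_index b.
have tE (k : 'I_(pos_dim b + p * (n - p))) : tnth (Tuple st) k = e (nth (i0, i0) (pn_index b) k).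
  by rewrite (tnth_nth 0) /= (nth_map (i0, i0)) // sz.
have mi (k : 'I_(pos_dim b + p * (n - p))) : nth (i0, i0) (pn_index b) k \in pn_index b.
  by rewrite mem_nth // sz.
rewrite !tE {1}AE (frame_at_orthonormal Pu (mem_pn_index b)) //.
rewrite nth_uniq ?sz ?uniq_pn_index // -[i == j]val_eqE; case: eqP => // _.
by rewrite esgn_pn_index // sz.
Qed.

(** ** Charts *)

Lemma dim_tspace b A : symmfd b A ->
  \dim (tspace (symmfd b) A) = (pos_dim b + p * (n - p))%N.
Proof.
move=> MA; have [_ _ [e [be _]]] := scalar_product_tspace MA.
exact: size_basis be.
Qed.

Lemma det_row_affine (B : E) (s : R) :
  \det (B + s *: delta_mx i0 i0) =
  \det B + s * (\det (B + delta_mx i0 i0) - \det B).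
Proof.
rewrite (@determinant_multilinear _ _ (B + s *: delta_mx i0 i0) B
  (B + delta_mx i0 i0) i0 (1 - s) s).
- by rewrite mulrBl mul1r mulrBr addrA addrAC.
- by apply/rowP => j; rewrite !mxE; ring.
- apply/matrixP => i j; rewrite !mxE eq_sym (negbTE (neq_lift _ _)).
  by rewrite mulr0 addr0.
apply/matrixP => i j; rewrite !mxE eq_sym (negbTE (neq_lift _ _)).
by rewrite mulr0 !addr0.
Qed.

(** Up to a congruence, a multiple of [N] is added to a single row. *)
Lemma det_rank1_affine (P B : E) (s : R) : P \in unitmx ->
  let N := congruence P (delta_mx i0 i0) in
  \det (B + s *: N) = \det B + s * (\det (B + N) - \det B).
Proof.
move=> Pu N; set B' := congruence (invmx P) B.
have BE : B = congruence P B' by rewrite congrK.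
have congrD s0 : B + s0 *: N = congruence P (B' + s0 *: delta_mx i0 i0).
  by rewrite {1}BE /N /congruence mulmxDr mulmxDl -scalemxAr -scalemxAl.
have dP C : \det (congruence P C) = \det P ^+ 2 * \det C.
  by rewrite !det_mulmx det_tr expr2 mulrAC.
have := congrD 1; rewrite !scale1r => ->; rewrite congrD BE !dP det_row_affine.
ring.
Qed.

(** The slope of the determinant in the direction of a unit diagonal matrix is a
    product of signs. *)
Lemma det_sgn_bump : \det (D + delta_mx i0 i0) - \det D != 0.
Proof.
have -> : D + delta_mx i0 i0 =
    diag_mx (\row_j (sgnr j + (j == i0)%:R)) :> E.
  apply/matrixP => i j; rewrite mxE sgn_mxE !mxE.
  have [<-|ij] := eqVneq i j; first by rewrite !mulr1n andbb.
  rewrite !mulr0n add0r; case: eqP => //= Ei; case: eqP => // Ej.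
  by rewrite Ei Ej eqxx in ij.
rewrite /sgn_mx !det_diag (bigD1 i0) //= [X in _ - X](bigD1 i0) //= !mxE eqxx.
rewrite (eq_bigr (fun j => sgnr j)); last first.
  by move=> j ji; rewrite !mxE (negbTE ji) addr0.
rewrite [X in _ - _ * X](eq_bigr (fun j => sgnr j)); last by move=> j ji; rewrite !mxE.
rewrite -mulrBl -/(sgnr i0) addrAC subrr add0r mul1r.
by apply/prodf_neq0 => j _; exact: sgnr_neq0.
Qed.

Lemma open_setI_preimage {V W : normedModType R} (O : set V) (O' : set W) (f : V -> W) :
  open O -> (forall x, O x -> differentiable f x) -> open O' ->
  open (O `&` f @^-1` O').
Proof.
move=> oO df oO'; rewrite openE => x [Ox O'x].
apply: filterI; first exact: open_nbhs_nbhs.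
exact: near_differentiable (df x Ox) oO' O'x.
Qed.

Lemma submanifold_GL : submanifold (pos_dim false + p * (n - p)) (symmfd false).
Proof.
move=> A MA; have [U [oU UA UB]] := GLSym_open pn MA.
exists U, U, id, id, (tspace (symmfd false) A).
have ids : smooth_on U (@id E) by exact: smooth_on_id.
split=> //; first exact: dim_tspace.
move=> x Ux; split=> [Mx|/(memv_tspace _ MA)[xs _]]; last exact: UB.
by apply/memv_tspace => //; split=> //; exact: symmfd_tr Mx.
Qed.

(** The chart straightens the hypersurface of constant determinant along the
    direction [N]: in the decomposition of the space of matrices into the kernel
    of [lam] and the line of [N], the second coordinate [lam] is replaced by the
    determinant, which is affine along [N] with slope [q]. *)
Lemma submanifold_SL : submanifold (pos_dim true + p * (n - p)) (symmfd true).
Proof.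
move=> A MA; have Au := symmfd_unit MA.
have [U0 [oU0 U0A U0B]] := GLSym_open pn (symmfd_GL MA).
have [P Pu AE] := symmfd_congrP MA.
pose N := congruence P (delta_mx i0 i0).
have Ns : N^T = N by rewrite /N /congruence !trmx_mul trmxK trmx_delta mulmxA.
pose q (B : E) : R := \det (B + N) - \det B.
have detN B s : \det (B + s *: N) = \det B + s * q B by exact: det_rank1_affine.
have qN B s : q (B + s *: N) = q B.
  have E1 : B + s *: N + N = B + (s + 1) *: N by rewrite scalerDl scale1r addrA.
  rewrite [LHS]/q E1 !detN; ring.
have Du : D \in unitmx := sgn_mx_unit n p.
have tau0 : \tr (invmx A *m N) != 0.
  rewrite AE tr_inv_congr // -g_self // gC g_delta sgn_mxE eqxx mulr1n sgnr_sqr mul1r.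
  exact: sgnr_neq0.
have qA : q A != 0.
  rewrite /q {1}AE /N /congruence -mulmxDl -mulmxDr -/(congruence P _) AE.
  rewrite /congruence !det_mulmx det_tr !(mulrAC _ _ (\det P)) -mulrBr mulf_neq0 //.
    by rewrite mulf_neq0 // -unitfE -unitmxE.
  exact: det_sgn_bump.
pose tau := \tr (invmx A *m N).
pose lam (B : E) : R := \tr (invmx A *m B) / tau.
have lamD B C : lam (B + C) = lam B + lam C.
  by rewrite /lam mulmxDr mxtraceD mulrDl.
have lamZ s B : lam (s *: B) = s * lam B.
  by rewrite /lam -scalemxAr mxtraceZ mulrA.
have lamN : lam N = 1 by rewrite /lam divff.
pose pr (B : E) : E := B - lam B *: N.
have prE B : B = pr B + lam B *: N by rewrite /pr subrK.
have lam_pr B : lam (pr B) = 0.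
  by rewrite /pr -scaleNr lamD lamZ lamN mulr1 subrr.
have prN B s : pr (B + s *: N) = pr B.
  by rewrite /pr lamD lamZ lamN mulr1 scalerDl opprD addrACA subrr addr0.
have pr_pr B : pr (pr B) = pr B by rewrite {1}/pr lam_pr scale0r subr0.
have q_pr B : q (pr B) = q B by rewrite [in RHS](prE B) qN.
pose delta : R := (-1) ^+ (n - p).
pose Phi (B : E) : E := pr B + (\det B - delta) *: N.
pose Psi (y : E) : E := pr y + ((lam y + delta - \det (pr y)) / q (pr y)) *: N.
have lam_Phi B : lam (Phi B) = \det B - delta.
  by rewrite /Phi lamD lam_pr add0r lamZ lamN mulr1.
have pr_Phi B : pr (Phi B) = pr B by rewrite /Phi prN pr_pr.
have PhiK B : q B != 0 -> Psi (Phi B) = B.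
  have dB : \det B = \det (pr B) + lam B * q B by rewrite {1}(prE B) detN q_pr.
  move=> qB; rewrite /Psi pr_Phi lam_Phi subrK q_pr dB.
  by rewrite [\det _ + _]addrC addrK mulfK // -prE.
have PsiK y : q (pr y) != 0 -> Phi (Psi y) = y.
  move=> qy; rewrite /Phi /Psi prN pr_pr detN divfK //.
  by rewrite [\det _ + _]addrC subrK addrK -prE.
have oT : open [set: E] := openT.
have slam : smooth_on setT lam.
  apply: smooth_onM => //; last exact: smooth_on_cst.
  apply: smooth_on_mxtrace => //; apply: smooth_on_mulmx => //.
    exact: smooth_on_cst.
  exact: smooth_on_id.
have sN (f : E -> R) O : open O -> smooth_on O f -> smooth_on O (fun B => f B *: N).
  by move=> oO fs; exact: smooth_onZ.
have spr : smooth_on setT pr.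
  by apply: smooth_onB_mx => //; [exact: smooth_on_id|exact: sN].
have sdet (O : set E) f : open O -> smooth_on O f -> smooth_on O (fun B : E => \det (f B) : R).
  by move=> oO fs; exact: smooth_on_det.
have sBR (O : set E) (f1 f2 : E -> R) : open O -> smooth_on O f1 -> smooth_on O f2 ->
    smooth_on O (fun B => f1 B - f2 B).
  move=> oO s1 s2; apply: smooth_onD => //.
  rewrite (_ : (fun x => - f2 x) = (fun x => -1 * f2 x)).
    by apply: smooth_onM => //; exact: smooth_on_cst.
  by apply/funext => x; rewrite mulN1r.
have sq : smooth_on setT q.
  apply: sBR => //; apply: sdet => //; last exact: smooth_on_id.
  by apply: smooth_onD => //; [exact: smooth_on_id|exact: smooth_on_cst].
have sqpr : smooth_on setT (fun y => q (pr y)).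
  by apply: smooth_on_ext sq => // y _; rewrite q_pr.
have sPhi : smooth_on setT Phi.
  apply: smooth_onD => //; apply: sN => //; apply: sBR => //.
    by apply: sdet => //; exact: smooth_on_id.
  exact: smooth_on_cst.
pose W := [set y : E | q (pr y) != 0].
have open_q (f : E -> R) : smooth_on setT f -> open [set B : E | f B != 0].
  move=> sf; rewrite -[[set B | _]]/(f @^-1` [set x : R | x != 0]).
  apply: open_comp; last exact: open_neq.
  by move=> B _; apply: differentiable_continuous; exact: smooth_on_diff sf I.
have oW : open W by exact: open_q.
have sPsi : smooth_on W Psi.
  apply: smooth_onD => //; first exact: smooth_on_sub spr.
  apply: sN => //; apply: smooth_onM => //.
    apply: sBR => //; last by apply: sdet => //; exact: smooth_on_sub spr.
    apply: smooth_onD => //; first exact: smooth_on_sub slam.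
    exact: smooth_on_cst.
  apply: smooth_onV => //; exact: smooth_on_sub sqpr.
exists (U0 `&` [set B : E | q B != 0]), (W `&` Psi @^-1` U0), Phi, Psi.
exists (tspace (symmfd true) A); split.
- split=> //; first by apply: openI => //; exact: open_q.
  apply: open_setI_preimage => // y Wy; exact: smooth_on_diff sPsi Wy.
- split; first exact: smooth_on_sub sPhi.
  move=> x [U0x qx]; rewrite PhiK //; split=> //.
  by split; rewrite /W /= ?pr_Phi ?q_pr // PhiK.
- split; first by apply: smooth_on_sub sPsi => y [].
  move=> y [Wy U0y]; rewrite PsiK //; split=> //; split=> //=.
  by rewrite /Psi qN.
- exact: dim_tspace.
move=> x [U0x qx].
have PhiE : Phi x = x + (\det x - delta - lam x) *: N.
  by rewrite /Phi /pr -addrA; congr (_ + _); rewrite -scaleNr -scalerDl addrC.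
have trPhi : \tr (invmx A *m Phi x) = (\det x - delta) * tau.
  by rewrite -lam_Phi /lam divfK.
split=> [Mx|/(memv_tspace _ MA)[xs xt]].
  apply/memv_tspace => //; split; last first.
    by move=> _; rewrite trPhi (symmfd_det Mx) subrr mul0r.
  by rewrite PhiE linearD linearZ /= Ns (symmfd_tr Mx).
have xsym : x^T = x.
  have : (Phi x)^T = Phi x := xs.
  by rewrite PhiE linearD linearZ /= Ns => /addIr.
split; first exact: U0B.
have := xt isT; rewrite trPhi => /eqP; rewrite mulf_eq0 (negbTE tau0) orbF.
by rewrite subr_eq0 => /eqP.
Qed.

Lemma semi_riemannian_symmfd b :
  semi_riemannian (symmfd b) g (pos_dim b) (p * (n - p)).
Proof.
split.
- by case: b; [exact: submanifold_SL|exact: submanifold_GL].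
- by move=> A MA; exact: scalar_product_tspace.
move=> X Y vX vY A MA.
have [U [F [G [_ [[oU UA Uu] [Fs FX] [Gs GY] _]]]]] :=
  smooth_map3 (@open_unitmx R n) (symmfd_unit MA) vX.1 vY.1 vY.1 MA.
exists U, (fun B => g B (F B) (G B)); split=> //.
  have iU : smooth_on U (fun B : E => invmx B) by exact: smooth_on_sub Uu smooth_on_inv.
  apply: smooth_on_mxtrace => //; apply: smooth_on_mulmx => //.
  by apply: smooth_on_mulmx => //; exact: smooth_on_mulmx.
by move=> B UB MB; rewrite FX // GY.
Qed.

(** ** Curvature *)

Lemma vector_fieldB b X Y : vector_field (symmfd b) X -> vector_field (symmfd b) Y ->
  vector_field (symmfd b) (fun A => X A - Y A).
Proof.
move=> vX vY; split=> A MA.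
  have [U [F [G [_ [[oU UA Uu] [Fs FX] [Gs GY] _]]]]] :=
    smooth_map3 (@open_unitmx R n) (symmfd_unit MA) vX.1 vY.1 vY.1 MA.
  exists U, (fun B => F B - G B); split=> //; first exact: smooth_onB_mx.
  by move=> B UB MB; rewrite FX // GY.
apply/tangentP => //; rewrite -scaleN1r; apply: symtanD; first exact: vf_symtan.
by apply: symtanZ; exact: vf_symtan.
Qed.

Lemma bracketE b X Y :
  bracket (symmfd b) X Y = (fun A => conn b X Y A - conn b Y X A).
Proof. by apply/funext => A; rewrite /conn /bracket [in RHS]chrisC opprB addrA subrK. Qed.

(** Leibniz rule for the bilinear pairing of a direction and a function, after the
    direction has been expanded in elementary matrices. *)
Lemma derive_derive_along (U : set E) (G H : E -> E) A v : open U -> U A ->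
  smooth_on U G -> smooth_on U H ->
  'D_v (fun B => 'D_(G B) H B) A = 'D_('D_v G A) H A + 'D_v ('D_(G A) H) A.
Proof.
move=> oU UA Gs Hs.
have dirE (W : E) B : U B -> 'D_W H B = \sum_i \sum_j W i j *: 'D_(delta_mx i j) H B.
  move=> UB; have dH := smooth_on_diff Hs UB.
  rewrite [in LHS](matrix_sum_delta W) deriveE // linear_sum.
  apply: eq_bigr => i _; rewrite linear_sum; apply: eq_bigr => j _.
  by rewrite linearZ -deriveE.
have dG := smooth_on_diff Gs UA.
have dDH w : differentiable ('D_w H) A by exact: smooth_on_diff (smooth_on_derive w Hs) UA.
have -> : 'D_v (fun B => 'D_(G B) H B) A =
    'D_v (fun B => \sum_i \sum_j G B i j *: 'D_(delta_mx i j) H B) A.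
  by apply: near_eq_derive; apply: (open_near oU UA) => B UB; exact: dirE.
have -> : 'D_v ('D_(G A) H) A =
    'D_v (fun B => \sum_i \sum_j G A i j *: 'D_(delta_mx i j) H B) A.
  by apply: near_eq_derive; apply: (open_near oU UA) => B UB; exact: dirE.
have dGH i j : differentiable (fun B => G B i j *: 'D_(delta_mx i j) H B) A.
  by apply: differentiable_scale => //; exact: differentiable_entry.
have dcH i j : differentiable (fun B => G A i j *: 'D_(delta_mx i j) H B) A.
  by apply: differentiable_scale.
rewrite (dirE _ A UA) !derive_sumf; [|by move=> i; exact: differentiable_sumf..].
rewrite -big_split; apply: eq_bigr => i _ /=.
rewrite !derive_sumf //; rewrite -big_split; apply: eq_bigr => j _ /=.
have dGij : differentiable (fun B => G B i j : R) A by exact: differentiable_entry.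
rewrite (derive_scale (a := fun B => G B i j)) // derive_entry //.
by rewrite (derive_scale (a := fun=> G A i j)) // derive_cst scale0r add0r.
Qed.

Lemma derive_chris (G H : E -> E) A v : A \in unitmx ->
  differentiable G A -> differentiable H A ->
  'D_v (fun B => chris B (G B) (H B)) A =
  chris A ('D_v G A) (H A) + chris A (G A) ('D_v H A) -
  2^-1 *: (G A *m invmx A *m v *m invmx A *m H A +
           H A *m invmx A *m v *m invmx A *m G A).
Proof.
move=> Au dG dH; have di := differentiable_invmx Au.
have d1 (F : E -> E) : differentiable F A ->
    differentiable (fun B => F B *m invmx B) A by move=> dF; exact: differentiable_mulmx.
have d2 (F F' : E -> E) : differentiable F A -> differentiable F' A ->
    differentiable (fun B => F B *m invmx B *m F' B) A.
  by move=> dF dF'; apply: differentiable_mulmx => //; exact: d1.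
have D2 (F F' : E -> E) : differentiable F A -> differentiable F' A ->
    'D_v (fun B => F B *m invmx B *m F' B) A =
    'D_v F A *m invmx A *m F' A + F A *m invmx A *m 'D_v F' A -
    F A *m invmx A *m v *m invmx A *m F' A.
  move=> dF dF'; rewrite derive_mulmx //; last exact: d1.
  rewrite derive_mulmx // derive_inv // mulmxN mulmxDl mulNmx !mulmxA.
  by rewrite addrAC.
rewrite /chris derive_scale //; last by apply: differentiableD; exact: d2.
rewrite derive_cst scale0r add0r deriveD' //; [|exact: d2..].
rewrite !D2 // -scalerDr -scalerBr; congr (_ *: _).
move: (G A *m _ *m v *m _ *m H A) (H A *m _ *m v *m _ *m G A) => a c.
move: ('D_v G A *m _ *m _) (_ *m _ *m 'D_v H A) ('D_v H A *m _ *m _) (_ *m _ *m 'D_v G A).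
move=> a1 a2 a3 a4; apply/matrixP => i j; rewrite !mxE; ring.
Qed.

(** With [x = invmx A *m u], and [y], [z] similarly, this is
    [- 4^-1 *: A *m [[x, y], z]]. *)
Definition curv A u v w : E :=
  4^-1 *: (v *m invmx A *m u *m invmx A *m w + w *m invmx A *m u *m invmx A *m v
    - u *m invmx A *m v *m invmx A *m w - w *m invmx A *m v *m invmx A *m u).

(** The first summand of each half comes from the derivative of the inverse in
    [chris]. *)
Lemma curv_chris A x y z :
  2^-1 *: (y *m invmx A *m x *m invmx A *m z + z *m invmx A *m x *m invmx A *m y)
  + chris A x (chris A y z)
  - (2^-1 *: (x *m invmx A *m y *m invmx A *m z + z *m invmx A *m y *m invmx A *m x)
     + chris A y (chris A x z)) = curv A x y z.
Proof.
rewrite /curv /chris -!scalemxAr -!scalemxAl !mulmxDl !mulmxDr !mulmxA.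
set i := invmx A.
move: (x *m i *m y *m i *m z) (y *m i *m x *m i *m z) (z *m i *m y *m i *m x)
  (z *m i *m x *m i *m y) (x *m i *m z *m i *m y) (y *m i *m z *m i *m x).
move=> m1 m2 m3 m4 m5 m6; apply/matrixP => a c; rewrite !mxE.
by field.
Qed.

(** The second derivatives [e0] cancel by symmetry, and the first derivatives
    of the fields by the definition of the bracket. *)
Lemma curvature_algebra (a1 a2 b1 b2 c1 c2 d1 d2 e0 h1 h2 k1 k2 : E) :
  (a1 + e0 - (b1 + c1 - h1) - (d1 - k1)) -
  (a2 + e0 - (b2 + c2 - h2) - (d2 - k2)) -
  ((a1 - a2) - (b1 - b2)) =
  (h1 + k1) - (h2 + k2) + (c2 - d1) + (d2 - c1).
Proof. by apply/matrixP => i j; rewrite !mxE; ring. Qed.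

Lemma curvatureE b X Y Z A : vector_field (symmfd b) X ->
  vector_field (symmfd b) Y -> vector_field (symmfd b) Z -> symmfd b A ->
  curvature (symmfd b) g X Y Z A = curv A (X A) (Y A) (Z A).
Proof.
move=> vX vY vZ MA; have Au := symmfd_unit MA.
have LC := levi_civita_symmfd b.
have [U [F [G [H [[oU UA Uu] [Fs FX] [Gs GY] [Hs HZ]]]]]] :=
  smooth_map3 (@open_unitmx R n) (symmfd_unit MA) vX.1 vY.1 vZ.1 MA.
have dF := smooth_on_diff Fs UA; have dG := smooth_on_diff Gs UA.
have dH := smooth_on_diff Hs UA.
(* Both iterated covariant derivatives in the curvature are instances. *)
have DD X1 Y1 F1 G1 : vector_field (symmfd b) X1 -> vector_field (symmfd b) Y1 ->
    smooth_on U F1 -> (forall B, U B -> symmfd b B -> F1 B = X1 B) ->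
    smooth_on U G1 -> (forall B, U B -> symmfd b B -> G1 B = Y1 B) ->
    levi_civita (symmfd b) g X1 (levi_civita (symmfd b) g Y1 Z) A =
    'D_('D_(X1 A) G1 A) H A + 'D_(X1 A) ('D_(Y1 A) H) A -
    (chris A ('D_(X1 A) G1 A) (Z A) + chris A (Y1 A) ('D_(X1 A) H A) -
     2^-1 *: (Y1 A *m invmx A *m X1 A *m invmx A *m Z A +
              Z A *m invmx A *m X1 A *m invmx A *m Y1 A)) -
    (chris A (X1 A) ('D_(Y1 A) H A) - chris A (X1 A) (chris A (Y1 A) (Z A))).
  move=> vX1 vY1 F1s F1X G1s G1Y; have dG1 := smooth_on_diff G1s UA.
  pose K B := 'D_(G1 B) H B - chris B (G1 B) (H B).
  have sD : smooth_on U (fun B => 'D_(G1 B) H B) by exact: smooth_on_derive_along.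
  have sC : smooth_on U (fun B => chris B (G1 B) (H B)).
    by apply: (smooth_on_chris (c := fun B => B)) => //; exact: smooth_on_id.
  have dK : differentiable K A.
    by apply: smooth_on_diff UA; exact: smooth_onB_mx.
  have KE B : U B -> symmfd b B -> K B = levi_civita (symmfd b) g Y1 Z B.
    move=> UB MB; rewrite levi_civitaE // (connE (F := H) (U := U)) //.
    - by rewrite /K G1Y // HZ.
    - exact: vf_symtan.
    exact: smooth_on_diff Hs UB.
  rewrite levi_civitaE //; last exact: (lc_field LC).
  rewrite (connE (F := K) (U := U)) //; last exact: vf_symtan.
  rewrite -(KE A UA MA) /K.
  have -> : 'D_(X1 A) (fun B => 'D_(G1 B) H B - chris B (G1 B) (H B)) A =
      'D_(X1 A) (fun B => 'D_(G1 B) H B) A - 'D_(X1 A) (fun B => chris B (G1 B) (H B)) A.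
    have dD := smooth_on_diff sD UA; have dC := smooth_on_diff sC UA.
    rewrite -[fun B => _ - _]/((fun B => 'D_(G1 B) H B) - (fun B => chris B (G1 B) (H B))).
    by rewrite deriveB //; exact: diff_derivable.
  rewrite (derive_derive_along _ oU UA G1s Hs) derive_chris // G1Y // HZ //.
  by rewrite -[- chris A (Y1 A) (Z A)]scaleN1r chrisDr chrisZr scaleN1r.
have vB : vector_field (symmfd b) (bracket (symmfd b) X Y).
  by rewrite bracketE; apply: vector_fieldB; exact: vector_field_conn.
have DB : levi_civita (symmfd b) g (bracket (symmfd b) X Y) Z A =
    ('D_('D_(X A) G A) H A - 'D_('D_(Y A) F A) H A) -
    (chris A ('D_(X A) G A) (Z A) - chris A ('D_(Y A) F A) (Z A)).
  rewrite levi_civitaE // (connE (F := H) (U := U)) //; last exact: vf_symtan.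
  have TX : tangent (symmfd b) A (X A) by exact: vX.2.
  have TY : tangent (symmfd b) A (Y A) by exact: vY.2.
  rewrite {1 2}/bracket (tderivE (F := G) TX oU UA) // (tderivE (F := F) TY oU UA) //.
  have DHB u w : 'D_(u - w) H A = 'D_u H A - 'D_w H A.
    by rewrite (deriveE (u - w) dH) (deriveE u dH) (deriveE w dH) linearB.
  have chrisB u w : chris A (u - w) (Z A) = chris A u (Z A) - chris A w (Z A).
    by rewrite -!(scaleN1r w) -(scaleN1r (chris A w _)) chrisDl chrisZl.
  by rewrite DHB chrisB.
rewrite /curvature (DD X Y F G) // (DD Y X G F) // DB.
rewrite (derive_comm_mx (X A) (Y A) oU UA Hs) curvature_algebra.
by rewrite !subrr !addr0 curv_chris.
Qed.

Lemma field_extP b A v : symmfd b A -> symtan b A v ->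
  vector_field (symmfd b) (field_ext (symmfd b) A v) /\ field_ext (symmfd b) A v A = v.
Proof.
move=> MA Tv.
have H : exists X, [set X : E -> E | vector_field (symmfd b) X /\ X A = v] X.
  by exists (symfield b v); split; [apply: symfield_vf; case: Tv|exact: symfieldE].
exact: (xgetPex (cst 0) H).
Qed.

Lemma curvature_atE b A u v w : symmfd b A ->
  symtan b A u -> symtan b A v -> symtan b A w ->
  curvature_at (symmfd b) g A u v w = curv A u v w.
Proof.
move=> MA Tu Tv Tw; rewrite /curvature_at.
have [vu ue] := field_extP MA Tu; have [vv ve] := field_extP MA Tv.
have [vw we] := field_extP MA Tw.
by rewrite curvatureE // ue ve we.
Qed.

(** ** Ricci tensor *)

(** The trace of an endomorphism of a subspace is the trace of any linear map on
    the whole space which extends it and takes its values in the subspace. *)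
Lemma trace_on_ext (L : {vspace E}) (f : E -> E) (F : {linear E -> E}) :
  (forall u, u \in L -> F u = f u) -> (forall u, F u \in L) ->
  trace_on L f = \sum_i \sum_j F (delta_mx i j) i j.
Proof.
move=> Ff FL; rewrite /trace_on.
have FE u : F u = \sum_(k < \dim L) coord (vbasis L) k (F u) *: (vbasis L)`_k.
  exact: coord_vbasis.
have -> : \sum_i \sum_j F (delta_mx i j) i j =
    \sum_i \sum_j \sum_(k < \dim L) coord (vbasis L) k (F (delta_mx i j)) * (vbasis L)`_k i j.
  apply: eq_bigr => i _; apply: eq_bigr => j _; rewrite {1}FE summxE.
  by apply: eq_bigr => k _; rewrite mxE.
rewrite [RHS](eq_bigr (fun i => \sum_(k < \dim L) \sum_j
    coord (vbasis L) k (F (delta_mx i j)) * (vbasis L)`_k i j)); last first.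
  by move=> i _; exact: exchange_big.
rewrite [RHS]exchange_big /=; apply: eq_bigr => k _.
rewrite -Ff; last by apply: vbasis_mem; rewrite mem_nth // size_tuple.
rewrite {1}[(vbasis L)`_k]matrix_sum_delta !linear_sum.
apply: eq_bigr => i _; rewrite !linear_sum; apply: eq_bigr => j _.
by rewrite !linearZ /= mulrC.
Qed.

(** The symmetrization extends [u |-> P *m u *m Q] from symmetric matrices to all
    matrices, as [trace_on_ext] requires. *)
Definition symprod (P Q : E) (u : E) : E := P *m (2^-1 *: (u + u^T)) *m Q.

Lemma symprod_linear P Q : linear (symprod P Q).
Proof.
move=> a u v; rewrite /symprod.
have -> : 2^-1 *: (a *: u + v + (a *: u + v)^T) =
    a *: (2^-1 *: (u + u^T)) + 2^-1 *: (v + v^T).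
  by apply/matrixP => i j; rewrite !mxE; ring.
move: (2^-1 *: (u + u^T)) (2^-1 *: (v + v^T)) => x y.
by rewrite mulmxDr mulmxDl -scalemxAr -scalemxAl.
Qed.

Lemma symprod_trace (P Q : E) :
  \sum_i \sum_j symprod P Q (delta_mx i j) i j =
  2^-1 * (\tr P * \tr Q + \tr (P *m Q^T)).
Proof.
have delta (a d : 'I_n) : P *m delta_mx a d *m Q = \matrix_(c, e) (P c a * Q d e).
  apply/matrixP => c e; rewrite !mxE (bigD1 d) //= big1 ?addr0.
    rewrite mxE (bigD1 a) //= big1 ?addr0 ?mxE ?eqxx ?mulr1 //.
    by move=> k ka; rewrite mxE (negbTE ka) mulr0.
  move=> k kb; rewrite mxE big1 ?mul0r // => l _.
  by rewrite mxE (negbTE kb) andbF mulr0.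
have -> : \sum_i \sum_j symprod P Q (delta_mx i j) i j =
    \sum_i \sum_j 2^-1 * (P i i * Q j j + P i j * Q i j).
  apply: eq_bigr => i _; apply: eq_bigr => j _.
  rewrite /symprod trmx_delta -scalemxAr -scalemxAl mulmxDr mulmxDl !delta.
  by rewrite !mxE.
under eq_bigr do rewrite -mulr_sumr big_split /=.
rewrite -mulr_sumr big_split /=; congr (_ * (_ + _)).
  by rewrite /mxtrace mulr_suml; apply: eq_bigr => i _; rewrite mulr_sumr.
rewrite /mxtrace; apply: eq_bigr => i _; rewrite mxE; apply: eq_bigr => j _.
by rewrite mxE.
Qed.

Lemma curv_symtan b A u v w : A^T = A -> A \in unitmx -> u^T = u -> v^T = v -> w^T = w ->
  symtan b A (curv A u v w).
Proof.
move=> As Au us vs ws; split.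
  rewrite /curv linearZ linearB linearB linearD /= !trmx_mul !trmx_inv As us vs ws !mulmxA.
  congr (_ *: _); rewrite [X in X - _ - _]addrC -!addrA; congr (_ + (_ + _)).
  by rewrite addrC.
move=> _; rewrite /curv -scalemxAr mxtraceZ !mulmxBr mulmxDr.
rewrite -[RHS](mulr0 4^-1); congr (_ * _).
set i := invmx A.
have rot (x y z : E) : \tr (i *m (x *m i *m y *m i *m z)) = tr3 A x y z.
  by rewrite /tr3 !mulmxA.
rewrite !linearB linearD /= !rot (tr3_rot A w u v) (tr3_rot A v u w) (tr3_rot A u w v).
by rewrite addrAC -!addrA; ring.
Qed.

(** [curv] is a combination of four operators [symprod]. Since [v] and [w] are
    trace-free relative to [A], the traces of the first two add up to [g A v w],
    those of the last two to [(n + 1) * g A v w]. *)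
Lemma ricci_symmfd A v w : symmfd true A -> symtan true A v -> symtan true A w ->
  ricci (symmfd true) g A v w = - (n%:R / 4) * g A v w.
Proof.
move=> MA [vs vt] [ws wt]; have Au := symmfd_unit MA; have As := symmfd_tr MA.
have Tv : symtan true A v by split.
have Tw : symtan true A w by split.
set i := invmx A; have is_ : i^T = i by rewrite /i trmx_inv As.
pose F u : E := 4^-1 *: (symprod (v *m i) (i *m w) u + symprod (w *m i) (i *m v) u
   - symprod 1%:M (i *m v *m i *m w) u - symprod (w *m i *m v *m i) 1%:M u).
have Flin : linear F.
  move=> a x y; rewrite /F !symprod_linear.
  move: (symprod _ _ x) (symprod _ _ x) (symprod _ _ x) (symprod _ _ x).
  move=> x1 x2 x3 x4.
  move: (symprod _ _ y) (symprod _ _ y) (symprod _ _ y) (symprod _ _ y).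
  move=> y1 y2 y3 y4.
  by apply/matrixP => k l; rewrite !mxE; ring.
pose FL : {linear E -> E} := HB.pack F (GRing.isLinear.Build _ _ _ _ _ Flin).
have FE u : F u = curv A (2^-1 *: (u + u^T)) v w.
  rewrite /F /symprod /curv -/i mul1mx mulmx1; set u' := 2^-1 *: _.
  by rewrite !mulmxA.
have symu u : (2^-1 *: (u + u^T))^T = 2^-1 *: (u + u^T) :> E.
  by rewrite linearZ linearD /= trmxK addrC.
rewrite /ricci (@trace_on_ext _ _ FL); first last.
- move=> u; apply/memv_tspace => //; rewrite /= FE; apply: curv_symtan => //.
- move=> u /(memv_tspace _ MA) Tu; rewrite curvature_atE //= FE Tu.1 half_double //.
rewrite (eq_bigr (fun a : 'I_n => \sum_(c < n) 4^-1 * (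
   symprod (v *m i) (i *m w) (delta_mx a c) a c +
   symprod (w *m i) (i *m v) (delta_mx a c) a c -
   symprod 1%:M (i *m v *m i *m w) (delta_mx a c) a c -
   symprod (w *m i *m v *m i) 1%:M (delta_mx a c) a c))); last first.
  move=> a _; apply: eq_bigr => c _; rewrite /= /F.
  move: (symprod _ _ _) (symprod _ _ _) (symprod _ _ _) (symprod _ _ _).
  by move=> x1 x2 x3 x4; rewrite !mxE.
under eq_bigr do rewrite -mulr_sumr !sumrB big_split /=.
rewrite -mulr_sumr !sumrB big_split /= !symprod_trace.
have t1 : \tr (v *m i) = 0 by rewrite mxtrace_mulC vt.
have t2 : \tr (w *m i) = 0 by rewrite mxtrace_mulC wt.
set G := g A v w.
have E5 : \tr (w *m i *m v *m i) = G.
  by rewrite mxtrace_mulC !mulmxA -/(trace_metric A w v) gC.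
have E3 : \tr (i *m v *m i *m w) = G by [].
have E1 : \tr (v *m i *m (i *m w)^T) = G.
  by rewrite trmx_mul ws is_ mulmxA mxtrace_mulC !mulmxA.
have E2 : \tr (w *m i *m (i *m v)^T) = G.
  by rewrite trmx_mul vs is_ mulmxA.
rewrite t1 t2 E1 E2 mul1mx mxtrace_tr E3 trmx1 mulmx1 E5 mxtrace1.
by field.
Qed.

(** ** Scalar curvature *)

(** The metric is nondegenerate. *)
Lemma gram_unit A : symmfd true A ->
  \matrix_(i < \dim (tspace (symmfd true) A), j < \dim (tspace (symmfd true) A))
    g A (vbasis (tspace (symmfd true) A))`_i (vbasis (tspace (symmfd true) A))`_j
  \in unitmx.
Proof.
move=> MA; set L := tspace _ _; set G := \matrix_(i, j) _.
rewrite -row_free_unit; apply/inj_row_free => x xG.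
pose u := \sum_(i < \dim L) x ord0 i *: (vbasis L)`_i.
have bL (i : 'I_(\dim L)) : (vbasis L)`_i \in L.
  by apply: vbasis_mem; rewrite mem_nth // size_tuple.
have uL : u \in L by apply: rpred_sum => i _; apply: rpredZ.
have u0 : u = 0.
  apply: (g_nondegenerate MA); first exact/memv_tspace.
  move=> z /(memv_tspace _ MA) zL; rewrite (coord_vbasis zL) gC g_suml big1 // => j _.
  rewrite gZl gC g_suml.
  have /rowP/(_ j) := xG; rewrite !mxE => E1.
  rewrite (eq_bigr (fun k : 'I_(\dim L) => x ord0 k * G k j)) ?E1 ?mulr0 //.
  by move=> k _; rewrite gZl mxE.
apply/rowP => j; rewrite mxE.
have /freeP := basis_free (vbasisP L); apply; exact: u0.
Qed.

Lemma scalar_curvature_symmfd A : symmfd true A ->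
  scalar_curvature (symmfd true) g A =
  - ((n%:R - 1) * n%:R * (n%:R + 2) / 8).
Proof.
move=> MA; rewrite /scalar_curvature; set L := tspace _ _.
set G := \matrix_(i, j) g _ _ _.
have Gu : G \in unitmx by exact: gram_unit.
have -> : \matrix_(i < \dim L, j < \dim L)
    ricci (symmfd true) g A (vbasis L)`_i (vbasis L)`_j = - (n%:R / 4) *: G.
  apply/matrixP => i j; rewrite !mxE.
  by apply: ricci_symmfd => //; apply/memv_tspace => //;
    apply: vbasis_mem; rewrite mem_nth // size_tuple.
rewrite -scalemxAr mulVmx // mxtraceZ mxtrace1.
have -> : \dim L = ((n * n.+1)./2 - 1)%N.
  by rewrite dim_tspace // -size_pn_index (perm_size (perm_pn_index _)) size_index_set.
have h1 : (1 <= (n * n.+1)./2)%N.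
  by rewrite half_gt0 (leq_trans (_ : 2 <= n.+1)%N) // leq_pmull.
rewrite natrB //.
have : ((n * n.+1)./2%:R : R) *+ 2 = n%:R * (n%:R + 1).
  rewrite -mulrnA muln2 natr1 -natrM; congr _%:R.
  by rewrite -[RHS]odd_double_half oddM /=; case: (odd n).
move=> E1.
have -> : ((n * n.+1)./2%:R : R) = n%:R * (n%:R + 1) / 2.
  by rewrite -E1 -[_ *+ 2]mulr_natr mulfK.
by field.
Qed.

End Manifolds.

Theorem proposition2p5 (R : realType) (n p : nat)
    (hn : (2 <= n)%N) (hp : (p <= n)%N) :
  let GL : set 'M[R]_n := GLSym p in
  let SL : set 'M[R]_n := SLSym p in
  let g : @metric R n := trace_metric in
  (* (a) *)
  ( semi_riemannian_submanifold SL GL g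
      ((n * n.+1)./2 - p * (n - p) - 1)%N (p * (n - p))%N
    /\ homogeneous SL g )
  /\
  (* (b) *)
  ( totally_geodesic SL GL g
    /\ (forall (I : set R) (c : R -> 'M[R]_n), open_interval I ->
          (geodesic SL g I c <->
           exists K V : 'M[R]_n,
             [/\ SL K, V^T = V, \tr (invmx K *m V) = 0 &
                 forall t, I t -> c t = K *m mxexp (t *: (invmx K *m V))]))
    /\ geodesically_complete SL g )
  /\
  (* (c) *)
  ( symmetric_manifold SL g
    /\ is_isometry SL g inversion
    /\ (forall C : 'M[R]_n, \det C = 1 \/ \det C = -1 ->
          is_isometry SL g (congruence C))
    /\ (forall Q : 'M[R]_n, SL Q ->
          symmetry_at SL g Q (congruence Q \o inversion)) )
  /\
  (* (d) *)
  ( einstein SL g (- (n%:R / 4))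
    /\ (forall A, SL A ->
          scalar_curvature SL g A =
            - ((n%:R - 1) * n%:R * (n%:R + 2) / 8)) ).
Proof.
move=> GL SL g; have n_gt0 : (0 < n)%N by exact: ltn_trans hn.
split; [split|split; [split; [|split]|split; [split; [|split; [|split]]|split]]].
- split.
  + exists (@pos_dim n p false), (p * (n - p))%N.
    exact: (semi_riemannian_symmfd n_gt0 hp false).
  + by move=> A [].
  exact: (semi_riemannian_symmfd n_gt0 hp true).
- exact: (symmfd_homogeneous hp).
- exact: (symmfd_totally_geodesic n_gt0 hp).
- move=> I c oI; split=> [geo|[K [V [MK Vs Vt cE]]]].
    have [K [V [MK [Vs Vt] cE]]] := mxexp_of_geodesic n_gt0 hp (b := true) oI geo.
    by exists K, V; split=> //; exact: Vt.
  by apply: (geodesic_mxexp n_gt0 hp (b := true) oI MK _ cE).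
- exact: (symmfd_geodesically_complete n_gt0 hp (b := true)).
- move=> Q MQ; exists (congruence Q \o inversion).
  exact: (symmfd_symmetry hp (b := true) MQ).
- exact: (inversion_isometry hp true).
- move=> C dC; have dC2 : \det C ^+ 2 = 1 by case: dC => ->; rewrite ?sqrrN expr1n.
  apply: (congruence_isometry hp (b := true)) => //.
  rewrite unitmxE unitfE; apply/eqP => dC0; move: dC2; rewrite dC0 expr0n /=.
  by move/esym/eqP; rewrite oner_eq0.
- by move=> Q MQ; exact: (symmfd_symmetry hp (b := true) MQ).
- move=> A v w MA Tv Tw.
  have Tv' := (tangentP hp (b := true) v MA).1 Tv.
  have Tw' := (tangentP hp (b := true) w MA).1 Tw.
  exact: (ricci_symmfd n_gt0 hp).
by move=> A MA; exact: (scalar_curvature_symmfd n_gt0 hp).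
Qed.
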